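(* Let $f\in\mathcal{A}$, let $$\mathcal{G}(z):=1-\frac{zf'(z)}{f(z)}+\frac{zf''(z)}{f'(z)},\qquad z\in\mathbb{D},$$ let $\varphi_L(z):=\sqrt{1+z}$ with the branch of the square root chosen so that $\varphi_L(0)=1$, and let $\beta\in\mathbb{R}$. Then each of the following is sufficient to imply $f\in\mathcal{S}^*_{Ne}$: (a) $1+\beta\,\mathcal{G}(z)\left(\dfrac{zf'(z)}{f(z)}\right)\prec\varphi_L(z)$, for $\beta\geq3(1-\log2)$; (b) $1+\beta\,\mathcal{G}(z)\prec\varphi_L(z)$, for $\beta\geq\dfrac{2\left(\sqrt2+\log2-\log(1+\sqrt2)-1\right)}{\log(5/3)}$; (c) $1+\beta\,\mathcal{G}(z)\left(\dfrac{zf'(z)}{f(z)}\right)^{-1}\prec\varphi_L(z)$, for $\beta\geq5\left(\sqrt2+\log2-\log(1+\sqrt2)-1\right)$. The bounds on $\beta$ are best possible.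
   Context: $\mathbb{D}=\{z\in\mathbb{C}:|z|<1\}$, $\mathcal{H}$ is the set of all analytic functions on $\mathbb{D}$, and $\mathcal{A}$ is the set of $f\in\mathcal{H}$ with $f(0)=0$ and $f'(0)=1$. For $f,g\in\mathcal{H}$, $f\prec g$ ($f$ is subordinate to $g$) means that there is $w\in\mathcal{H}$ with $w(0)=0$ and $|w(z)|<1$ for $z\in\mathbb{D}$ such that $f(z)=g(w(z))$ on $\mathbb{D}$; in particular, writing a subordination presupposes that both sides are analytic in $\mathbb{D}$ (the removable singularity of $zf'(z)/f(z)$ at $0$ being filled with value $1$). With $\varphi_{Ne}(z):=1+z-z^3/3$, $\mathcal{S}^*_{Ne}:=\{f\in\mathcal{A}:zf'(z)/f(z)\prec\varphi_{Ne}(z)\}$. $\log$ of a positive number is the natural logarithm. That a bound $\beta\ge\beta_0$ is best possible means that $\beta_0$ cannot be replaced by any smaller real number so that the implication remains valid for all $f\in\mathcal{A}$ and all $\beta$ at least that number. *)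

(* Defs.v *)
From Stdlib Require Import Reals Lra.
From Coquelicot Require Import Coquelicot.

Open Scope R_scope.

Definition unit_disk (z : C) : Prop := Cmod z < 1.

(* Functions are total on C; only their values on the open unit disk matter. *)
Definition analytic (F : C -> C) : Prop :=
  forall z : C, unit_disk z ->
    ex_derive (K := C_AbsRing) (V := C_NormedModule) F z.

Definition class_A (f : C -> C) : Prop :=
  analytic f /\ f (RtoC 0) = RtoC 0 /\ C_derive f (RtoC 0) = RtoC 1.

Definition subordinate (F g : C -> C) : Prop :=
  analytic F /\ analytic g /\
  exists w : C -> C,
    analytic w /\ w (RtoC 0) = RtoC 0 /\
    (forall z : C, unit_disk z -> Cmod (w z) < 1) /\
    (forall z : C, unit_disk z -> F z = g (w z)).

(* z f'(z) / f(z), with its removable singularity at 0 filled by the value 1. *)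
Definition zdlog (f : C -> C) (z : C) : C :=
  if Ceq_dec z (RtoC 0) then RtoC 1
  else (z * C_derive f z / f z)%C.

Definition calG (f : C -> C) (z : C) : C :=
  (RtoC 1 - zdlog f z + z * C_derive (C_derive f) z / C_derive f z)%C.

(* The points where no denominator of [zdlog f] and [calG f] vanishes; the
   origin is included because of the filled value of [zdlog f]. *)
Definition regular_point (f : C -> C) (z : C) : Prop :=
  (z <> RtoC 0 -> f z <> RtoC 0) /\ C_derive f z <> RtoC 0.

(* Division by 0 has a conventional value, so an expression E with the above
   denominators is only looked at where it is defined. "E is analytic in the
   disk" then means that the remaining singularities, if any, are removable:
   E coincides at the regular points with an analytic function F, which is the
   function to be subordinated. *)
Definition expr_subordinate (f E g : C -> C) : Prop :=
  exists F : C -> C,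
    (forall z : C, unit_disk z -> regular_point f z -> F z = E z) /\
    subordinate F g.

(* Principal square root: the root with nonnegative real part. *)
Definition Csqrt (z : C) : C :=
  (sqrt ((Cmod z + Re z) / 2),
   (if Rle_dec 0 (Im z) then 1 else -1) * sqrt ((Cmod z - Re z) / 2)).

Definition phi_L (z : C) : C := Csqrt (RtoC 1 + z)%C.

Definition phi_Ne (z : C) : C := (RtoC 1 + z - z ^ 3 / RtoC 3)%C.

(* A zero of f other than 0 is a pole of z f'(z) / f(z), so the analyticity
   required by [subordinate] already excludes such zeros. *)
Definition Sstar_Ne (f : C -> C) : Prop :=
  class_A f /\ subordinate (zdlog f) phi_Ne.

(* [E beta f] is the left-hand side of the subordination. *)
Definition sufficient_from (E : R -> (C -> C) -> C -> C) (beta0 : R) : Prop :=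
  forall (f : C -> C) (beta : R),
    class_A f -> beta0 <= beta ->
    expr_subordinate f (E beta f) phi_L -> Sstar_Ne f.

Definition best_possible (E : R -> (C -> C) -> C -> C) (beta0 : R) : Prop :=
  forall b : R, b < beta0 -> ~ sufficient_from E b.

Lemma Re_le_Cmod_abs (z : C) : - Cmod z <= Re z <= Cmod z.
Proof.
  exact (proj1 (Rabs_le_between _ _) (Rle_trans _ _ _ (Rmax_l _ _) (Rmax_Cmod z))).
Qed.

Lemma Csqrt_sqr (z : C) : (Csqrt z * Csqrt z)%C = z.
Proof.
  destruct (Re_le_Cmod_abs z) as [H1 H2].
  assert (Hm : Cmod z * Cmod z = Re z * Re z + Im z * Im z).
  { unfold Cmod, Re, Im. rewrite sqrt_sqrt; [ring | nra]. }
  assert (A : 0 <= (Cmod z + Re z) / 2) by lra.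
  assert (B : 0 <= (Cmod z - Re z) / 2) by lra.
  assert (P : sqrt ((Cmod z + Re z) / 2) * sqrt ((Cmod z - Re z) / 2)
              = Rabs (Im z) / 2).
  { rewrite <- sqrt_mult by assumption.
    replace (_ * _) with ((Rabs (Im z) / 2) * (Rabs (Im z) / 2)).
    - apply sqrt_square. pose proof (Rabs_pos (Im z)). lra.
    - pose proof (Rsqr_abs (Im z)) as Q. unfold Rsqr in Q. nra. }
  pose proof (sqrt_sqrt _ A) as SA. pose proof (sqrt_sqrt _ B) as SB.
  unfold Csqrt, Cmult; cbn [fst snd].
  set (s := sqrt ((Cmod z + Re z) / 2)) in *.
  set (t := sqrt ((Cmod z - Re z) / 2)) in *.
  transitivity (Re z, Im z); [| destruct z; reflexivity].
  destruct (Rle_dec 0 (Im z)) as [H | H]; f_equal.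
  - nra.
  - rewrite Rabs_pos_eq in P by assumption. nra.
  - nra.
  - rewrite Rabs_left in P by lra. nra.
Qed.

Lemma phi_L_0 : phi_L (RtoC 0) = RtoC 1.
Proof.
  unfold phi_L. rewrite Cplus_0_r. unfold Csqrt. rewrite Cmod_1. cbn.
  replace ((1 + 1) / 2) with 1 by lra. replace ((1 - 1) / 2) with 0 by lra.
  rewrite sqrt_1, sqrt_0, Rmult_0_r. reflexivity.
Qed.

(* Main.v *)
(** With [p = z f' / f] one has [calG f * p = z p'], so the three hypotheses say that
    [z u' = (sqrt (1 + w) - 1) / beta], [w] a Schwarz function, for [u = p - 1], [u = log p],
    [u = 1 - 1 / p] respectively.  For [|zeta| <= t] the value [sqrt (1 + zeta)] lies in the disk
    with diameter [sqrt (1 - t), sqrt (1 + t)]; integrating along radii, [u] takes its values in the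
    disk with diameter [-2 (1 - log 2) / beta, 2 (sqrt 2 + log 2 - log (1 + sqrt 2) - 1) / beta].
    For [beta] above the stated bound this forces [|p - 1| < 2 / 3], and this disk lies in
    [phi_Ne (D)], on which [phi_Ne] has an analytic inverse, because [|1 - z ^ 2 / 3| >= 2 / 3] on
    the unit circle.  The extremal [f] comes from [w = id]; there [p] is real on the real axis and
    leaves [phi_Ne (D) inter R = (1 / 3, 5 / 3)] when [beta] is smaller.

    [f'] may have zeros and [f] further zeros a priori.  So [p] is only identified near 0 with the
    analytic solution [P] of the differential equation, and the identity theorem applied to
    [z f' - P f] excludes zeros of [f] in the punctured disk. *)

(* Each threshold is decided by one end of the diameter. In (a) it is the left end, the longer one,
   with equality case [2 (1 - log 2) / beta = 2 / 3]. In (b) and (c) it is the right end: [exp u]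
   reaches [5 / 3] at [u = log (5 / 3)], and [1 / (1 - u)] reaches it at [u = 2 / 5]. There the left
   end has room to spare and crude decimal bounds settle it. A bound on [|u|] alone would be
   governed by the longer left end and would lose the constants of (b) and (c); this is why the
   off-centre disk is carried along.

   The function theory rests on Goursat's theorem for closed convex sets. Cauchy's formula follows
   by contracting a circle radially towards the point of evaluation, so that neither winding numbers
   nor homotopies occur. Power series are replaced by repeated division by [z], which preserves
   analyticity because the quotient is again a Cauchy integral. *)
Require Import Defs.
From Stdlib Require Import Reals.
From Stdlib Require Import Lra Lia Psatz ClassicalEpsilon.
From Coquelicot Require Import Coquelicot.
Open Scope R_scope.

(** * Complex derivatives *)


(* Stated by epsilon-delta because C_NormedModule and the absolute-value ring C_AbsRing carry
   different (equivalent) uniform structures, so that Coquelicot's product and composition rules do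
   not apply. *)
Definition is_cderive (f : C -> C) (z l : C) : Prop :=
  forall eps, 0 < eps -> exists delta, 0 < delta /\
    forall y, Cmod (y - z) < delta ->
      Cmod (f y - f z - l * (y - z)) <= eps * Cmod (y - z).

Definition is_curve_derive (g : R -> C) (t : R) (v : C) : Prop :=
  forall eps, 0 < eps -> exists delta, 0 < delta /\
    forall s, Rabs (s - t) < delta ->
      Cmod (g s - g t - v * (RtoC (s - t))) <= eps * Rabs (s - t).

Definition Ccontinuous (f : C -> C) (z : C) : Prop :=
  forall eps, 0 < eps -> exists delta, 0 < delta /\
    forall y, Cmod (y - z) < delta -> Cmod (f y - f z) < eps.

Definition curve_continuous (g : R -> C) (t : R) : Prop :=
  forall eps, 0 < eps -> exists delta, 0 < delta /\
    forall s, Rabs (s - t) < delta -> Cmod (g s - g t) < eps.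

Lemma Cmod_minus_sym (a b : C) : Cmod (a - b) = Cmod (b - a).
Proof. rewrite <- Cmod_opp. f_equal. ring. Qed.

Lemma Cmod_tri3 (a b c : C) : Cmod (a - c) <= Cmod (a - b) + Cmod (b - c).
Proof. replace (a - c)%C with ((a - b) + (b - c))%C by ring. apply Cmod_triangle. Qed.

Lemma Cmod_rev (a b : C) : Cmod a - Cmod b <= Cmod (a - b).
Proof.
  assert (H := Cmod_triangle (a - b) b).
  replace (a - b + b)%C with a in H by ring. lra.
Qed.

Lemma Cmod_sub_le (a b : C) : Cmod (a - b) <= Cmod a + Cmod b.
Proof. rewrite <- (Cmod_opp b). apply Cmod_triangle. Qed.

Lemma Cmod_sqr (z : C) : Cmod z * Cmod z = Re z * Re z + Im z * Im z.
Proof. unfold Cmod, Re, Im. rewrite sqrt_sqrt; [ring | nra]. Qed.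

Lemma Im_le_Cmod (z : C) : Rabs (Im z) <= Cmod z.
Proof. eapply Rle_trans; [apply Rmax_r | apply (Rmax_Cmod z)]. Qed.

Lemma Cmod_le_Re_Im (z : C) : Cmod z <= Rabs (Re z) + Rabs (Im z).
Proof.
  assert (H := Cmod_sqr z). assert (H0 := Cmod_ge_0 z).
  assert (A := Rabs_pos (Re z)). assert (B := Rabs_pos (Im z)).
  assert (E1 := Rsqr_abs (Re z)). assert (E2 := Rsqr_abs (Im z)). unfold Rsqr in *. nra.
Qed.

Lemma Cmod_zero (z : C) : Cmod z <= 0 -> z = (RtoC 0).
Proof. intros H. apply Cmod_eq_0. assert (A := Cmod_ge_0 z). lra. Qed.

Lemma Cmod_RtoC_pos (x : R) : 0 <= x -> Cmod (RtoC x) = x.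
Proof. intros H. rewrite Cmod_R. apply Rabs_pos_eq, H. Qed.

Lemma Cminus_nz (a b : C) : (a - b)%C <> (RtoC 0) -> a <> b.
Proof. intros H E. apply H. rewrite E. ring. Qed.

Lemma Cmod_lt_neq (a b : C) : Cmod a < Cmod b -> (b - a)%C <> (RtoC 0).
Proof.
  intros H E. assert (b = a) by (replace b with (a + (b - a))%C by ring; rewrite E; ring).
  subst. lra.
Qed.

Lemma is_derive_iff_is_cderive (f : C -> C) (z l : C) :
  is_derive (K := C_AbsRing) (V := C_NormedModule) f z l <-> is_cderive f z l.
Proof.
  split.
  - intros [_ H] eps He.
    specialize (H z (fun P HP => HP) (mkposreal eps He)).
    destruct H as [d Hd]. exists d. split; [apply cond_pos |].
    intros y Hy. specialize (Hd y Hy). simpl in Hd.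
    eapply Rle_trans; [| exact Hd]. right.
    change (Cmod (f y - f z - l * (y - z)) = Cmod ((f y - f z) - (y - z) * l))%C.
    f_equal; ring.
  - intros H. split; [apply is_linear_scal_l |].
    intros x Hx.
    (* The filter formulation quantifies over every limit of the neighbourhood filter of [z]; there
       is only one. *)
    assert (x = z) as ->.
    { symmetry. apply (is_filter_lim_locally_unique (K := C_AbsRing) (V := AbsRing_NormedModule C_AbsRing) z x Hx). }
    intros eps. destruct (H eps (cond_pos eps)) as [d [Hd H']].
    exists (mkposreal d Hd). intros y Hy. specialize (H' y Hy).
    eapply Rle_trans; [| exact H']. right.
    change (Cmod ((f y - f z) - (y - z) * l) = Cmod (f y - f z - l * (y - z)))%C.
    f_equal; ring.
Qed.

Lemma is_curve_derive_is_derive (g : R -> C) (t : R) (v : C) :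
  is_curve_derive g t v -> is_derive (K := R_AbsRing) (V := C_R_NormedModule) g t v.
Proof.
  intros H. split; [apply is_linear_scal_l |].
  intros x Hx.
  assert (x = t) as ->.
  { symmetry. apply (is_filter_lim_locally_unique (K := R_AbsRing) (V := AbsRing_NormedModule R_AbsRing) t x Hx). }
  intros eps. destruct (H eps (cond_pos eps)) as [d [Hd H']].
  exists (mkposreal d Hd). intros y Hy. specialize (H' y Hy).
  eapply Rle_trans; [| exact H']. right.
  etransitivity; [symmetry; exact (Cmod_norm _) |].
  f_equal. change (minus y t) with (y - t). rewrite scal_R_Cmult.
  change ((g y - g t) - RtoC (y - t) * v = g y - g t - v * RtoC (y - t))%C. ring.
Qed.

Lemma curve_continuous_continuous (g : R -> C) (t : R) :
  curve_continuous g t -> continuous (T := R_UniformSpace) (U := C_UniformSpace) g t.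
Proof.
  intros H. apply filterlim_locally. intros eps.
  destruct (H eps (cond_pos eps)) as [d [Hd H']].
  exists (mkposreal d Hd). intros y Hy. specialize (H' y Hy).
  apply (C_NormedModule_mixin_compat1 (g t) (g y)). exact H'.
Qed.

Lemma is_cderive_locally_ext (f g : C -> C) (z l : C) (d : R) :
  0 < d -> (forall y, Cmod (y - z) < d -> f y = g y) -> is_cderive f z l -> is_cderive g z l.
Proof.
  intros Hd Heq H eps He. destruct (H eps He) as [e [He' H']].
  exists (Rmin d e). split; [apply Rmin_pos; lra |].
  intros y Hy. rewrite <- !Heq.
  - apply H'. eapply Rlt_le_trans; [exact Hy | apply Rmin_r].
  - replace (z - z)%C with (RtoC 0) by ring. rewrite Cmod_0. lra.
  - eapply Rlt_le_trans; [exact Hy | apply Rmin_l].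
Qed.

Lemma is_cderive_ext (f g : C -> C) (z l : C) : (forall y, f y = g y) -> is_cderive f z l -> is_cderive g z l.
Proof. intros H. apply (is_cderive_locally_ext f g z l 1); [lra | auto]. Qed.

Lemma is_cderive_eq (f : C -> C) (z l m : C) : is_cderive f z l -> l = m -> is_cderive f z m.
Proof. intros H <-. exact H. Qed.

(** Serves wherever the remainder factors exactly through a square: inverse, square root, Cauchy
    integrals and the inverse of the cubic. *)
Lemma is_cderive_quadratic (f : C -> C) (z l : C) (K d : R) :
  0 < d -> 0 <= K ->
  (forall y, Cmod (y - z) < d -> Cmod (f y - f z - l * (y - z)) <= K * (Cmod (y - z) * Cmod (y - z))) ->
  is_cderive f z l.
Proof.
  intros Hd HK H eps He. exists (Rmin d (eps / (K + 1))).
  assert (0 < eps / (K + 1)) by (apply Rdiv_lt_0_compat; lra).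
  split; [apply Rmin_pos; lra |]. intros y Hy.
  assert (Cmod (y - z) < d) by (eapply Rlt_le_trans; [exact Hy | apply Rmin_l]).
  assert (Cmod (y - z) < eps / (K + 1)) by (eapply Rlt_le_trans; [exact Hy | apply Rmin_r]).
  eapply Rle_trans; [apply H; assumption |].
  assert (P := Cmod_ge_0 (y - z)).
  assert (E : eps = eps / (K + 1) * (K + 1)) by (field; lra).
  assert (K * Cmod (y - z) <= eps) by nra. nra.
Qed.

Lemma is_cderive_unique (f : C -> C) (z l m : C) : is_cderive f z l -> is_cderive f z m -> l = m.
Proof.
  intros H1 H2.
  apply is_derive_iff_is_cderive, is_C_derive_unique in H1.
  apply is_derive_iff_is_cderive, is_C_derive_unique in H2. congruence.
Qed.

Lemma is_cderive_Ccontinuous (f : C -> C) (z l : C) : is_cderive f z l -> Ccontinuous f z.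
Proof.
  intros H eps He. destruct (H 1 Rlt_0_1) as [d [Hd H']].
  assert (Hl := Cmod_ge_0 l).
  assert (0 < eps / (Cmod l + 2)) by (apply Rdiv_lt_0_compat; lra).
  exists (Rmin d (eps / (Cmod l + 2))). split; [apply Rmin_pos; lra |].
  intros y Hy.
  assert (Cmod (y - z) < d) by (eapply Rlt_le_trans; [exact Hy | apply Rmin_l]).
  assert (Cmod (y - z) < eps / (Cmod l + 2)) by (eapply Rlt_le_trans; [exact Hy | apply Rmin_r]).
  specialize (H' y H1).
  replace (f y - f z)%C with ((f y - f z - l * (y - z)) + l * (y - z))%C by ring.
  eapply Rle_lt_trans; [apply Cmod_triangle |]. rewrite Cmod_mult.
  assert (P := Cmod_ge_0 (y - z)).
  assert (E : eps = eps / (Cmod l + 2) * (Cmod l + 2)) by (field; lra). nra.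
Qed.

Lemma is_cderive_const (c z : C) : is_cderive (fun _ => c) z 0.
Proof.
  intros eps He. exists 1. split; [lra |]. intros y _.
  replace (c - c - 0 * (y - z))%C with (RtoC 0) by ring. rewrite Cmod_0.
  assert (P := Cmod_ge_0 (y - z)). nra.
Qed.

Lemma is_cderive_id (z : C) : is_cderive (fun y => y) z 1.
Proof.
  intros eps He. exists 1. split; [lra |]. intros y _.
  replace (y - z - 1 * (y - z))%C with (RtoC 0) by ring. rewrite Cmod_0.
  assert (P := Cmod_ge_0 (y - z)). nra.
Qed.

Lemma is_cderive_plus (f g : C -> C) (z l m : C) :
  is_cderive f z l -> is_cderive g z m -> is_cderive (fun y => f y + g y)%C z (l + m)%C.
Proof.
  intros Hf Hg eps He.
  destruct (Hf (eps / 2)) as [d [Hd H1]]; [lra |].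
  destruct (Hg (eps / 2)) as [e [He' H2]]; [lra |].
  exists (Rmin d e). split; [apply Rmin_pos; lra |]. intros y Hy.
  assert (Cmod (y - z) < d) by (eapply Rlt_le_trans; [exact Hy | apply Rmin_l]).
  assert (Cmod (y - z) < e) by (eapply Rlt_le_trans; [exact Hy | apply Rmin_r]).
  replace (f y + g y - (f z + g z) - (l + m) * (y - z))%C
    with ((f y - f z - l * (y - z)) + (g y - g z - m * (y - z)))%C by ring.
  eapply Rle_trans; [apply Cmod_triangle |].
  specialize (H1 y H). specialize (H2 y H0). lra.
Qed.

Lemma is_cderive_mult (f g : C -> C) (z l m : C) :
  is_cderive f z l -> is_cderive g z m -> is_cderive (fun y => f y * g y)%C z (l * g z + f z * m)%C.
Proof.
  intros Hf Hg eps He.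
  assert (Pf := Cmod_ge_0 (f z)). assert (Pg := Cmod_ge_0 (g z)). assert (Pl := Cmod_ge_0 l).
  set (M := Cmod (f z) + Cmod (g z) + Cmod l + 2).
  assert (HM : 0 < eps / (2 * M)) by (apply Rdiv_lt_0_compat; unfold M; lra).
  assert (EM : eps = 2 * (eps / (2 * M) * M)) by (field; unfold M; lra).
  destruct (Hf (eps / (2 * M))) as [d [Hd H1]]; [lra |].
  destruct (Hg (eps / (2 * M))) as [e [He' H2]]; [lra |].
  destruct (is_cderive_Ccontinuous g z m Hg (Rmin 1 (eps / (2 * M)))) as [e3 [He3 H3]];
    [apply Rmin_pos; lra |].
  exists (Rmin d (Rmin e e3)). split; [repeat apply Rmin_pos; lra |]. intros y Hy.
  assert (C1 : Cmod (y - z) < d) by (eapply Rlt_le_trans; [exact Hy | apply Rmin_l]).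
  assert (C2 : Cmod (y - z) < Rmin e e3) by (eapply Rlt_le_trans; [exact Hy | apply Rmin_r]).
  assert (C3 : Cmod (y - z) < e) by (eapply Rlt_le_trans; [exact C2 | apply Rmin_l]).
  assert (C4 : Cmod (y - z) < e3) by (eapply Rlt_le_trans; [exact C2 | apply Rmin_r]).
  specialize (H1 y C1). specialize (H2 y C3). specialize (H3 y C4).
  assert (H3a := Rlt_le_trans _ _ _ H3 (Rmin_l _ _)).
  assert (H3b := Rlt_le_trans _ _ _ H3 (Rmin_r _ _)).
  replace (f y * g y - f z * g z - (l * g z + f z * m) * (y - z))%C
    with ((f y - f z - l * (y - z)) * g y + l * (y - z) * (g y - g z)
          + f z * (g y - g z - m * (y - z)))%C by ring.
  eapply Rle_trans; [apply Cmod_triangle |].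
  eapply Rle_trans; [apply Rplus_le_compat_r, Cmod_triangle |].
  rewrite !Cmod_mult.
  assert (Hgy : Cmod (g y) <= Cmod (g z) + 1).
  { assert (Q := Cmod_rev (g y) (g z)). lra. }
  assert (P := Cmod_ge_0 (y - z)). assert (Pgy := Cmod_ge_0 (g y)).
  set (k := eps / (2 * M)) in *. set (n := Cmod (y - z)) in *.
  apply Rle_trans with (k * n * (Cmod (g z) + 1) + Cmod l * n * k + Cmod (f z) * (k * n)).
  - repeat apply Rplus_le_compat.
    + apply Rmult_le_compat; try apply Cmod_ge_0; auto.
    + apply Rmult_le_compat_l; [nra | lra].
    + apply Rmult_le_compat_l; lra.
  - rewrite EM. unfold M. assert (0 <= k * n) by nra. nra.
Qed.

Lemma is_cderive_scal (c : C) (f : C -> C) (z l : C) : is_cderive f z l -> is_cderive (fun y => c * f y)%C z (c * l)%C.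
Proof.
  intros H. replace (c * l)%C with (0 * f z + c * l)%C by ring.
  apply (is_cderive_mult (fun _ => c) f); [apply is_cderive_const | exact H].
Qed.

Lemma is_cderive_minus (f g : C -> C) (z l m : C) :
  is_cderive f z l -> is_cderive g z m -> is_cderive (fun y => f y - g y)%C z (l - m)%C.
Proof.
  intros Hf Hg. apply is_cderive_ext with (fun y => f y + (- (1)) * g y)%C; [intros; ring |].
  replace (l - m)%C with (l + (- (1)) * m)%C by ring.
  apply is_cderive_plus; [exact Hf | apply is_cderive_scal, Hg].
Qed.

Lemma is_cderive_comp (f g : C -> C) (z l m : C) :
  is_cderive f (g z) l -> is_cderive g z m -> is_cderive (fun y => f (g y)) z (l * m)%C.
Proof.
  intros Hf Hg eps He.
  assert (Pl := Cmod_ge_0 l). assert (Pm := Cmod_ge_0 m).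
  assert (A1 : 0 < eps / (2 * (Cmod m + 1))) by (apply Rdiv_lt_0_compat; lra).
  assert (A2 : 0 < eps / (2 * (Cmod l + 1))) by (apply Rdiv_lt_0_compat; lra).
  assert (E1 : eps = 2 * (eps / (2 * (Cmod m + 1)) * (Cmod m + 1))) by (field; lra).
  assert (E2 : eps = 2 * (eps / (2 * (Cmod l + 1)) * (Cmod l + 1))) by (field; lra).
  set (k1 := eps / (2 * (Cmod m + 1))) in *. set (k2 := eps / (2 * (Cmod l + 1))) in *.
  destruct (Hf k1 A1) as [d [Hd H1]].
  destruct (Hg (Rmin 1 k2)) as [e [He' H2]]; [apply Rmin_pos; lra |].
  destruct (is_cderive_Ccontinuous g z m Hg d Hd) as [e3 [He3 H3]].
  exists (Rmin e e3). split; [apply Rmin_pos; lra |]. intros y Hy.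
  assert (C3 : Cmod (y - z) < e) by (eapply Rlt_le_trans; [exact Hy | apply Rmin_l]).
  assert (C4 : Cmod (y - z) < e3) by (eapply Rlt_le_trans; [exact Hy | apply Rmin_r]).
  specialize (H1 (g y) (H3 y C4)). specialize (H2 y C3).
  assert (P := Cmod_ge_0 (y - z)).
  assert (H2a : Cmod (g y - g z - m * (y - z)) <= 1 * Cmod (y - z)).
  { eapply Rle_trans; [exact H2 |]. apply Rmult_le_compat_r; [exact P | apply Rmin_l]. }
  assert (H2b : Cmod (g y - g z - m * (y - z)) <= k2 * Cmod (y - z)).
  { eapply Rle_trans; [exact H2 |]. apply Rmult_le_compat_r; [exact P | apply Rmin_r]. }
  assert (H4 : Cmod (g y - g z) <= (Cmod m + 1) * Cmod (y - z)).
  { replace (g y - g z)%C with ((g y - g z - m * (y - z)) + m * (y - z))%C by ring.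
    eapply Rle_trans; [apply Cmod_triangle |]. rewrite Cmod_mult. lra. }
  replace (f (g y) - f (g z) - l * m * (y - z))%C
    with ((f (g y) - f (g z) - l * (g y - g z)) + l * (g y - g z - m * (y - z)))%C by ring.
  eapply Rle_trans; [apply Cmod_triangle |]. rewrite Cmod_mult.
  assert (k1 * Cmod (g y - g z) <= eps / 2 * Cmod (y - z)) by nra.
  assert (Cmod l * Cmod (g y - g z - m * (y - z)) <= eps / 2 * Cmod (y - z)).
  { apply Rle_trans with (Cmod l * (k2 * Cmod (y - z))); [nra |].
    assert (Cmod l * k2 <= eps / 2) by nra. nra. }
  lra.
Qed.

(** The remainder is exactly [(y - z)^2 / (z^2 y)], and [|y| >= |z| / 2] near [z]. *)
Lemma is_cderive_Cinv (z : C) : z <> (RtoC 0) -> is_cderive Cinv z (- / (z * z))%C.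
Proof.
  intros Hz. assert (Pz := proj1 (Cmod_gt_0 z) Hz).
  assert (0 < / (Cmod z * Cmod z * (Cmod z / 2))).
  { apply Rinv_0_lt_compat. repeat apply Rmult_lt_0_compat; lra. }
  apply is_cderive_quadratic with (/ (Cmod z * Cmod z * (Cmod z / 2))) (Cmod z / 2); [lra | lra |].
  intros y Hy.
  assert (Hy2 : Cmod z / 2 <= Cmod y).
  { assert (Q := Cmod_rev z y). rewrite Cmod_minus_sym in Hy. lra. }
  assert (Hy0 : y <> (RtoC 0)) by (apply Cmod_gt_0; lra).
  replace (/ y - / z - - / (z * z) * (y - z))%C with ((y - z) * (y - z) * / (z * z * y))%C
    by (field; auto).
  rewrite !Cmod_mult, Cmod_inv, !Cmod_mult by (repeat apply Cmult_neq_0; auto).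
  rewrite Rmult_comm. apply Rmult_le_compat_r; [nra |].
  apply Rinv_le_contravar; [repeat apply Rmult_lt_0_compat; lra |].
  apply Rmult_le_compat_l; nra.
Qed.

Lemma is_cderive_inv (f : C -> C) (z l : C) :
  is_cderive f z l -> f z <> (RtoC 0) -> is_cderive (fun y => / f y)%C z (- l / (f z * f z))%C.
Proof.
  intros H Hz. replace (- l / (f z * f z))%C with (- / (f z * f z) * l)%C by (field; auto).
  apply (is_cderive_comp Cinv f); [apply is_cderive_Cinv, Hz | exact H].
Qed.

Lemma is_cderive_div (f g : C -> C) (z l m : C) :
  is_cderive f z l -> is_cderive g z m -> g z <> (RtoC 0) ->
  is_cderive (fun y => f y / g y)%C z ((l * g z - f z * m) / (g z * g z))%C.
Proof.
  intros Hf Hg Hz.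
  replace ((l * g z - f z * m) / (g z * g z))%C
    with (l * / g z + f z * (- m / (g z * g z)))%C by (field; auto).
  apply (is_cderive_mult f (fun y => / g y)%C); [exact Hf | apply is_cderive_inv; auto].
Qed.

Lemma Ccontinuous_nz (f : C -> C) (z : C) :
  Ccontinuous f z -> f z <> (RtoC 0) -> exists d, 0 < d /\ forall y, Cmod (y - z) < d -> f y <> (RtoC 0).
Proof.
  intros H Hz. destruct (H (Cmod (f z))) as [d [Hd H']]; [apply Cmod_gt_0, Hz |].
  exists d. split; [exact Hd |]. intros y Hy E. specialize (H' y Hy).
  rewrite E, Cmod_minus_sym in H'. replace (f z - 0)%C with (f z) in H' by ring. lra.
Qed.

Lemma is_cderive_is_curve_derive (f : C -> C) (g : R -> C) (t : R) (l v : C) :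
  is_cderive f (g t) l -> is_curve_derive g t v -> is_curve_derive (fun s => f (g s)) t (l * v)%C.
Proof.
  intros Hf Hg eps He.
  assert (Pl := Cmod_ge_0 l). assert (Pm := Cmod_ge_0 v).
  assert (A1 : 0 < eps / (2 * (Cmod v + 1))) by (apply Rdiv_lt_0_compat; lra).
  assert (A2 : 0 < eps / (2 * (Cmod l + 1))) by (apply Rdiv_lt_0_compat; lra).
  assert (E1 : eps = 2 * (eps / (2 * (Cmod v + 1)) * (Cmod v + 1))) by (field; lra).
  assert (E2 : eps = 2 * (eps / (2 * (Cmod l + 1)) * (Cmod l + 1))) by (field; lra).
  set (k1 := eps / (2 * (Cmod v + 1))) in *. set (k2 := eps / (2 * (Cmod l + 1))) in *.
  destruct (Hf k1 A1) as [d [Hd H1]].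
  destruct (Hg (Rmin 1 k2)) as [e [He' H2]]; [apply Rmin_pos; lra |].
  assert (Hd' : 0 < d / (Cmod v + 1)) by (apply Rdiv_lt_0_compat; lra).
  exists (Rmin e (d / (Cmod v + 1))). split; [apply Rmin_pos; lra |]. intros y Hy.
  assert (C3 : Rabs (y - t) < e) by (eapply Rlt_le_trans; [exact Hy | apply Rmin_l]).
  assert (C4 : Rabs (y - t) < d / (Cmod v + 1)) by (eapply Rlt_le_trans; [exact Hy | apply Rmin_r]).
  specialize (H2 y C3).
  assert (P := Rabs_pos (y - t)).
  assert (H2a : Cmod (g y - g t - v * (RtoC (y - t))) <= 1 * Rabs (y - t)).
  { eapply Rle_trans; [exact H2 |]. apply Rmult_le_compat_r; [exact P | apply Rmin_l]. }
  assert (H2b : Cmod (g y - g t - v * (RtoC (y - t))) <= k2 * Rabs (y - t)).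
  { eapply Rle_trans; [exact H2 |]. apply Rmult_le_compat_r; [exact P | apply Rmin_r]. }
  assert (H4 : Cmod (g y - g t) <= (Cmod v + 1) * Rabs (y - t)).
  { replace (g y - g t)%C with ((g y - g t - v * (RtoC (y - t))) + v * (RtoC (y - t)))%C by ring.
    eapply Rle_trans; [apply Cmod_triangle |]. rewrite Cmod_mult, Cmod_R. lra. }
  assert (H5 : Cmod (g y - g t) < d).
  { eapply Rle_lt_trans; [exact H4 |].
    replace d with ((Cmod v + 1) * (d / (Cmod v + 1))) by (field; lra).
    apply Rmult_lt_compat_l; lra. }
  specialize (H1 (g y) H5).
  replace (f (g y) - f (g t) - l * v * RtoC (y - t))%C
    with ((f (g y) - f (g t) - l * (g y - g t)) + l * (g y - g t - v * RtoC (y - t)))%C by ring.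
  eapply Rle_trans; [apply Cmod_triangle |]. rewrite Cmod_mult.
  assert (k1 * Cmod (g y - g t) <= eps / 2 * Rabs (y - t)) by nra.
  assert (Cmod l * Cmod (g y - g t - v * RtoC (y - t)) <= eps / 2 * Rabs (y - t)).
  { apply Rle_trans with (Cmod l * (k2 * Rabs (y - t))); [nra |].
    assert (Cmod l * k2 <= eps / 2) by nra. nra. }
  lra.
Qed.

Lemma Ccontinuous_curve_continuous (f : C -> C) (g : R -> C) (t : R) :
  Ccontinuous f (g t) -> curve_continuous g t -> curve_continuous (fun s => f (g s)) t.
Proof.
  intros Hf Hg eps He. destruct (Hf eps He) as [d [Hd H1]].
  destruct (Hg d Hd) as [e [He' H2]]. exists e. split; auto.
Qed.

Lemma is_curve_derive_curve_continuous (g : R -> C) (t : R) (v : C) : is_curve_derive g t v -> curve_continuous g t.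
Proof.
  intros H eps He. destruct (H 1 Rlt_0_1) as [d [Hd H']].
  assert (Hl := Cmod_ge_0 v).
  assert (0 < eps / (Cmod v + 2)) by (apply Rdiv_lt_0_compat; lra).
  exists (Rmin d (eps / (Cmod v + 2))). split; [apply Rmin_pos; lra |].
  intros y Hy.
  assert (Rabs (y - t) < d) by (eapply Rlt_le_trans; [exact Hy | apply Rmin_l]).
  assert (Rabs (y - t) < eps / (Cmod v + 2)) by (eapply Rlt_le_trans; [exact Hy | apply Rmin_r]).
  specialize (H' y H1).
  replace (g y - g t)%C with ((g y - g t - v * RtoC (y - t)) + v * RtoC (y - t))%C by ring.
  eapply Rle_lt_trans; [apply Cmod_triangle |]. rewrite Cmod_mult, Cmod_R.
  assert (P := Rabs_pos (y - t)).
  assert (E : eps = eps / (Cmod v + 2) * (Cmod v + 2)) by (field; lra). nra.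
Qed.

Lemma is_derive_eps (f : R -> R) (t l : R) :
  is_derive f t l <->
  forall eps, 0 < eps -> exists delta, 0 < delta /\
    forall s, Rabs (s - t) < delta -> Rabs (f s - f t - l * (s - t)) <= eps * Rabs (s - t).
Proof.
  split.
  - intros [_ H] eps He.
    specialize (H t (fun P HP => HP) (mkposreal eps He)).
    destruct H as [d Hd]. exists d. split; [apply cond_pos |].
    intros y Hy. specialize (Hd y Hy).
    change (Rabs ((f y - f t) - (y - t) * l) <= eps * Rabs (y - t)) in Hd.
    rewrite (Rmult_comm l). exact Hd.
  - intros H. split; [apply is_linear_scal_l |].
    intros x Hx.
    assert (x = t) as ->.
    { symmetry. apply (is_filter_lim_locally_unique (K := R_AbsRing) (V := AbsRing_NormedModule R_AbsRing) t x Hx). }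
    intros eps. destruct (H eps (cond_pos eps)) as [d [Hd H']].
    exists (mkposreal d Hd). intros y Hy. specialize (H' y Hy).
    change (Rabs ((f y - f t) - (y - t) * l) <= eps * Rabs (y - t)).
    rewrite (Rmult_comm _ l). exact H'.
Qed.

Lemma is_curve_derive_pair (x y : R -> R) (t x' y' : R) :
  is_derive x t x' -> is_derive y t y' -> is_curve_derive (fun s => (x s, y s)) t (x', y').
Proof.
  intros Hx Hy eps He.
  destruct (proj1 (is_derive_eps _ _ _) Hx (eps / 2)) as [d [Hd H1]]; [lra |].
  destruct (proj1 (is_derive_eps _ _ _) Hy (eps / 2)) as [e [He' H2]]; [lra |].
  exists (Rmin d e). split; [apply Rmin_pos; lra |]. intros s Hs.
  specialize (H1 s (Rlt_le_trans _ _ _ Hs (Rmin_l _ _))).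
  specialize (H2 s (Rlt_le_trans _ _ _ Hs (Rmin_r _ _))).
  eapply Rle_trans; [apply Cmod_le_Re_Im |]. simpl.
  replace (x s + - x t + - (x' * (s - t) - y' * 0)) with (x s - x t - x' * (s - t)) by ring.
  replace (y s + - y t + - (x' * 0 + y' * (s - t))) with (y s - y t - y' * (s - t)) by ring.
  lra.
Qed.

Lemma is_curve_derive_Re (g : R -> C) (t : R) (v : C) : is_curve_derive g t v -> is_derive (fun s => Re (g s)) t (Re v).
Proof.
  intros H. apply is_derive_eps. intros eps He. destruct (H eps He) as [d [Hd H']].
  exists d. split; [exact Hd |]. intros s Hs. eapply Rle_trans; [| apply (H' s Hs)].
  eapply Rle_trans; [| apply re_le_Cmod]. right. f_equal.
  unfold Re, RtoC; simpl. ring.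
Qed.

Lemma is_curve_derive_line (a v : C) (t : R) : is_curve_derive (fun s => a + RtoC s * v)%C t v.
Proof.
  intros eps He. exists 1. split; [lra |]. intros s _.
  replace (a + RtoC s * v - (a + RtoC t * v) - v * RtoC (s - t))%C with (RtoC 0)
    by (rewrite RtoC_minus; ring).
  rewrite Cmod_0. assert (P := Rabs_pos (s - t)). nra.
Qed.

Lemma is_curve_derive_minus (f g : R -> C) (t : R) (l m : C) :
  is_curve_derive f t l -> is_curve_derive g t m -> is_curve_derive (fun s => f s - g s)%C t (l - m)%C.
Proof.
  intros Hf Hg eps He.
  destruct (Hf (eps / 2)) as [d [Hd H1]]; [lra |].
  destruct (Hg (eps / 2)) as [e [He' H2]]; [lra |].
  exists (Rmin d e). split; [apply Rmin_pos; lra |]. intros s Hs.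
  specialize (H1 s (Rlt_le_trans _ _ _ Hs (Rmin_l _ _))).
  specialize (H2 s (Rlt_le_trans _ _ _ Hs (Rmin_r _ _))).
  replace (f s - g s - (f t - g t) - (l - m) * RtoC (s - t))%C
    with ((f s - f t - l * RtoC (s - t)) - (g s - g t - m * RtoC (s - t)))%C by ring.
  eapply Rle_trans; [apply Cmod_sub_le |]. lra.
Qed.

(** * Integrals along segments *)


Definition is_CInt (f : R -> C) (a b : R) (l : C) : Prop :=
  is_RInt (V := C_R_NormedModule) f a b l.

Definition CInt (f : R -> C) (a b : R) : C := RInt (V := C_R_CompleteNormedModule) f a b.

Lemma is_CInt_CInt (f : R -> C) (a b : R) (l : C) : is_CInt f a b l -> CInt f a b = l.
Proof. intros H. apply (is_RInt_unique (V := C_R_CompleteNormedModule) f a b l H). Qed.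

Lemma CInt_correct (f : R -> C) (a b : R) :
  a <= b -> (forall t, a <= t <= b -> curve_continuous f t) -> is_CInt f a b (CInt f a b).
Proof.
  intros Hab H. apply (RInt_correct (V := C_R_CompleteNormedModule)).
  apply (ex_RInt_continuous (V := C_R_CompleteNormedModule)).
  intros t Ht. rewrite Rmin_left, Rmax_right in Ht by assumption.
  apply curve_continuous_continuous, H, Ht.
Qed.

Lemma is_CInt_ftc (F f : R -> C) (a b : R) :
  a <= b -> (forall t, a <= t <= b -> is_curve_derive F t (f t)) ->
  (forall t, a <= t <= b -> curve_continuous f t) -> is_CInt f a b (F b - F a)%C.
Proof.
  intros Hab HF Hf.
  apply (is_RInt_derive (V := C_R_CompleteNormedModule) F f a b);
    rewrite Rmin_left, Rmax_right by assumption; intros t Ht.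
  - apply is_curve_derive_is_derive, HF, Ht.
  - apply curve_continuous_continuous, Hf, Ht.
Qed.

Lemma is_CInt_ext (f g : R -> C) (a b : R) (l : C) :
  a <= b -> (forall t, a <= t <= b -> f t = g t) -> is_CInt f a b l -> is_CInt g a b l.
Proof.
  intros Hab H Hf. apply (is_RInt_ext (V := C_R_NormedModule) f); [| exact Hf].
  rewrite Rmin_left, Rmax_right by assumption. intros t Ht. apply H. lra.
Qed.

Lemma is_CInt_plus (f g : R -> C) (a b : R) (l m : C) :
  is_CInt f a b l -> is_CInt g a b m -> is_CInt (fun t => f t + g t)%C a b (l + m)%C.
Proof. apply (is_RInt_plus (V := C_R_NormedModule)). Qed.

Lemma is_CInt_minus (f g : R -> C) (a b : R) (l m : C) :
  is_CInt f a b l -> is_CInt g a b m -> is_CInt (fun t => f t - g t)%C a b (l - m)%C.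
Proof. apply (is_RInt_minus (V := C_R_NormedModule)). Qed.

(** The integral is that of a real vector space, so a complex factor has to be split into its
    components. *)
Lemma is_CInt_scal (c : C) (f : R -> C) (a b : R) (l : C) :
  is_CInt f a b l -> is_CInt (fun t => c * f t)%C a b (c * l)%C.
Proof.
  intros H.
  assert (H1 : is_RInt (V := R_NormedModule) (fun t => fst (f t)) a b (fst l))
    by apply (is_RInt_fct_extend_fst (U := R_NormedModule) (V := R_NormedModule) f a b l H).
  assert (H2 : is_RInt (V := R_NormedModule) (fun t => snd (f t)) a b (snd l))
    by apply (is_RInt_fct_extend_snd (U := R_NormedModule) (V := R_NormedModule) f a b l H).
  apply (is_RInt_fct_extend_pair (U := R_NormedModule) (V := R_NormedModule)
    (fun t => c * f t)%C a b (fst c * fst l - snd c * snd l) (fst c * snd l + snd c * fst l)).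
  - apply (is_RInt_minus (V := R_NormedModule) (fun t => fst c * fst (f t))
      (fun t => snd c * snd (f t))); apply (is_RInt_scal (V := R_NormedModule)); assumption.
  - apply (is_RInt_plus (V := R_NormedModule) (fun t => fst c * snd (f t))
      (fun t => snd c * fst (f t))); apply (is_RInt_scal (V := R_NormedModule)); assumption.
Qed.

Lemma is_CInt_bound (f : R -> C) (a b : R) (l : C) (M : R) :
  a <= b -> (forall t, a <= t <= b -> Cmod (f t) <= M) -> is_CInt f a b l -> Cmod l <= (b - a) * M.
Proof.
  intros Hab HM H. rewrite Cmod_norm.
  apply (norm_RInt_le_const (V := C_R_NormedModule) f a b l M Hab); [| exact H].
  intros t Ht. eapply Rle_trans; [right; symmetry; exact (Cmod_norm (f t)) | apply HM, Ht].
Qed.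

Lemma is_CInt_unique (f : R -> C) (a b : R) (l m : C) : is_CInt f a b l -> is_CInt f a b m -> l = m.
Proof. intros H1 H2. apply is_CInt_CInt in H1. apply is_CInt_CInt in H2. congruence. Qed.

Lemma is_CInt_const (c : C) (a b : R) : is_CInt (fun _ => c) a b (RtoC (b - a) * c)%C.
Proof. rewrite <- scal_R_Cmult. apply (is_RInt_const (V := C_R_NormedModule)). Qed.

Definition seg_int (f : C -> C) (a b : C) : C :=
  ((b - a) * CInt (fun t => f (a + RtoC t * (b - a))%C) 0 1)%C.

Definition seg_continuous (f : C -> C) (a b : C) : Prop :=
  forall t, 0 <= t <= 1 -> Ccontinuous f (a + RtoC t * (b - a))%C.

Lemma curve_continuous_line (a v : C) (t : R) : curve_continuous (fun s => a + RtoC s * v)%C t.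
Proof. eapply is_curve_derive_curve_continuous, is_curve_derive_line. Qed.

Lemma seg_continuous_curve_continuous (f : C -> C) (a b : C) (t : R) :
  seg_continuous f a b -> 0 <= t <= 1 -> curve_continuous (fun t => f (a + RtoC t * (b - a))%C) t.
Proof.
  intros H Ht. apply (Ccontinuous_curve_continuous f (fun t => a + RtoC t * (b - a))%C); [apply H, Ht | apply curve_continuous_line].
Qed.

Lemma seg_int_is_CInt (f : C -> C) (a b : C) : seg_continuous f a b ->
  is_CInt (fun t => (b - a) * f (a + RtoC t * (b - a)))%C 0 1 (seg_int f a b).
Proof.
  intros H. apply is_CInt_scal, CInt_correct; [lra |]. intros t Ht. apply seg_continuous_curve_continuous; assumption.
Qed.

Lemma seg_int_bound (f : C -> C) (a b : C) (M : R) : seg_continuous f a b ->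
  (forall t, 0 <= t <= 1 -> Cmod (f (a + RtoC t * (b - a))%C) <= M) ->
  Cmod (seg_int f a b) <= Cmod (b - a) * M.
Proof.
  intros H HM. unfold seg_int. rewrite Cmod_mult. apply Rmult_le_compat_l; [apply Cmod_ge_0 |].
  replace M with ((1 - 0) * M) by ring.
  apply is_CInt_bound with (fun t => f (a + RtoC t * (b - a))%C); [lra | exact HM |].
  apply CInt_correct; [lra |]. intros t Ht. apply seg_continuous_curve_continuous; assumption.
Qed.

Lemma seg_int_ftc (F f : C -> C) (a b : C) : seg_continuous f a b ->
  (forall t, 0 <= t <= 1 -> is_cderive F (a + RtoC t * (b - a))%C (f (a + RtoC t * (b - a))%C)) ->
  seg_int f a b = (F b - F a)%C.
Proof.
  intros H HF. eapply is_CInt_unique; [apply seg_int_is_CInt, H |].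
  replace (F b - F a)%C
    with (F (a + RtoC 1 * (b - a)) - F (a + RtoC 0 * (b - a)))%C by (f_equal; f_equal; try f_equal; ring).
  apply (is_CInt_ext (fun t => f (a + RtoC t * (b - a)) * (b - a))%C); [lra | intros; ring |].
  apply (is_CInt_ftc (fun t => F (a + RtoC t * (b - a))%C)); [lra | |].
  - intros t Ht. apply (is_cderive_is_curve_derive F (fun t => a + RtoC t * (b - a))%C); [apply HF, Ht | apply is_curve_derive_line].
  - intros t Ht. apply (Ccontinuous_curve_continuous (fun w => w * (b - a))%C (fun t => f (a + RtoC t * (b - a))%C)).
    + eapply is_cderive_Ccontinuous. apply (is_cderive_mult (fun w => w) (fun _ => (b - a)%C)); [apply is_cderive_id | apply is_cderive_const].
    + apply seg_continuous_curve_continuous; assumption.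
Qed.

Lemma seg_continuous_minus (f g : C -> C) (a b : C) :
  seg_continuous f a b -> seg_continuous g a b -> seg_continuous (fun z => f z - g z)%C a b.
Proof.
  intros Hf Hg t Ht eps He.
  destruct (Hf t Ht (eps / 2)) as [d [Hd H1]]; [lra |].
  destruct (Hg t Ht (eps / 2)) as [e [He' H2]]; [lra |].
  exists (Rmin d e). split; [apply Rmin_pos; lra |]. intros y Hy.
  specialize (H1 y (Rlt_le_trans _ _ _ Hy (Rmin_l _ _))).
  specialize (H2 y (Rlt_le_trans _ _ _ Hy (Rmin_r _ _))).
  set (z := (a + RtoC t * (b - a))%C) in *.
  replace (f y - g y - (f z - g z))%C with ((f y - f z) - (g y - g z))%C by ring.
  eapply Rle_lt_trans; [apply Cmod_sub_le |]. lra.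
Qed.

Lemma seg_int_minus (f g : C -> C) (a b : C) : seg_continuous f a b -> seg_continuous g a b ->
  seg_int (fun z => f z - g z)%C a b = (seg_int f a b - seg_int g a b)%C.
Proof.
  intros Hf Hg. eapply is_CInt_unique; [apply seg_int_is_CInt, seg_continuous_minus; assumption |].
  eapply is_CInt_ext; [lra | | apply is_CInt_minus; apply seg_int_is_CInt; assumption].
  intros t _. simpl. ring.
Qed.

Lemma seg_continuous_rev (f : C -> C) (a b : C) : seg_continuous f a b -> seg_continuous f b a.
Proof.
  intros H t Ht.
  replace (b + RtoC t * (a - b))%C with (a + RtoC (1 - t) * (b - a))%C by (rewrite RtoC_minus; ring).
  apply H. lra.
Qed.

Lemma seg_int_rev (f : C -> C) (a b : C) : seg_continuous f a b -> seg_int f b a = (- seg_int f a b)%C.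
Proof.
  intros H. eapply is_CInt_unique; [apply seg_int_is_CInt, seg_continuous_rev, H |].
  assert (H1 := seg_int_is_CInt f a b H).
  assert (H2 : is_CInt (fun t => (b - a) * f (a + RtoC t * (b - a)))%C 1 0 (- seg_int f a b)%C)
    by apply (is_RInt_swap (V := C_R_NormedModule) _ _ _ _ H1).
  (* The endpoints take the form required by the substitution of [-1 * t + 1] for the parameter. *)
  assert (H3 : is_CInt (fun t => (b - a) * f (a + RtoC t * (b - a)))%C (-1 * 0 + 1) (-1 * 1 + 1) (- seg_int f a b)%C)
    by (replace (-1 * 0 + 1) with 1 by ring; replace (-1 * 1 + 1) with 0 by ring; exact H2).
  assert (H4 := is_RInt_comp_lin (V := C_R_NormedModule) _ _ _ _ _ _ H3).
  eapply is_CInt_ext; [lra | | exact H4]. intros t _. simpl. rewrite scal_R_Cmult.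
  replace (a + RtoC (-1 * t + 1) * (b - a))%C with (b + RtoC t * (a - b))%C; [ring |].
  rewrite RtoC_plus, RtoC_mult. ring.
Qed.

Lemma seg_continuous_sub (f : C -> C) (a b : C) (u v : R) : seg_continuous f a b ->
  0 <= u <= 1 -> 0 <= v <= 1 ->
  seg_continuous f (a + RtoC u * (b - a))%C (a + RtoC v * (b - a))%C.
Proof.
  intros H Hu Hv t Ht.
  replace (a + RtoC u * (b - a) + RtoC t * (a + RtoC v * (b - a) - (a + RtoC u * (b - a))))%C
    with (a + RtoC (u + t * (v - u)) * (b - a))%C.
  - apply H. split; nra.
  - rewrite RtoC_plus, RtoC_mult, RtoC_minus. ring.
Qed.

(** The affine substitution [(q - p) t + p] identifies the integral over a subsegment with the part
    of the full integral over the parameters [[p, q]]; additivity in the parameter does the rest. *)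
Lemma seg_int_split (f : C -> C) (a b : C) (u : R) : seg_continuous f a b -> 0 <= u <= 1 ->
  seg_int f a b = (seg_int f a (a + RtoC u * (b - a)) + seg_int f (a + RtoC u * (b - a)) b)%C.
Proof.
  intros H Hu.
  assert (K : forall p q, 0 <= p <= 1 -> 0 <= q <= 1 -> p <= q ->
    is_CInt (fun t => (b - a) * f (a + RtoC t * (b - a)))%C p q
      (seg_int f (a + RtoC p * (b - a)) (a + RtoC q * (b - a)))%C).
  { intros p q Hp Hq Hpq.
    assert (E : is_CInt (fun t => (b - a) * f (a + RtoC t * (b - a)))%C p q
      (CInt (fun t => (b - a) * f (a + RtoC t * (b - a)))%C p q)).
    { apply CInt_correct; [exact Hpq |]. intros t Ht.
      apply (Ccontinuous_curve_continuous (fun w => (b - a) * w)%C (fun t => f (a + RtoC t * (b - a))%C)).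
      - eapply is_cderive_Ccontinuous. apply is_cderive_scal, is_cderive_id.
      - apply seg_continuous_curve_continuous; [exact H | lra]. }
    assert (E1 : is_CInt (fun t => (b - a) * f (a + RtoC t * (b - a)))%C ((q - p) * 0 + p) ((q - p) * 1 + p)
      (CInt (fun t => (b - a) * f (a + RtoC t * (b - a)))%C p q))
      by (replace ((q - p) * 0 + p) with p by ring; replace ((q - p) * 1 + p) with q by ring; exact E).
    assert (E2 := is_RInt_comp_lin (V := C_R_NormedModule) _ _ _ _ _ _ E1).
    assert (E3 := seg_int_is_CInt f _ _ (seg_continuous_sub f a b p q H Hp Hq)).
    set (J := CInt _ p q) in *.
    replace (seg_int f (a + RtoC p * (b - a)) (a + RtoC q * (b - a)))%C with J; [exact E |].
    eapply is_CInt_unique; [| exact E3].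
    eapply is_CInt_ext; [lra | | exact E2]. intros t _. simpl. rewrite scal_R_Cmult.
    replace (a + RtoC p * (b - a) + RtoC t * (a + RtoC q * (b - a) - (a + RtoC p * (b - a))))%C
      with (a + RtoC ((q - p) * t + p) * (b - a))%C
      by (rewrite RtoC_plus, RtoC_mult, RtoC_minus; ring).
    rewrite RtoC_minus. ring. }
  assert (K1 := K 0 u ltac:(lra) Hu ltac:(lra)).
  assert (K2 := K u 1 Hu ltac:(lra) ltac:(lra)).
  assert (K3 := K 0 1 ltac:(lra) ltac:(lra) ltac:(lra)).
  replace (a + RtoC 0 * (b - a))%C with a in * by ring.
  replace (a + RtoC 1 * (b - a))%C with b in * by ring.
  eapply is_CInt_unique; [exact K3 |].
  apply (is_RInt_Chasles (V := C_R_NormedModule) _ _ _ _ _ _ K1 K2).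
Qed.

(** * Limits of sequences with geometrically decreasing steps *)

Lemma R_geometric_limit (u : nat -> R) (M q : R) :
  0 <= q < 1 -> (forall n, Rabs (u (S n) - u n) <= M * q ^ n) -> exists l, Un_cv u l.
Proof.
  intros Hq H.
  assert (HM : 0 <= M) by (specialize (H O); simpl in H; assert (P := Rabs_pos (u 1%nat - u O)); lra).
  assert (S0 : ex_series (fun n => u (S n) - u n)).
  { apply (ex_series_le (K := R_AbsRing) (V := R_CompleteNormedModule) _ (fun n => M * q ^ n)).
    - exact H.
    - apply (ex_series_scal_l (K := R_AbsRing) (V := R_NormedModule) M (fun n => q ^ n)).
      apply ex_series_geom. rewrite Rabs_pos_eq; lra. }
  destruct S0 as [s Hs]. exists (s + u O). apply is_lim_seq_Reals.
  apply (is_lim_seq_incr_1 u).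
  apply is_lim_seq_ext with (fun n => sum_n (fun n => u (S n) - u n) n + u O).
  - intros n. induction n.
    + rewrite sum_O. ring.
    + rewrite sum_Sn. change (sum_n (fun n0 : nat => u (S n0) - u n0) n + (u (S (S n)) - u (S n)) + u O = u (S (S n))). lra.
  - apply (is_lim_seq_plus' _ _ s (u O)); [exact Hs | apply is_lim_seq_const].
Qed.

(** The explicit rate controls the nested triangles in Goursat's theorem; the plain limit is what
    the closedness argument there and the fixed point iteration for the cubic use. *)
Lemma C_geometric_limit (u : nat -> C) (M q : R) :
  0 <= q < 1 -> (forall n, Cmod (u (S n) - u n) <= M * q ^ n) ->
  exists l, (forall n, Cmod (u n - l) <= M / (1 - q) * q ^ n) /\
            (forall eps, 0 < eps -> exists n, forall m, (n <= m)%nat -> Cmod (u m - l) < eps).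
Proof.
  intros Hq H.
  destruct (R_geometric_limit (fun n => Re (u n)) M q Hq) as [x Hx].
  { intros n. eapply Rle_trans; [| apply (H n)]. eapply Rle_trans; [| apply re_le_Cmod].
    right. f_equal. }
  destruct (R_geometric_limit (fun n => Im (u n)) M q Hq) as [y Hy].
  { intros n. eapply Rle_trans; [| apply (H n)]. eapply Rle_trans; [| apply Im_le_Cmod].
    right. f_equal. }
  assert (HM : 0 <= M) by (specialize (H O); simpl in H; assert (P := Cmod_ge_0 (u 1%nat - u O)); lra).
  exists (x, y).
  assert (L : forall eps, 0 < eps -> exists n, forall m, (n <= m)%nat -> Cmod (u m - (x, y)) < eps).
  { intros eps He. destruct (Hx (eps / 2)) as [n1 H1]; [lra |].
    destruct (Hy (eps / 2)) as [n2 H2]; [lra |].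
    exists (Nat.max n1 n2). intros m Hm.
    specialize (H1 m ltac:(lia)). specialize (H2 m ltac:(lia)). unfold Rdist in H1, H2.
    eapply Rle_lt_trans; [apply Cmod_le_Re_Im |].
    change (Rabs (Re (u m) - x) + Rabs (Im (u m) - y) < eps). lra. }
  split; [| exact L]. intros n.
  apply le_epsilon. intros eps He. destruct (L eps He) as [N HN].
  specialize (HN (n + N)%nat ltac:(lia)).
  eapply Rle_trans; [apply (Cmod_tri3 _ (u (n + N)%nat)) |].
  apply Rplus_le_compat; [| lra].
  (* The partial geometric sum in closed form, which makes the induction on [k] exact. *)
  assert (B : forall k, Cmod (u n - u (n + k)%nat) <= M / (1 - q) * (q ^ n - q ^ (n + k))).
  { intros k. induction k.
    - rewrite Nat.add_0_r. replace (u n - u n)%C with (RtoC 0) by ring. rewrite Cmod_0.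
      right; ring.
    - eapply Rle_trans; [apply (Cmod_tri3 _ (u (n + k)%nat)) |].
      specialize (H (n + k)%nat). rewrite Cmod_minus_sym in H.
      rewrite Nat.add_succ_r.
      eapply Rle_trans; [apply Rplus_le_compat; [exact IHk | exact H] |].
      right. simpl. field. lra. }
  eapply Rle_trans; [apply B |]. apply Rmult_le_compat_l.
  - apply Rdiv_le_0_compat; lra.
  - assert (0 <= q ^ (n + N)) by (apply pow_le; lra). lra.
Qed.

(** * Goursat's theorem *)


Definition tri_int (f : C -> C) (a b c : C) : C := (seg_int f a b + seg_int f b c + seg_int f c a)%C.

(** Written as a point of the parametrised segment, so that [seg_int_split] at [/ 2] yields it
    verbatim. *)
Definition mid (a b : C) : C := (a + RtoC (/ 2) * (b - a))%C.

Definition perim (a b c : C) : R := Cmod (b - a) + Cmod (c - b) + Cmod (a - c).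

(** Goursat's theorem is stated for closed convex sets because two kinds are needed: disks, for
    primitives, and disks cut by a half plane, for contours that must avoid a point. *)
Definition Cconvex (K : C -> Prop) : Prop :=
  forall u v t, K u -> K v -> 0 <= t <= 1 -> K (u + RtoC t * (v - u))%C.

Definition Cclosed (K : C -> Prop) : Prop :=
  forall u, (forall eps, 0 < eps -> exists v, K v /\ Cmod (v - u) < eps) -> K u.

Lemma convex_seg_continuous (K : C -> Prop) (f : C -> C) (a b : C) :
  Cconvex K -> (forall u, K u -> Ccontinuous f u) -> K a -> K b -> seg_continuous f a b.
Proof. intros HK Hf Ha Hb t Ht. apply Hf, HK; assumption. Qed.

Lemma mid_in (K : C -> Prop) (a b : C) : Cconvex K -> K a -> K b -> K (mid a b).
Proof. intros HK Ha Hb. apply HK; try assumption. lra. Qed.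

(** Three corner triangles and the medial one; each inner side is traversed twice, in opposite
    directions. *)
Lemma tri_int_split (K : C -> Prop) (f : C -> C) (a b c : C) :
  Cconvex K -> (forall u, K u -> Ccontinuous f u) -> K a -> K b -> K c ->
  tri_int f a b c = (tri_int f a (mid a b) (mid c a) + tri_int f (mid a b) b (mid b c)
                 + tri_int f (mid c a) (mid b c) c + tri_int f (mid a b) (mid b c) (mid c a))%C.
Proof.
  intros HK Hf Ha Hb Hc.
  assert (S := fun u v => convex_seg_continuous K f u v HK Hf).
  assert (Hab := mid_in K a b HK Ha Hb). assert (Hbc := mid_in K b c HK Hb Hc).
  assert (Hca := mid_in K c a HK Hc Ha).
  unfold tri_int.
  rewrite (seg_int_split f a b (/ 2)), (seg_int_split f b c (/ 2)), (seg_int_split f c a (/ 2)) by (auto; lra).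
  fold (mid a b) (mid b c) (mid c a).
  rewrite (seg_int_rev f (mid a b) (mid c a)), (seg_int_rev f (mid b c) (mid a b)), (seg_int_rev f (mid c a) (mid b c))
    by auto.
  rewrite (seg_int_rev f (mid a b) (mid b c)) by auto. ring.
Qed.

Lemma Cmod_half (z : C) : Cmod (RtoC (/ 2) * z) = Cmod z / 2.
Proof. rewrite Cmod_mult, Cmod_RtoC_pos by lra. field. Qed.

Lemma RtoC_half : (RtoC (/ 2) + RtoC (/ 2) = RtoC 1)%C.
Proof. rewrite <- RtoC_plus. f_equal. field. Qed.

Lemma mid_sides (a b c : C) :
  (mid a b - a = RtoC (/ 2) * (b - a) /\ b - mid a b = RtoC (/ 2) * (b - a) /\
   mid b c - mid a b = RtoC (/ 2) * (c - a))%C.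
Proof.
  unfold mid. assert (H := RtoC_half).
  assert (E : RtoC 1 = (RtoC (/ 2) + RtoC (/ 2))%C) by (symmetry; exact H).
  repeat split.
  - ring.
  (* [RtoC (/ 2)] is an atom for [ring], so a factor 1 is inserted and rewritten as the sum of two
     halves. *)
  - replace b with (RtoC 1 * b)%C at 1 by ring. replace a with (RtoC 1 * a)%C at 1 by ring.
    rewrite E. ring.
  - replace (b + RtoC (/ 2) * (c - b) - (a + RtoC (/ 2) * (b - a)))%C
      with (RtoC 1 * b + RtoC (/ 2) * (c - b) - (RtoC 1 * a + RtoC (/ 2) * (b - a)))%C by ring.
    rewrite E. ring.
Qed.

(** The four pieces sum to the whole, so one of them carries at least a quarter of the integral. The
    displacement of the first vertex is recorded because these vertices will form the convergent
    sequence. *)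
Lemma goursat_step (K : C -> Prop) (f : C -> C) (a b c : C) :
  Cconvex K -> (forall u, K u -> Ccontinuous f u) -> K a -> K b -> K c ->
  exists a' b' c', K a' /\ K b' /\ K c' /\ perim a' b' c' = perim a b c / 2 /\
    Cmod (a' - a) <= perim a b c /\ Cmod (tri_int f a b c) / 4 <= Cmod (tri_int f a' b' c').
Proof.
  intros HK Hf Ha Hb Hc.
  assert (Hab := mid_in K a b HK Ha Hb). assert (Hbc := mid_in K b c HK Hb Hc).
  assert (Hca := mid_in K c a HK Hc Ha).
  assert (E := tri_int_split K f a b c HK Hf Ha Hb Hc).
  destruct (mid_sides a b c) as (A1 & A2 & A3).
  destruct (mid_sides b c a) as (B1 & B2 & B3).
  destruct (mid_sides c a b) as (C1 & C2 & C3).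
  assert (P1 := Cmod_ge_0 (b - a)). assert (P2 := Cmod_ge_0 (c - b)). assert (P3 := Cmod_ge_0 (a - c)).
  assert (Q1 := Cmod_minus_sym a b). assert (Q2 := Cmod_minus_sym b c). assert (Q3 := Cmod_minus_sym c a).
  assert (R3 : Cmod (mid a b - mid c a) = Cmod (b - c) / 2) by (rewrite C3; apply Cmod_half).
  assert (R1 : Cmod (mid b c - mid a b) = Cmod (c - a) / 2) by (rewrite A3; apply Cmod_half).
  assert (R2 : Cmod (mid c a - mid b c) = Cmod (a - b) / 2) by (rewrite B3; apply Cmod_half).
  assert (S1 : Cmod (mid a b - a) = Cmod (b - a) / 2) by (rewrite A1; apply Cmod_half).
  assert (S2 : Cmod (b - mid a b) = Cmod (b - a) / 2) by (rewrite A2; apply Cmod_half).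
  assert (S3 : Cmod (mid b c - b) = Cmod (c - b) / 2) by (rewrite B1; apply Cmod_half).
  assert (S4 : Cmod (c - mid b c) = Cmod (c - b) / 2) by (rewrite B2; apply Cmod_half).
  assert (S5 : Cmod (mid c a - c) = Cmod (a - c) / 2) by (rewrite C1; apply Cmod_half).
  assert (S6 : Cmod (a - mid c a) = Cmod (a - c) / 2) by (rewrite C2; apply Cmod_half).
  assert (U1 := Cmod_minus_sym (mid a b) (mid c a)). assert (U2 := Cmod_minus_sym (mid b c) (mid a b)).
  assert (U3 := Cmod_minus_sym (mid c a) (mid b c)). assert (U4 := Cmod_minus_sym (mid c a) a).
  destruct (Rle_dec (Cmod (tri_int f a b c) / 4) (Cmod (tri_int f a (mid a b) (mid c a)))) as [L1 | L1].
  { exists a, (mid a b), (mid c a). unfold perim. repeat (split; [assumption |]).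
    split; [lra |]. split; [| exact L1]. replace (a - a)%C with (RtoC 0) by ring. rewrite Cmod_0. lra. }
  destruct (Rle_dec (Cmod (tri_int f a b c) / 4) (Cmod (tri_int f (mid a b) b (mid b c)))) as [L2 | L2].
  { exists (mid a b), b, (mid b c). unfold perim. repeat (split; [assumption |]).
    split; [lra |]. split; [lra | exact L2]. }
  destruct (Rle_dec (Cmod (tri_int f a b c) / 4) (Cmod (tri_int f (mid c a) (mid b c) c))) as [L3 | L3].
  { exists (mid c a), (mid b c), c. unfold perim. repeat (split; [assumption |]).
    split; [lra |]. split; [lra | exact L3]. }
  exists (mid a b), (mid b c), (mid c a). unfold perim. repeat (split; [assumption |]).
  split; [lra |]. split; [lra |].
  set (t1 := tri_int f a (mid a b) (mid c a)) in *. set (t2 := tri_int f (mid a b) b (mid b c)) in *.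
  set (t3 := tri_int f (mid c a) (mid b c) c) in *. set (t4 := tri_int f (mid a b) (mid b c) (mid c a)) in *.
  assert (Z : Cmod (tri_int f a b c) <= Cmod t1 + Cmod t2 + Cmod t3 + Cmod t4).
  { rewrite E. eapply Rle_trans; [apply Cmod_triangle |]. apply Rplus_le_compat_r.
    eapply Rle_trans; [apply Cmod_triangle |]. apply Rplus_le_compat_r. apply Cmod_triangle. }
  lra.
Qed.

Definition triangle : Type := (C * C * C)%type.
Definition va (T : triangle) : C := fst (fst T).
Definition vb (T : triangle) : C := snd (fst T).
Definition vc (T : triangle) : C := snd T.

(** Dependent choice: triangles are packed with the membership of their vertices in [K], so that
    [goursat_step] applies to every one of them and can be iterated. *)
Lemma goursat_sequence (K : C -> Prop) (f : C -> C) (a b c : C) :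
  Cconvex K -> (forall u, K u -> Ccontinuous f u) -> K a -> K b -> K c ->
  exists T : nat -> triangle, forall n,
    K (va (T n)) /\ K (vb (T n)) /\ K (vc (T n)) /\
    perim (va (T n)) (vb (T n)) (vc (T n)) = perim a b c * (/ 2) ^ n /\
    Cmod (va (T (S n)) - va (T n)) <= perim a b c * (/ 2) ^ n /\
    Cmod (tri_int f a b c) * (/ 4) ^ n <= Cmod (tri_int f (va (T n)) (vb (T n)) (vc (T n))).
Proof.
  intros HK Hf Ha Hb Hc.
  set (In := fun T : triangle => K (va T) /\ K (vb T) /\ K (vc T)).
  set (Rel := fun (T T' : sig In) =>
    perim (va (proj1_sig T')) (vb (proj1_sig T')) (vc (proj1_sig T'))
      = perim (va (proj1_sig T)) (vb (proj1_sig T)) (vc (proj1_sig T)) / 2 /\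
    Cmod (va (proj1_sig T') - va (proj1_sig T))
      <= perim (va (proj1_sig T)) (vb (proj1_sig T)) (vc (proj1_sig T)) /\
    Cmod (tri_int f (va (proj1_sig T)) (vb (proj1_sig T)) (vc (proj1_sig T))) / 4
      <= Cmod (tri_int f (va (proj1_sig T')) (vb (proj1_sig T')) (vc (proj1_sig T')))).
  assert (Step : forall T, exists T', Rel T T').
  { intros [[[p q] r] (I1 & I2 & I3)]. simpl in *.
    destruct (goursat_step K f p q r HK Hf I1 I2 I3) as (a' & b' & c' & J1 & J2 & J3 & J).
    exists (exist In (a', b', c') (conj J1 (conj J2 J3))). exact J. }
  set (next := fun T => proj1_sig (constructive_indefinite_description _ (Step T))).
  assert (Hnext : forall T, Rel T (next T))
    by (intros T0; apply (proj2_sig (constructive_indefinite_description _ (Step T0)))).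
  set (T := fix T n := match n with
    | O => exist In (a, b, c) (conj Ha (conj Hb Hc)) | S n => next (T n) end).
  exists (fun n => proj1_sig (T n)).
  assert (B : forall n, perim (va (proj1_sig (T n))) (vb (proj1_sig (T n))) (vc (proj1_sig (T n)))
      = perim a b c * (/ 2) ^ n /\ Cmod (tri_int f a b c) * (/ 4) ^ n <=
      Cmod (tri_int f (va (proj1_sig (T n))) (vb (proj1_sig (T n))) (vc (proj1_sig (T n))))).
  { induction n.
    - simpl. split; [ring_simplify; reflexivity |]. rewrite Rmult_1_r. apply Rle_refl.
    - destruct IHn as [I1 I2]. destruct (Hnext (T n)) as (J1 & _ & J2).
      change (T (S n)) with (next (T n)). rewrite J1, I1. split; [simpl; field |].
      eapply Rle_trans; [| exact J2]. simpl. lra. }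
  intros n. destruct (B n) as [B1 B2].
  destruct (proj2_sig (T n)) as (I1 & I2 & I3). repeat (split; [assumption |]).
  split; [| exact B2]. rewrite <- B1. apply (Hnext (T n)).
Qed.

Lemma affine_seg_int (l m z0 a b : C) :
  seg_int (fun z => m + l * (z - z0))%C a b
  = ((m * b + l * RtoC (/ 2) * ((b - z0) * (b - z0)))
     - (m * a + l * RtoC (/ 2) * ((a - z0) * (a - z0))))%C.
Proof.
  apply (seg_int_ftc (fun z => m * z + l * RtoC (/ 2) * ((z - z0) * (z - z0)))%C).
  - intros t _. eapply is_cderive_Ccontinuous. apply is_cderive_plus; [apply is_cderive_const |].
    apply is_cderive_scal. apply is_cderive_minus; [apply is_cderive_id | apply is_cderive_const].
  - intros t _. set (w := (a + RtoC t * (b - a))%C).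
    replace (m + l * (w - z0))%C with
      (m * RtoC 1 + l * RtoC (/ 2) * ((RtoC 1 - RtoC 0) * (w - z0) + (w - z0) * (RtoC 1 - RtoC 0)))%C.
    + apply is_cderive_plus; [apply is_cderive_scal, is_cderive_id |]. apply is_cderive_scal.
      apply (is_cderive_mult (fun z => z - z0)%C (fun z => z - z0)%C);
        apply is_cderive_minus; (apply is_cderive_id || apply is_cderive_const).
    + transitivity (m + l * ((RtoC (/ 2) + RtoC (/ 2)) * (w - z0)))%C; [ring |].
      rewrite RtoC_half. ring.
Qed.

Lemma affine_tri_int (l m z0 a b c : C) : tri_int (fun z => m + l * (z - z0))%C a b c = RtoC 0.
Proof. unfold tri_int. rewrite !affine_seg_int. ring. Qed.

Lemma is_cderive_affine (l m z0 z : C) : is_cderive (fun z => m + l * (z - z0))%C z l.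
Proof.
  intros eps He. exists 1. split; [lra |]. intros y _.
  replace (m + l * (y - z0) - (m + l * (z - z0)) - l * (y - z))%C with (RtoC 0) by ring.
  rewrite Cmod_0. assert (P := Cmod_ge_0 (y - z)). nra.
Qed.

Lemma Ccontinuous_affine (l m z0 z : C) : Ccontinuous (fun z => m + l * (z - z0))%C z.
Proof. eapply is_cderive_Ccontinuous, is_cderive_affine. Qed.

Lemma tri_int_minus (f g : C -> C) (a b c : C) :
  seg_continuous f a b -> seg_continuous f b c -> seg_continuous f c a ->
  seg_continuous g a b -> seg_continuous g b c -> seg_continuous g c a ->
  tri_int (fun z => f z - g z)%C a b c = (tri_int f a b c - tri_int g a b c)%C.
Proof. intros. unfold tri_int. rewrite !seg_int_minus by assumption. ring. Qed.

Lemma side_dist (a b : C) (t : R) : 0 <= t <= 1 -> Cmod (a + RtoC t * (b - a) - a) <= Cmod (b - a).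
Proof.
  intros Ht. replace (a + RtoC t * (b - a) - a)%C with (RtoC t * (b - a))%C by ring.
  rewrite Cmod_mult, Cmod_RtoC_pos by lra. assert (P := Cmod_ge_0 (b - a)). nra.
Qed.

(* Bisection selects nested triangles shrinking to a point z0 of K; subtracting the affine part of
   f at z0, which has zero contour integral, leaves an error o(perimeter ^ 2). *)
Lemma goursat (K : C -> Prop) (f : C -> C) (a b c : C) :
  Cclosed K -> Cconvex K -> (forall u, K u -> exists l, is_cderive f u l) -> K a -> K b -> K c ->
  tri_int f a b c = RtoC 0.
Proof.
  intros Hcl HK HD Ha Hb Hc.
  assert (Hf : forall u, K u -> Ccontinuous f u).
  { intros u Hu. destruct (HD u Hu) as [l Hl]. eapply is_cderive_Ccontinuous, Hl. }
  destruct (goursat_sequence K f a b c HK Hf Ha Hb Hc) as [T HT].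
  assert (P0 : 0 <= perim a b c) by (unfold perim; repeat apply Rplus_le_le_0_compat; apply Cmod_ge_0).
  set (P := perim a b c) in *.
  destruct (C_geometric_limit (fun n => va (T n)) P (/ 2)) as (z0 & Hz & Hlim); [lra | apply HT |].
  assert (Kz : K z0).
  { apply Hcl. intros eps He. destruct (Hlim eps He) as [n Hn]. exists (va (T n)).
    split; [apply HT | apply Hn; lia]. }
  destruct (HD z0 Kz) as [l Hl].
  apply Cmod_zero. apply le_epsilon. intros eps He. rewrite Rplus_0_l.
  (* The final bound is [3 P^2 k]; the summand 1 covers a degenerate triangle with [P = 0]. *)
  set (k := eps / (3 * P * P + 1)).
  assert (Hk : 0 < k) by (apply Rdiv_lt_0_compat; nra).
  destruct (Hl k Hk) as [d [Hd Hdd]].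
  destruct (pow_lt_1_zero (/ 2)) with (y := d / (3 * P + 1)) as [N HN];
    [rewrite Rabs_pos_eq; lra | apply Rdiv_lt_0_compat; lra |].
  specialize (HN N (Nat.le_refl N)).
  assert (Hpow : 0 < (/ 2) ^ N) by (apply pow_lt; lra).
  rewrite Rabs_pos_eq in HN by lra.
  destruct (HT N) as (I1 & I2 & I3 & I4 & _ & I5). specialize (Hz N). simpl in Hz.
  set (p := va (T N)) in *. set (q := vb (T N)) in *. set (r := vc (T N)) in *.
  set (h := (/ 2) ^ N) in *.
  replace (P / (1 - / 2)) with (2 * P) in Hz by field.
  assert (Hd3 : 3 * P * h < d).
  { apply Rle_lt_trans with ((3 * P + 1) * h); [nra |].
    replace d with ((3 * P + 1) * (d / (3 * P + 1))) by (field; lra).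
    apply Rmult_lt_compat_l; lra. }
  set (g := fun z => (f z0 + l * (z - z0))%C).
  assert (Sf := fun u v => convex_seg_continuous K f u v HK Hf).
  assert (Sg : forall u v, seg_continuous g u v) by (intros u v t _; apply Ccontinuous_affine).
  assert (E : tri_int f p q r = tri_int (fun z => f z - g z)%C p q r).
  { rewrite tri_int_minus by auto. unfold g. rewrite affine_tri_int. ring. }
  assert (Near : forall u, Cmod (u - p) <= P * h -> Cmod (f u - g u) <= k * (3 * P * h)).
  { intros u Hu.
    assert (Huz : Cmod (u - z0) <= 3 * P * h).
    { eapply Rle_trans; [apply (Cmod_tri3 _ p) |]. lra. }
    unfold g. replace (f u - (f z0 + l * (u - z0)))%C with (f u - f z0 - l * (u - z0))%C by ring.
    eapply Rle_trans; [apply Hdd; lra |]. apply Rmult_le_compat_l; lra. }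
  assert (Q1 := Cmod_ge_0 (q - p)). assert (Q2 := Cmod_ge_0 (r - q)). assert (Q3 := Cmod_ge_0 (p - r)).
  unfold perim in I4.
  assert (B1 : Cmod (seg_int (fun z => f z - g z)%C p q) <= Cmod (q - p) * (k * (3 * P * h))).
  { apply seg_int_bound; [apply seg_continuous_minus; auto |]. intros t Ht. apply Near.
    eapply Rle_trans; [apply side_dist, Ht |]. lra. }
  assert (B2 : Cmod (seg_int (fun z => f z - g z)%C q r) <= Cmod (r - q) * (k * (3 * P * h))).
  { apply seg_int_bound; [apply seg_continuous_minus; auto |]. intros t Ht. apply Near.
    eapply Rle_trans; [apply (Cmod_tri3 _ q) |].
    assert (X := side_dist q r t Ht). lra. }
  assert (B3 : Cmod (seg_int (fun z => f z - g z)%C r p) <= Cmod (p - r) * (k * (3 * P * h))).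
  { apply seg_int_bound; [apply seg_continuous_minus; auto |]. intros t Ht. apply Near.
    (* The last side is read backwards, so that distances are again measured from [p]. *)
    replace (r + RtoC t * (p - r))%C with (p + RtoC (1 - t) * (r - p))%C by (rewrite RtoC_minus; ring).
    eapply Rle_trans; [apply side_dist; lra |]. rewrite Cmod_minus_sym. lra. }
  assert (B : Cmod (tri_int f p q r) <= P * h * (k * (3 * P * h))).
  { rewrite E. unfold tri_int. eapply Rle_trans; [apply Cmod_triangle |].
    eapply Rle_trans; [apply Rplus_le_compat_r, Cmod_triangle |]. nra. }
  assert (H4 : (/ 4) ^ N = h * h).
  { unfold h. rewrite <- Rpow_mult_distr. f_equal. field. }
  rewrite H4 in I5.
  assert (Hhh : 0 < h * h) by nra.
  assert (Y : Cmod (tri_int f a b c) * (h * h) <= (3 * P * P * k) * (h * h)) by nra.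
  apply Rmult_le_reg_r in Y; [| exact Hhh].
  eapply Rle_trans; [exact Y |]. unfold k.
  apply Rle_trans with ((3 * P * P + 1) * (eps / (3 * P * P + 1))).
  - apply Rmult_le_compat_r; [fold k; lra | lra].
  - right. field. nra.
Qed.

(** * Primitives and contour contraction *)


(** Analyticity with the derivative named, so that the derivative can itself be shown to be
    [hol]. *)
Definition hol (f : C -> C) : Prop := forall z, unit_disk z -> is_cderive f z (C_derive f z).

Lemma is_cderive_C_derive (f : C -> C) (z l : C) : is_cderive f z l -> C_derive f z = l.
Proof. intros H. apply is_C_derive_unique, is_derive_iff_is_cderive, H. Qed.

Lemma is_cderive_hol (f : C -> C) : (forall z, unit_disk z -> exists l, is_cderive f z l) -> hol f.
Proof. intros H z Hz. destruct (H z Hz) as [l Hl]. rewrite (is_cderive_C_derive f z l Hl). exact Hl. Qed.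

Lemma analytic_hol (f : C -> C) : analytic f <-> hol f.
Proof.
  split.
  - intros H. apply is_cderive_hol. intros z Hz. destruct (H z Hz) as [l Hl].
    exists l. apply is_derive_iff_is_cderive, Hl.
  - intros H z Hz. exists (C_derive f z). apply is_derive_iff_is_cderive, H, Hz.
Qed.

Lemma hol_ex (f : C -> C) (z : C) : hol f -> unit_disk z -> exists l, is_cderive f z l.
Proof. intros H Hz. exists (C_derive f z). apply H, Hz. Qed.

Lemma hol_Ccontinuous (f : C -> C) (z : C) : hol f -> unit_disk z -> Ccontinuous f z.
Proof. intros H Hz. eapply is_cderive_Ccontinuous, H, Hz. Qed.

Lemma ball_closed (rho : R) : Cclosed (fun u => Cmod u <= rho).
Proof.
  intros u H. apply le_epsilon. intros eps He. destruct (H eps He) as [v [Hv Hd]].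
  assert (Q := Cmod_rev u v). rewrite Cmod_minus_sym in Q. lra.
Qed.

Lemma ball_convex (rho : R) : Cconvex (fun u => Cmod u <= rho).
Proof.
  intros u v t Hu Hv Ht.
  replace (u + RtoC t * (v - u))%C with (RtoC (1 - t) * u + RtoC t * v)%C by (rewrite RtoC_minus; ring).
  eapply Rle_trans; [apply Cmod_triangle |]. rewrite !Cmod_mult, !Cmod_RtoC_pos by lra. nra.
Qed.

Lemma seg_int_refl (f : C -> C) (z : C) : seg_int f z z = RtoC 0.
Proof. unfold seg_int. ring. Qed.

Lemma seg_int_derive (f : C -> C) (z : C) (d : R) :
  0 < d -> (forall y, Cmod (y - z) < d -> Ccontinuous f y) -> is_cderive (fun y => seg_int f z y) z (f z).
Proof.
  intros Hd Hf eps He.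
  assert (Z : Cmod (z - z) < d) by (replace (z - z)%C with (RtoC 0) by ring; rewrite Cmod_0; lra).
  destruct (Hf z Z eps He) as [e [He' H]].
  exists (Rmin d e). split; [apply Rmin_pos; lra |]. intros y Hy.
  assert (Hy1 := Rlt_le_trans _ _ _ Hy (Rmin_l _ _)).
  assert (Hy2 := Rlt_le_trans _ _ _ Hy (Rmin_r _ _)).
  assert (Near : forall t, 0 <= t <= 1 -> Cmod (z + RtoC t * (y - z) - z) <= Cmod (y - z))
    by (intros t Ht; apply side_dist, Ht).
  assert (S : seg_continuous f z y).
  { intros t Ht. apply Hf. eapply Rle_lt_trans; [apply Near, Ht | exact Hy1]. }
  (* The constant [f z] is written as an affine function of slope 0, whose segment integral is
     already known. *)
  assert (S' : seg_continuous (fun u => f z + RtoC 0 * (u - z))%C z y) by (intros t _; apply Ccontinuous_affine).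
  replace (seg_int f z y - seg_int f z z - f z * (y - z))%C
    with (seg_int (fun u => f u - (f z + RtoC 0 * (u - z)))%C z y)
    by (rewrite seg_int_minus, affine_seg_int, seg_int_refl by assumption; ring).
  rewrite Rmult_comm. apply seg_int_bound; [apply seg_continuous_minus; assumption |].
  intros t Ht. set (u := (z + RtoC t * (y - z))%C).
  replace (f u - (f z + RtoC 0 * (u - z)))%C with (f u - f z)%C by ring.
  left. apply H. eapply Rle_lt_trans; [apply Near, Ht | exact Hy2].
Qed.

(** The candidate is the integral from 0. Goursat on the triangle [0, z, y] moves the base point to
    [z], where [seg_int_derive] gives the derivative. *)
Lemma hol_primitive (f : C -> C) : hol f ->
  exists F, F (RtoC 0) = RtoC 0 /\ forall z, unit_disk z -> is_cderive F z (f z).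
Proof.
  intros Hf. exists (fun z => seg_int f (RtoC 0) z). split; [apply seg_int_refl |].
  intros z Hz. unfold unit_disk in Hz. assert (Pz := Cmod_ge_0 z).
  set (rho := (1 + Cmod z) / 2). set (d := (1 - Cmod z) / 2).
  assert (In : forall y, Cmod (y - z) < d -> Cmod y <= rho).
  { intros y Hy. assert (Q := Cmod_rev y z). unfold d, rho in *. lra. }
  apply is_cderive_locally_ext with (fun y => seg_int f (RtoC 0) z + seg_int f z y)%C d.
  - unfold d. lra.
  - intros y Hy.
    assert (HK : forall u, Cmod u <= rho -> exists l, is_cderive f u l)
      by (intros u Hu; apply hol_ex; [exact Hf | unfold unit_disk, rho in *; lra]).
    assert (HC : forall u, Cmod u <= rho -> Ccontinuous f u)
      by (intros u Hu; apply hol_Ccontinuous; [exact Hf | unfold unit_disk, rho in *; lra]).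
    assert (Z0 : Cmod (RtoC 0) <= rho) by (rewrite Cmod_0; unfold rho; lra).
    assert (G := goursat _ f (RtoC 0) z y (ball_closed rho) (ball_convex rho) HK
      Z0 ltac:(unfold rho; lra) (In y Hy)).
    unfold tri_int in G. rewrite (seg_int_rev f (RtoC 0) y) in G.
    + replace (seg_int f (RtoC 0) z + seg_int f z y)%C
        with (seg_int f (RtoC 0) z + seg_int f z y + - seg_int f (RtoC 0) y + seg_int f (RtoC 0) y)%C by ring.
      rewrite G. ring.
    + apply (convex_seg_continuous (fun u => Cmod u <= rho)); auto using ball_convex.
  - replace (f z) with (RtoC 0 + f z)%C by ring. apply is_cderive_plus; [apply is_cderive_const |].
    apply seg_int_derive with d; [unfold d; lra |]. intros y Hy. apply hol_Ccontinuous; [exact Hf |].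
    specialize (In y Hy). unfold unit_disk, rho in *. lra.
Qed.

Definition circle (r t : R) : C := (r * cos t, r * sin t).

Lemma Cmod_circle (r t : R) : 0 <= r -> Cmod (circle r t) = r.
Proof.
  intros Hr. unfold circle, Cmod; simpl.
  replace (_ + _) with (r * r * (Rsqr (sin t) + Rsqr (cos t))) by (unfold Rsqr; ring).
  rewrite sin2_cos2, Rmult_1_r. apply sqrt_square, Hr.
Qed.

Lemma is_curve_derive_circle (r t : R) : is_curve_derive (circle r) t (Ci * circle r t)%C.
Proof.
  replace (Ci * circle r t)%C with ((- (r * sin t), r * cos t) : C).
  - apply is_curve_derive_pair; auto_derive; auto; ring.
  - unfold circle, Ci, Cmult; simpl. f_equal; ring.
Qed.

Lemma circle_2PI (r : R) : circle r (2 * PI) = circle r 0.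
Proof. unfold circle. rewrite cos_2PI, sin_2PI, cos_0, sin_0. reflexivity. Qed.

Definition cdot (u v : C) : R := Re u * Re v + Im u * Im v.

Lemma cdot_le (u v : C) : Rabs (cdot u v) <= Cmod u * Cmod v.
Proof.
  unfold cdot. replace (Re u * Re v + Im u * Im v) with (Re (u * Cconj v)%C)
    by (unfold Re, Im, Cconj; simpl; ring).
  eapply Rle_trans; [apply re_le_Cmod |]. rewrite Cmod_mult, Cmod_conj. apply Rle_refl.
Qed.

Lemma halfplane_convex (a n : C) (c : R) : Cconvex (fun u => c <= cdot (u - a) n).
Proof.
  intros u v t Hu Hv Ht. unfold cdot, Re, Im in *; simpl in *.
  nra.
Qed.

Lemma cdot_plus (u v n : C) : cdot (u + v) n = cdot u n + cdot v n.
Proof. unfold cdot, Re, Im; simpl. ring. Qed.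

Lemma cdot_self (n : C) : cdot n n = Cmod n * Cmod n.
Proof. unfold cdot. rewrite Cmod_sqr. reflexivity. Qed.

Lemma cdot_scal (x : R) (u n : C) : cdot (RtoC x * u) n = x * cdot u n.
Proof. unfold cdot, Re, Im, RtoC; simpl. ring. Qed.

Lemma halfplane_closed (a n : C) (c : R) : Cclosed (fun u => c <= cdot (u - a) n).
Proof.
  intros u H. apply le_epsilon. intros eps He. assert (Pn := Cmod_ge_0 n).
  assert (Hk : 0 < eps / (Cmod n + 1)) by (apply Rdiv_lt_0_compat; lra).
  destruct (H _ Hk) as [v [Hv Hd]].
  assert (E : cdot (v - a) n = cdot (u - a) n + cdot (v - u) n)
    by (rewrite <- cdot_plus; f_equal; ring).
  assert (Q := cdot_le (v - u) n). apply Rabs_le_between in Q.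
  assert (Ee : eps = eps / (Cmod n + 1) * (Cmod n + 1)) by (field; lra).
  assert (Cmod (v - u) * Cmod n <= eps).
  { assert (X := Cmod_ge_0 (v - u)). nra. }
  lra.
Qed.

Lemma inter_closed (K L : C -> Prop) : Cclosed K -> Cclosed L -> Cclosed (fun u => K u /\ L u).
Proof.
  intros HK HL u H. split; [apply HK | apply HL]; intros eps He;
    destruct (H eps He) as [v [[H1 H2] H3]]; exists v; auto.
Qed.

Lemma inter_convex (K L : C -> Prop) : Cconvex K -> Cconvex L -> Cconvex (fun u => K u /\ L u).
Proof. intros HK HL u v t [] [] Ht. split; auto. Qed.

(* The quadrilateral z_eps, z, w, w_eps, where z_eps = a + eps (z - a), lies in a half plane away
   from a, so that g has zero integral along it although g may be singular at a. *)
Lemma contraction_derive (g : C -> C) (a z : C) (eps : R) :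
  (forall u, unit_disk u -> u <> a -> exists l, is_cderive g u l) ->
  unit_disk a -> unit_disk z -> z <> a -> 0 < eps <= 1 ->
  is_cderive (fun w => seg_int g (a + RtoC eps * (w - a))%C w) z
     (g z - g (a + RtoC eps * (z - a))%C * RtoC eps)%C.
Proof.
  intros Hg Ha Hz Hza Heps. unfold unit_disk in *.
  set (n := (z - a)%C).
  assert (Hn : 0 < Cmod n) by (apply Cmod_gt_0, Cminus_eq_contra, Hza).
  set (rho := Rmax (Cmod a) ((1 + Cmod z) / 2)).
  assert (Hrho : rho < 1) by (apply Rmax_lub_lt; lra).
  (* The point [z_eps] has inner product [eps |n|^2] with [n]. Half of it still holds for [w_eps]
     when [|w - z| < |n| / 2], and it excludes [a], whose value is 0. *)
  set (c := eps * (Cmod n * Cmod n) / 2).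
  assert (Hc : 0 < c) by (unfold c; assert (0 < Cmod n * Cmod n) by nra; nra).
  set (K := fun u => Cmod u <= rho /\ c <= cdot (u - a) n).
  assert (Kcl : Cclosed K) by (apply inter_closed; [apply ball_closed | apply halfplane_closed]).
  assert (Kco : Cconvex K) by (apply inter_convex; [apply ball_convex | apply halfplane_convex]).
  assert (KD : forall u, K u -> exists l, is_cderive g u l).
  { intros u [H1 H2]. apply Hg; [lra |]. intros ->.
    unfold cdot in H2. replace (a - a)%C with (RtoC 0) in H2 by ring.
    unfold Re, Im in H2; simpl in H2. lra. }
  assert (KC : forall u, K u -> Ccontinuous g u).
  { intros u Hu. destruct (KD u Hu) as [l Hl]. eapply is_cderive_Ccontinuous, Hl. }
  set (d := Rmin (Cmod n / 2) ((1 - Cmod z) / 2)).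
  assert (Hd : 0 < d) by (apply Rmin_pos; lra).
  assert (In1 : forall w, Cmod (w - z) < d -> K w /\ K (a + RtoC eps * (w - a))%C).
  { intros w Hw.
    assert (Hw1 := Rlt_le_trans _ _ _ Hw (Rmin_l _ _)).
    assert (Hw2 := Rlt_le_trans _ _ _ Hw (Rmin_r _ _)).
    assert (Q := Cmod_rev w z).
    assert (Hwr : Cmod w <= rho) by (apply Rle_trans with ((1 + Cmod z) / 2); [lra | apply Rmax_r]).
    assert (Har : Cmod a <= rho) by apply Rmax_l.
    assert (Hdot : Cmod n * Cmod n / 2 <= cdot (w - a) n).
    { replace (w - a)%C with (n + (w - z))%C by (unfold n; ring).
      rewrite cdot_plus, cdot_self. assert (X := cdot_le (w - z) n).
      apply Rabs_le_between in X. nra. }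
    assert (0 < Cmod n * Cmod n) by nra.
    split; split; auto.
    - unfold c. nra.
    - apply (ball_convex rho a w eps); auto. lra.
    - replace (a + RtoC eps * (w - a) - a)%C with (RtoC eps * (w - a))%C by ring.
      rewrite cdot_scal. unfold c. nra. }
  assert (Z : Cmod (z - z) < d) by (replace (z - z)%C with (RtoC 0) by ring; rewrite Cmod_0; lra).
  destruct (In1 z Z) as [Kz Kze].
  set (ze := (a + RtoC eps * (z - a))%C) in *.
  assert (Sc : forall u v, K u -> K v -> seg_continuous g u v)
    by (intros u v; apply convex_seg_continuous; assumption).
  apply is_cderive_locally_ext with
    (fun w => (seg_int g ze z + seg_int g z w) - seg_int g ze (a + RtoC eps * (w - a))%C)%C d; [exact Hd | |].
  - intros w Hw. destruct (In1 w Hw) as [Kw Kwe]. set (we := (a + RtoC eps * (w - a))%C) in *.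
    (* The quadrilateral is cut along the diagonal from [z_eps] to [w] into two triangles. *)
    assert (G1 := goursat K g ze z w Kcl Kco KD Kze Kz Kw).
    assert (G2 := goursat K g ze w we Kcl Kco KD Kze Kw Kwe).
    unfold tri_int in G1, G2.
    rewrite (seg_int_rev g ze w) in G1 by auto.
    rewrite (seg_int_rev g we w), (seg_int_rev g ze we) in G2 by auto.
    apply Ceq_minus.
    transitivity ((seg_int g ze z + seg_int g z w + - seg_int g ze w)
      + (seg_int g ze w + - seg_int g we w + - seg_int g ze we))%C; [ring |].
    rewrite G1, G2. ring.
  (* [seg_int_derive] needs continuity on a full neighbourhood, which may leave [K] but not reach
     [a] or the unit circle. *)
  - assert (Cd : forall u, K u -> exists e, 0 < e /\ forall y, Cmod (y - u) < e -> Ccontinuous g y).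
    { intros u Hu. assert (Hua : u <> a).
      { intros ->. destruct Hu as [_ Hu].
        unfold cdot in Hu. replace (a - a)%C with (RtoC 0) in Hu by ring.
        unfold Re, Im in Hu; simpl in Hu. lra. }
      assert (Hu1 : Cmod u < 1) by (destruct Hu; lra).
      assert (Hu2 : 0 < Cmod (u - a)) by (apply Cmod_gt_0, Cminus_eq_contra, Hua).
      exists (Rmin (Cmod (u - a)) (1 - Cmod u)). split; [apply Rmin_pos; lra |].
      intros y Hy. assert (Hy1 := Rlt_le_trans _ _ _ Hy (Rmin_l _ _)).
      assert (Hy2 := Rlt_le_trans _ _ _ Hy (Rmin_r _ _)).
      destruct (Hg y) as [l Hl].
      - assert (Q := Cmod_rev y u). lra.
      - intros ->. rewrite Cmod_minus_sym in Hy1. lra.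
      - eapply is_cderive_Ccontinuous, Hl. }
    apply is_cderive_minus.
    + replace (g z) with (RtoC 0 + g z)%C by ring. apply is_cderive_plus; [apply is_cderive_const |].
      destruct (Cd z Kz) as [e [He H]]. apply seg_int_derive with e; assumption.
    + apply (is_cderive_comp (fun w => seg_int g ze w) (fun w => a + RtoC eps * (w - a))%C).
      * fold ze. destruct (Cd ze Kze) as [e [He H]]. apply seg_int_derive with e; assumption.
      * apply is_cderive_affine.
Qed.

(** * Cauchy's formula *)


Lemma curve_continuous_mult (f g : R -> C) (t : R) : curve_continuous f t -> curve_continuous g t -> curve_continuous (fun s => f s * g s)%C t.
Proof.
  intros Hf Hg eps He.
  assert (P := Cmod_ge_0 (f t)). assert (Q := Cmod_ge_0 (g t)).
  set (M := Cmod (f t) + Cmod (g t) + 1).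
  assert (Hk : 0 < eps / (2 * M)) by (apply Rdiv_lt_0_compat; unfold M; lra).
  assert (E : eps = 2 * (eps / (2 * M) * M)) by (field; unfold M; lra).
  set (k := eps / (2 * M)) in *.
  destruct (Hf k Hk) as [d [Hd H1]].
  destruct (Hg (Rmin 1 k)) as [e [He' H2]]; [apply Rmin_pos; lra |].
  exists (Rmin d e). split; [apply Rmin_pos; lra |]. intros s Hs.
  specialize (H1 s (Rlt_le_trans _ _ _ Hs (Rmin_l _ _))).
  specialize (H2 s (Rlt_le_trans _ _ _ Hs (Rmin_r _ _))).
  assert (H2a := Rlt_le_trans _ _ _ H2 (Rmin_l _ _)).
  assert (H2b := Rlt_le_trans _ _ _ H2 (Rmin_r _ _)).
  replace (f s * g s - f t * g t)%C with ((f s - f t) * g s + f t * (g s - g t))%C by ring.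
  eapply Rle_lt_trans; [apply Cmod_triangle |]. rewrite !Cmod_mult.
  assert (Hg1 : Cmod (g s) <= Cmod (g t) + 1) by (assert (X := Cmod_rev (g s) (g t)); lra).
  assert (X1 := Cmod_ge_0 (f s - f t)). assert (X2 := Cmod_ge_0 (g s - g t)). assert (X3 := Cmod_ge_0 (g s)).
  apply Rle_lt_trans with (k * (Cmod (g t) + 1) + Cmod (f t) * k).
  - apply Rplus_le_compat; [apply Rmult_le_compat; lra | apply Rmult_le_compat_l; lra].
  - rewrite E. unfold M. nra.
Qed.

Lemma curve_continuous_const (c : C) (t : R) : curve_continuous (fun _ => c) t.
Proof.
  intros eps He. exists 1. split; [lra |]. intros s _.
  replace (c - c)%C with (RtoC 0) by ring. rewrite Cmod_0. exact He.
Qed.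

Lemma curve_continuous_circle (r t : R) : curve_continuous (circle r) t.
Proof. eapply is_curve_derive_curve_continuous, is_curve_derive_circle. Qed.

Lemma curve_continuous_comp_circle (f : C -> C) (r t : R) :
  hol f -> 0 <= r < 1 -> curve_continuous (fun s => f (circle r s)) t.
Proof.
  intros Hf Hr. apply (Ccontinuous_curve_continuous f (circle r)); [| apply curve_continuous_circle].
  apply hol_Ccontinuous; [exact Hf |]. unfold unit_disk. rewrite Cmod_circle; lra.
Qed.

Lemma circle_minus_ge (r t : R) (a : C) : 0 <= r -> r - Cmod a <= Cmod (circle r t - a).
Proof. intros Hr. assert (X := Cmod_rev (circle r t) a). rewrite Cmod_circle in X by lra. exact X. Qed.

Lemma circle_minus_nz (r t : R) (a : C) : 0 <= r -> Cmod a < r -> (circle r t - a)%C <> RtoC 0.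
Proof. intros Hr Ha. apply Cmod_gt_0. assert (X := circle_minus_ge r t a Hr). lra. Qed.

Lemma curve_continuous_kernel (r t : R) (a : C) : 0 <= r -> Cmod a < r ->
  curve_continuous (fun s => / (circle r s - a))%C t.
Proof.
  intros Hr Ha. apply (Ccontinuous_curve_continuous (fun z => / (z - a))%C (circle r)); [| apply curve_continuous_circle].
  eapply is_cderive_Ccontinuous. apply is_cderive_inv; [apply is_cderive_minus; [apply is_cderive_id | apply is_cderive_const] |].
  apply circle_minus_nz; assumption.
Qed.

Lemma curve_continuous_bounded (k : R -> C) (a b : R) : a <= b -> (forall t, a <= t <= b -> curve_continuous k t) ->
  exists B, 0 <= B /\ forall t, a <= t <= b -> Cmod (k t) <= B.
Proof.
  intros Hab Hk.
  destruct (continuity_ab_maj (fun t => Cmod (k t)) a b Hab) as [m [Hm1 Hm2]].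
  - intros t Ht eps He. destruct (Hk t Ht eps He) as [d [Hd H]].
    exists d. split; [exact Hd |]. intros s [_ Hs]. specialize (H s Hs).
    simpl. unfold Rdist. apply Rabs_def1.
    + assert (X := Cmod_rev (k s) (k t)). lra.
    + assert (X := Cmod_rev (k t) (k s)). rewrite Cmod_minus_sym in H. lra.
  - exists (Cmod (k m)). split; [apply Cmod_ge_0 | exact Hm1].
Qed.

Lemma PI2_pos : 0 <= 2 * PI.
Proof. assert (X := PI_RGT_0). lra. Qed.

(** Differentiation under the integral sign: a quadratic remainder uniform in [t] integrates to a
    quadratic remainder, and no limits have to be exchanged. *)
Lemma is_cderive_param (K : R -> C -> C) (K' : R -> C) (a : C) (d M : R) :
  0 < d -> 0 <= M ->
  (forall t b, 0 <= t <= 2 * PI -> Cmod (b - a) < d -> curve_continuous (fun s => K s b) t) ->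
  (forall t, 0 <= t <= 2 * PI -> curve_continuous K' t) ->
  (forall t b, 0 <= t <= 2 * PI -> Cmod (b - a) < d ->
     Cmod (K t b - K t a - K' t * (b - a)) <= M * (Cmod (b - a) * Cmod (b - a))) ->
  is_cderive (fun b => CInt (fun t => K t b) 0 (2 * PI)) a (CInt K' 0 (2 * PI)).
Proof.
  intros Hd HM HK HK' H. assert (P := PI2_pos).
  apply is_cderive_quadratic with (2 * PI * M) d; [exact Hd | nra |]. intros b Hb.
  assert (Z : Cmod (a - a) < d) by (replace (a - a)%C with (RtoC 0) by ring; rewrite Cmod_0; lra).
  rewrite Rmult_assoc. replace (2 * PI) with (2 * PI - 0) at 4 by ring.
  apply is_CInt_bound with (fun t => K t b - K t a - (b - a) * K' t)%C; [exact P | |].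
  - intros t Ht. rewrite (Cmult_comm (b - a)). apply H; assumption.
  - rewrite (Cmult_comm _ (b - a)). apply is_CInt_minus; [apply is_CInt_minus | apply is_CInt_scal];
      apply CInt_correct; auto.
Qed.

(** Exact first order Taylor remainder of [1 / u] at [v], meant for [u = zeta - b] and
    [v = zeta - a]; the next lemma does the same for [1 / u^2]. *)
Lemma kernel_identity (u v : C) : u <> RtoC 0 -> v <> RtoC 0 ->
  (/ u - / v - / (v * v) * (v - u) = (v - u) * (v - u) * (/ u * (/ v * / v)))%C.
Proof. intros. field. auto. Qed.

Lemma kernel_sq_identity (u v : C) : u <> RtoC 0 -> v <> RtoC 0 ->
  (/ u * / u - / v * / v - RtoC 2 * (/ v * / v * / v) * (v - u)
   = (v - u) * (v - u) * (/ u * (/ v * / v) * (/ u + RtoC 2 * / v)))%C.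
Proof. intros. field. auto. Qed.

(** The first half differentiates Cauchy's formula; the second shows that the resulting derivative
    is again differentiable. *)
Lemma is_cderive_cauchy_integral (k : R -> C) (r : R) (a : C) :
  0 <= r -> Cmod a < r -> (forall t, 0 <= t <= 2 * PI -> curve_continuous k t) ->
  is_cderive (fun b => CInt (fun t => k t * / (circle r t - b))%C 0 (2 * PI)) a
     (CInt (fun t => k t * (/ (circle r t - a) * / (circle r t - a)))%C 0 (2 * PI)) /\
  is_cderive (fun b => CInt (fun t => k t * (/ (circle r t - b) * / (circle r t - b)))%C 0 (2 * PI)) a
     (CInt (fun t => k t * (RtoC 2 * (/ (circle r t - a) * / (circle r t - a) * / (circle r t - a))))%C
        0 (2 * PI)).
Proof.
  intros Hr Ha Hk.
  destruct (curve_continuous_bounded k 0 (2 * PI) PI2_pos Hk) as [B [HB Hkb]].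
  set (e := r - Cmod a). assert (He : 0 < e) by (unfold e; lra).
  assert (HP : 0 < / e) by (apply Rinv_0_lt_compat; lra).
  assert (HP2 : / (e / 2) = 2 * / e) by (field; lra).
  assert (Near : forall b, Cmod (b - a) < e / 2 -> Cmod b < r /\ forall t,
    (circle r t - b)%C <> RtoC 0 /\ (circle r t - a)%C <> RtoC 0 /\
    Cmod (/ (circle r t - b)) <= 2 * / e /\ Cmod (/ (circle r t - a)) <= / e).
  { intros b Hb. assert (X := Cmod_rev b a).
    assert (Hbr : Cmod b < r) by (unfold e in *; lra). split; [exact Hbr |]. intros t.
    assert (Y1 := circle_minus_ge r t b Hr). assert (Y2 := circle_minus_ge r t a Hr).
    assert (N1 := circle_minus_nz r t b Hr Hbr). assert (N2 := circle_minus_nz r t a Hr Ha).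
    split; [exact N1 |]. split; [exact N2 |]. rewrite !Cmod_inv by assumption.
    split.
    - rewrite <- HP2. apply Rinv_le_contravar; unfold e in *; lra.
    - apply Rinv_le_contravar; unfold e in *; lra. }
  split.
  - apply (is_cderive_param (fun t b => k t * / (circle r t - b))%C) with (e / 2) (B * (2 * / e * (/ e * / e)));
      [lra | repeat apply Rmult_le_pos; lra | | |].
    + intros t b Ht Hb. apply curve_continuous_mult; [apply Hk, Ht |]. apply curve_continuous_kernel; [exact Hr | apply Near, Hb].
    + intros t Ht. repeat apply curve_continuous_mult; try apply Hk, Ht; apply curve_continuous_kernel; assumption.
    + intros t b Ht Hb. destruct (Near b Hb) as [_ N]. destruct (N t) as (N1 & N2 & M1 & M2).
      set (u := (circle r t - b)%C) in *. set (v := (circle r t - a)%C) in *.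
      assert (Ei := kernel_identity u v N1 N2).
      replace (b - a)%C with (v - u)%C by (unfold u, v; ring).
      replace (k t * / u - k t * / v - k t * (/ v * / v) * (v - u))%C
        with (k t * (/ u - / v - / (v * v) * (v - u)))%C by (field; auto).
      rewrite Ei, !Cmod_mult.
      rewrite (Rmult_comm (Cmod (v - u) * Cmod (v - u))), <- Rmult_assoc.
      apply Rmult_le_compat_r; [assert (X := Cmod_ge_0 (v - u)); nra |].
      assert (X1 := Cmod_ge_0 (/ u)). assert (X2 := Cmod_ge_0 (/ v)). assert (X3 := Cmod_ge_0 (k t)).
      repeat apply Rmult_le_compat; auto; nra.
  - apply (is_cderive_param (fun t b => k t * (/ (circle r t - b) * / (circle r t - b)))%C)
      with (e / 2) (B * (2 * / e * (/ e * / e) * (2 * / e + 2 * / e))); [lra | | | |].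
    { apply Rmult_le_pos; [exact HB |]. repeat apply Rmult_le_pos; lra. }
    + intros t b Ht Hb. repeat apply curve_continuous_mult; try apply Hk, Ht;
        apply curve_continuous_kernel; try exact Hr; apply Near, Hb.
    + intros t Ht. repeat apply curve_continuous_mult; try apply Hk, Ht; try apply curve_continuous_const;
        apply curve_continuous_kernel; assumption.
    + intros t b Ht Hb. destruct (Near b Hb) as [_ N]. destruct (N t) as (N1 & N2 & M1 & M2).
      set (u := (circle r t - b)%C) in *. set (v := (circle r t - a)%C) in *.
      assert (Ei := kernel_sq_identity u v N1 N2).
      replace (b - a)%C with (v - u)%C by (unfold u, v; ring).
      replace (k t * (/ u * / u) - k t * (/ v * / v) - k t * (RtoC 2 * (/ v * / v * / v)) * (v - u))%C
        with (k t * (/ u * / u - / v * / v - RtoC 2 * (/ v * / v * / v) * (v - u)))%C by ring.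
      rewrite Ei, Cmod_mult, (Cmod_mult ((v - u) * (v - u))%C), !(Cmod_mult (v - u)%C).
      rewrite (Rmult_comm (Cmod (v - u) * Cmod (v - u))), <- Rmult_assoc.
      apply Rmult_le_compat_r; [assert (X := Cmod_ge_0 (v - u)); nra |].
      assert (X4 : Cmod (/ u + RtoC 2 * / v) <= 2 * / e + 2 * / e).
      { eapply Rle_trans; [apply Cmod_triangle |]. rewrite Cmod_mult, Cmod_RtoC_pos by lra. lra. }
      rewrite !Cmod_mult.
      assert (X1 := Cmod_ge_0 (/ u)). assert (X2 := Cmod_ge_0 (/ v)). assert (X3 := Cmod_ge_0 (k t)).
      assert (X5 := Cmod_ge_0 (/ u + RtoC 2 * / v)).
      repeat apply Rmult_le_compat; auto; repeat apply Rmult_le_pos; auto.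
Qed.

Lemma Ci_cancel (z w : C) : (Ci * z = Ci * w -> z = w)%C.
Proof.
  intros H. replace z with (/ Ci * (Ci * z))%C by (field; apply Ci_nz).
  rewrite H. field. apply Ci_nz.
Qed.

(** As a function of the centre [b] the integral is constant: with [zeta] on the circle, its
    derivative integrates [zeta / (zeta - b)^2], the [t]-derivative of the periodic function
    [i / (zeta - b)]. At [b = 0] the integrand is 1. *)
Lemma circle_kernel_integral (r : R) (a : C) : 0 < r -> Cmod a < r ->
  is_CInt (fun t => circle r t * / (circle r t - a))%C 0 (2 * PI) (RtoC (2 * PI)).
Proof.
  intros Hr Ha. assert (P := PI2_pos).
  set (J := fun b => CInt (fun t => circle r t * / (circle r t - b))%C 0 (2 * PI)).
  assert (HJ : forall b, Cmod b < r -> is_cderive J b (RtoC 0)).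
  { intros b Hb. destruct (is_cderive_cauchy_integral (circle r) r b) as [H _];
      [lra | exact Hb | intros; apply curve_continuous_circle |].
    replace (RtoC 0) with (CInt (fun t => circle r t * (/ (circle r t - b) * / (circle r t - b)))%C 0 (2 * PI));
      [exact H |].
    apply is_CInt_CInt.
    replace (RtoC 0) with (Ci * (/ (circle r (2 * PI) - b) - / (circle r 0 - b)))%C
      by (rewrite circle_2PI; ring).
    apply is_CInt_ext with (fun t => Ci * (- (RtoC 1 - RtoC 0) / ((circle r t - b) * (circle r t - b))
       * (Ci * circle r t)))%C; [exact P | |].
    - intros t _. assert (N := circle_minus_nz r t b (Rlt_le _ _ Hr) Hb).
      replace (Ci * (- (RtoC 1 - RtoC 0) / ((circle r t - b) * (circle r t - b)) * (Ci * circle r t)))%C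
        with (- (Ci * Ci) * (circle r t * (/ (circle r t - b) * / (circle r t - b))))%C by (field; auto).
      replace (- (Ci * Ci))%C with (RtoC 1); [ring |].
      unfold Ci, RtoC, Cmult, Copp; simpl. f_equal; ring.
    - apply is_CInt_scal. apply (is_CInt_ftc (fun t => / (circle r t - b))%C); [exact P | |].
      + intros t _. assert (N := circle_minus_nz r t b (Rlt_le _ _ Hr) Hb).
        apply (is_cderive_is_curve_derive (fun z => / (z - b))%C (circle r)); [| apply is_curve_derive_circle].
        apply (is_cderive_inv (fun z => z - b)%C); [| exact N]. apply is_cderive_minus; [apply is_cderive_id | apply is_cderive_const].
      + intros t _. assert (N := circle_minus_nz r t b (Rlt_le _ _ Hr) Hb).
        apply curve_continuous_mult; [| apply curve_continuous_mult; [apply curve_continuous_const | apply curve_continuous_circle]].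
        unfold Cdiv. apply curve_continuous_mult; [apply curve_continuous_const |].
        eapply is_curve_derive_curve_continuous. apply (is_cderive_is_curve_derive (fun z => / ((z - b) * (z - b)))%C (circle r)); [| apply is_curve_derive_circle].
        apply (is_cderive_inv (fun z => (z - b) * (z - b))%C); [| apply Cmult_neq_0; exact N].
        apply (is_cderive_mult (fun z => z - b)%C (fun z => z - b)%C);
          (apply is_cderive_minus; [apply is_cderive_id | apply is_cderive_const]). }
  assert (E : (J a - J (RtoC 0) = RtoC 0)%C).
  { replace (J a - J (RtoC 0))%C with (J (RtoC 0 + RtoC 1 * a) - J (RtoC 0 + RtoC 0 * a))%C
      by (f_equal; f_equal; try f_equal; ring).
    eapply is_CInt_unique.
    - apply (is_CInt_ftc (fun s => J (RtoC 0 + RtoC s * a)%C) (fun _ => RtoC 0 * a)%C); [lra | |].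
      + intros s Hs. apply (is_cderive_is_curve_derive J (fun s => RtoC 0 + RtoC s * a)%C); [| apply is_curve_derive_line].
        apply HJ. rewrite Cplus_0_l, Cmod_mult, Cmod_RtoC_pos by lra.
        assert (X := Cmod_ge_0 a). nra.
      + intros; apply curve_continuous_const.
    - assert (X := is_CInt_const (RtoC 0 * a)%C 0 1).
      replace (RtoC (1 - 0) * (RtoC 0 * a))%C with (RtoC 0) in X by ring. exact X. }
  assert (E0 : J (RtoC 0) = RtoC (2 * PI)).
  { apply is_CInt_CInt. replace (RtoC (2 * PI)) with (RtoC (2 * PI - 0) * RtoC 1)%C
      by (rewrite Rminus_0_r; ring).
    apply is_CInt_ext with (fun _ => RtoC 1); [exact P | | apply is_CInt_const].
    intros t _. assert (N := circle_minus_nz r t (RtoC 0) (Rlt_le _ _ Hr)).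
    rewrite Cmod_0 in N. specialize (N Hr).
    replace (circle r t - RtoC 0)%C with (circle r t) in * by ring. field. exact N. }
  rewrite <- E0. replace (J (RtoC 0)) with (J a) by (apply Ceq_minus, E).
  apply CInt_correct; [exact P |]. intros t _. apply curve_continuous_mult; [apply curve_continuous_circle |].
  apply curve_continuous_kernel; lra.
Qed.

(** The integral of the difference quotient is unchanged when the circle is contracted towards [a],
    and tends to 0 there by mere continuity of [f]; no bound on the quotient near [a] is needed. *)
Lemma difference_quotient_integral (f : C -> C) (r : R) (a : C) :
  hol f -> 0 < r < 1 -> Cmod a < r ->
  is_CInt (fun t => (f (circle r t) - f a) * / (circle r t - a) * circle r t)%C 0 (2 * PI) (RtoC 0).
Proof.
  intros Hf Hr Ha. assert (P := PI2_pos).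
  assert (Da : unit_disk a) by (unfold unit_disk; lra).
  set (g := fun z => ((f z - f a) * / (z - a))%C).
  assert (Hg : forall u, unit_disk u -> u <> a -> exists l, is_cderive g u l).
  { intros u Hu Hua. eexists. apply is_cderive_mult.
    - apply is_cderive_minus; [apply Hf, Hu | apply is_cderive_const].
    - apply is_cderive_inv; [apply is_cderive_minus; [apply is_cderive_id | apply is_cderive_const] | apply Cminus_eq_contra, Hua]. }
  assert (Dc : forall t, unit_disk (circle r t)) by (intros t; unfold unit_disk; rewrite Cmod_circle; lra).
  assert (Nc : forall t, circle r t <> a) by (intros t; apply Cminus_nz, circle_minus_nz; lra).
  set (I := CInt (fun t => g (circle r t) * circle r t)%C 0 (2 * PI)).
  assert (Cg : forall t, curve_continuous (fun t => g (circle r t) * circle r t)%C t).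
  { intros t. apply curve_continuous_mult; [| apply curve_continuous_circle].
    apply (Ccontinuous_curve_continuous g (circle r)); [| apply curve_continuous_circle].
    destruct (Hg (circle r t) (Dc t) (Nc t)) as [l Hl]. eapply is_cderive_Ccontinuous, Hl. }
  assert (HI : is_CInt (fun t => g (circle r t) * circle r t)%C 0 (2 * PI) I)
    by (apply CInt_correct; [exact P | intros; apply Cg]).
  enough (I = RtoC 0) as <- by exact HI.
  apply Cmod_zero. apply le_epsilon. intros eta Heta. rewrite Rplus_0_l.
  (* Chosen so that the final estimate [2 PI * (q / (r - |a|)) * r] is exactly [eta]. *)
  set (q := eta * (r - Cmod a) / (2 * PI * r)).
  assert (Ppi := PI_RGT_0).
  assert (Hq : 0 < q).
  { apply Rdiv_lt_0_compat; [apply Rmult_lt_0_compat; lra | apply Rmult_lt_0_compat; lra]. }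
  destruct (hol_Ccontinuous f a Hf Da q Hq) as [d [Hd Hfa]].
  (* Points of the circle are at distance less than 2 from [a], so the contracted ones are at
     distance at most [2 d / 3 < d]. *)
  set (eps := Rmin 1 (d / 3)).
  assert (He1 : 0 < eps <= 1) by (split; [apply Rmin_pos; lra | apply Rmin_l]).
  assert (He2 : eps <= d / 3) by apply Rmin_r.
  set (ze := fun z => (a + RtoC eps * (z - a))%C).
  assert (Dze : forall t, unit_disk (ze (circle r t)) /\ ze (circle r t) <> a).
  { intros t. split.
    - unfold unit_disk. apply Rle_lt_trans with r; [| lra].
      apply (ball_convex r a (circle r t) eps); try lra. rewrite Cmod_circle; lra.
    - intros E. apply (Cmult_neq_0 (RtoC eps) (circle r t - a)%C).
      + intros X. apply RtoC_inj in X. lra.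
      + apply circle_minus_nz; lra.
      + transitivity (ze (circle r t) - a)%C; [unfold ze; ring | rewrite E; ring]. }
  set (h := fun t => (g (ze (circle r t)) * RtoC eps * circle r t)%C).
  assert (Ch : forall t, curve_continuous h t).
  { intros t. destruct (Dze t) as [D1 D2]. destruct (Hg _ D1 D2) as [l Hl].
    apply curve_continuous_mult; [| apply curve_continuous_circle]. apply curve_continuous_mult; [| apply curve_continuous_const].
    apply (Ccontinuous_curve_continuous g (fun t => ze (circle r t))); [eapply is_cderive_Ccontinuous, Hl |].
    apply (Ccontinuous_curve_continuous ze (circle r)); [apply Ccontinuous_affine | apply curve_continuous_circle]. }
  (* By [contraction_derive] the integrand is the derivative of the radial segment integral, which
     returns to its initial value after one turn. *)
  assert (HG : is_CInt (fun t => (g (circle r t) - g (ze (circle r t)) * RtoC eps) * (Ci * circle r t))%C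
    0 (2 * PI) (RtoC 0)).
  { replace (RtoC 0) with (seg_int g (ze (circle r (2 * PI))) (circle r (2 * PI))
      - seg_int g (ze (circle r 0)) (circle r 0))%C by (rewrite circle_2PI; ring).
    apply (is_CInt_ftc (fun t => seg_int g (ze (circle r t)) (circle r t))); [exact P | |].
    - intros t _. apply (is_cderive_is_curve_derive (fun w => seg_int g (ze w) w) (circle r)); [| apply is_curve_derive_circle].
      apply contraction_derive; auto.
    - intros t _. destruct (Dze t) as [D1 D2].
      apply (Ccontinuous_curve_continuous (fun z => (g z - g (ze z) * RtoC eps) * (Ci * z))%C (circle r));
        [| apply curve_continuous_circle].
      destruct (Hg _ (Dc t) (Nc t)) as [l1 Hl1]. destruct (Hg _ D1 D2) as [l2 Hl2].
      eapply is_cderive_Ccontinuous. apply (is_cderive_mult (fun z => g z - g (ze z) * RtoC eps)%C (fun z => Ci * z)%C).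
      + apply is_cderive_minus; [exact Hl1 |]. apply is_cderive_mult; [| apply is_cderive_const].
        apply (is_cderive_comp g ze); [exact Hl2 | apply is_cderive_affine].
      + apply is_cderive_scal, is_cderive_id. }
  assert (HII : (I - CInt h 0 (2 * PI) = RtoC 0)%C).
  { apply Ci_cancel. replace (Ci * RtoC 0)%C with (RtoC 0) by ring.
    eapply is_CInt_unique; [| exact HG].
    eapply is_CInt_ext; [exact P | | apply is_CInt_scal, is_CInt_minus; [exact HI | apply CInt_correct; auto]].
    intros t _. unfold h. simpl. ring. }
  replace I with (CInt h 0 (2 * PI)) by (symmetry; apply Ceq_minus, HII).
  apply Rle_trans with ((2 * PI - 0) * (q / (r - Cmod a) * r)).
  - apply is_CInt_bound with h; [exact P | | apply CInt_correct; auto].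
    intros t _. destruct (Dze t) as [D1 D2].
    assert (N := circle_minus_nz r t a (Rlt_le _ _ (proj1 Hr)) Ha).
    assert (Ne : RtoC eps <> RtoC 0) by (intros X; apply RtoC_inj in X; lra).
    (* The factor [eps] cancels the shrinking denominator [ze - a = eps (circle - a)]. *)
    replace (h t) with ((f (ze (circle r t)) - f a) * / (circle r t - a) * circle r t)%C.
    2: { unfold h, g, ze. field. split; [| exact N].
         replace (a + RtoC eps * (circle r t - a) - a)%C with (RtoC eps * (circle r t - a))%C by ring.
         apply Cmult_neq_0; assumption. }
    rewrite !Cmod_mult, Cmod_inv, Cmod_circle by (lra || exact N).
    apply Rmult_le_compat_r; [lra |].
    apply Rmult_le_compat; [apply Cmod_ge_0 | left; apply Rinv_0_lt_compat, Cmod_gt_0, N | |].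
    + left. apply Hfa. replace (ze (circle r t) - a)%C with (RtoC eps * (circle r t - a))%C
        by (unfold ze; ring).
      rewrite Cmod_mult, Cmod_RtoC_pos by lra.
      assert (X := Cmod_sub_le (circle r t) a). rewrite Cmod_circle in X by lra.
      assert (Y := Cmod_ge_0 (circle r t - a)). nra.
    + apply Rinv_le_contravar; [lra | apply circle_minus_ge; lra].
  - right. unfold q. field. split; [lra | split; lra].
Qed.

(** On the circle, [d zeta / (2 pi i)] is [zeta dt / (2 pi)]. *)
Definition cauchy_kernel (f : C -> C) (r t : R) : C := (f (circle r t) * circle r t * / RtoC (2 * PI))%C.

Lemma RtoC_2PI_nz : RtoC (2 * PI) <> RtoC 0.
Proof. intros H. apply RtoC_inj in H. assert (X := PI_RGT_0). lra. Qed.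

Lemma cauchy_formula (f : C -> C) (r : R) (a : C) :
  hol f -> 0 < r < 1 -> Cmod a < r ->
  is_CInt (fun t => cauchy_kernel f r t * / (circle r t - a))%C 0 (2 * PI) (f a).
Proof.
  intros Hf Hr Ha.
  assert (H1 := difference_quotient_integral f r a Hf Hr Ha).
  assert (H2 := is_CInt_scal (f a) _ _ _ _ (circle_kernel_integral r a (proj1 Hr) Ha)).
  assert (H3 := is_CInt_scal (/ RtoC (2 * PI))%C _ _ _ _ (is_CInt_plus _ _ _ _ _ _ H1 H2)).
  replace (/ RtoC (2 * PI) * (RtoC 0 + f a * RtoC (2 * PI)))%C with (f a) in H3
    by (field; apply RtoC_2PI_nz).
  eapply is_CInt_ext; [apply PI2_pos | | exact H3].
  intros t _. simpl. unfold cauchy_kernel. ring.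
Qed.

Lemma curve_continuous_cauchy_kernel (f : C -> C) (r t : R) : hol f -> 0 < r < 1 -> curve_continuous (cauchy_kernel f r) t.
Proof.
  intros Hf Hr. apply curve_continuous_mult; [| apply curve_continuous_const].
  apply curve_continuous_mult; [apply curve_continuous_comp_circle; [exact Hf | lra] | apply curve_continuous_circle].
Qed.

Lemma radius_between (z : C) : unit_disk z -> exists r, 0 < r < 1 /\ Cmod z < r.
Proof. intros H. unfold unit_disk in H. exists ((1 + Cmod z) / 2). assert (X := Cmod_ge_0 z). lra. Qed.

Lemma cauchy_formula_derive (f : C -> C) (r : R) (a : C) :
  hol f -> 0 < r < 1 -> Cmod a < r ->
  C_derive f a = CInt (fun t => cauchy_kernel f r t * (/ (circle r t - a) * / (circle r t - a)))%C 0 (2 * PI).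
Proof.
  intros Hf Hr Ha. apply is_cderive_C_derive.
  apply is_cderive_locally_ext with (fun b => CInt (fun t => cauchy_kernel f r t * / (circle r t - b))%C 0 (2 * PI))
    (r - Cmod a); [lra | |].
  - intros b Hb. apply is_CInt_CInt, cauchy_formula; auto. assert (X := Cmod_rev b a). lra.
  - apply (proj1 (is_cderive_cauchy_integral (cauchy_kernel f r) r a ltac:(lra) Ha
      (fun t _ => curve_continuous_cauchy_kernel f r t Hf Hr))).
Qed.

Lemma hol_derive (f : C -> C) : hol f -> hol (C_derive f).
Proof.
  intros Hf. apply is_cderive_hol. intros z Hz. destruct (radius_between z Hz) as (r & Hr & Hzr).
  eexists. apply is_cderive_locally_ext with
    (fun b => CInt (fun t => cauchy_kernel f r t * (/ (circle r t - b) * / (circle r t - b)))%C 0 (2 * PI))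
    (r - Cmod z); [lra | |].
  - intros b Hb. symmetry. apply cauchy_formula_derive; auto. assert (X := Cmod_rev b z). lra.
  - apply (proj2 (is_cderive_cauchy_integral (cauchy_kernel f r) r z ltac:(lra) Hzr
      (fun t _ => curve_continuous_cauchy_kernel f r t Hf Hr))).
Qed.

Definition divz (f : C -> C) (z : C) : C :=
  if Ceq_dec z (RtoC 0) then C_derive f (RtoC 0) else (f z / z)%C.

Lemma divz_mult (f : C -> C) (z : C) : f (RtoC 0) = RtoC 0 -> (z * divz f z)%C = f z.
Proof.
  intros H. unfold divz. destruct (Ceq_dec z (RtoC 0)) as [-> | Hz]; [rewrite H; ring | field; exact Hz].
Qed.

(** Subtracting Cauchy's formulas at [b] and at 0 and dividing by [b] represents the quotient as the
    Cauchy integral with density [k]; at [b = 0] the same integral is the formula for [f'(0)]. The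
    singularity is thus removed without a separate argument. *)
Lemma hol_divz (f : C -> C) : hol f -> f (RtoC 0) = RtoC 0 -> hol (divz f).
Proof.
  intros Hf H0. apply is_cderive_hol. intros z Hz. destruct (radius_between z Hz) as (r & Hr & Hzr).
  set (k := fun t => (f (circle r t) * / RtoC (2 * PI))%C).
  assert (Hk : forall t, curve_continuous k t).
  { intros t. apply curve_continuous_mult; [apply curve_continuous_comp_circle; [exact Hf | lra] | apply curve_continuous_const]. }
  assert (N0 : forall t, circle r t <> RtoC 0).
  { intros t. apply Cmod_gt_0. rewrite Cmod_circle; lra. }
  eexists. apply is_cderive_locally_ext with (fun b => CInt (fun t => k t * / (circle r t - b))%C 0 (2 * PI))
    (r - Cmod z); [lra | |].
  - intros b Hb. assert (Hbr : Cmod b < r) by (assert (X := Cmod_rev b z); lra).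
    unfold divz. destruct (Ceq_dec b (RtoC 0)) as [-> | Hbz].
    + rewrite (cauchy_formula_derive f r) by auto. symmetry. apply is_CInt_CInt.
      eapply is_CInt_ext; [apply PI2_pos | | apply CInt_correct; [apply PI2_pos |]].
      * intros t _. unfold k, cauchy_kernel. simpl.
        replace (circle r t - RtoC 0)%C with (circle r t) by ring. field.
        split; [apply N0 | apply RtoC_2PI_nz].
      * intros t _. apply curve_continuous_mult; [apply Hk | apply curve_continuous_kernel; lra].
    + apply is_CInt_CInt.
      assert (H1 := cauchy_formula f r b Hf Hr Hbr).
      assert (H2 := cauchy_formula f r (RtoC 0) Hf Hr ltac:(rewrite Cmod_0; lra)).
      assert (H3 := is_CInt_scal (/ b)%C _ _ _ _ (is_CInt_minus _ _ _ _ _ _ H1 H2)).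
      rewrite H0 in H3. replace (/ b * (f b - RtoC 0))%C with (f b / b)%C in H3 by (field; exact Hbz).
      eapply is_CInt_ext; [apply PI2_pos | | exact H3].
      intros t _. simpl. unfold cauchy_kernel, k.
      assert (N1 := circle_minus_nz r t b (Rlt_le _ _ (proj1 Hr)) Hbr).
      replace (circle r t - RtoC 0)%C with (circle r t) by ring. field.
      repeat split; auto; apply RtoC_2PI_nz.
  - apply (proj1 (is_cderive_cauchy_integral k r z ltac:(lra) Hzr (fun t _ => Hk t))).
Qed.

(** The factor [r / (r - |a|)] does not depend on [f]; applying the estimate to powers of [f]
    removes it in [maximum_modulus]. *)
Lemma cauchy_estimate (f : C -> C) (r B : R) (a : C) :
  hol f -> 0 < r < 1 -> Cmod a < r -> (forall t, 0 <= t <= 2 * PI -> Cmod (f (circle r t)) <= B) ->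
  Cmod (f a) <= B * (r / (r - Cmod a)).
Proof.
  intros Hf Hr Ha HB. assert (P := PI_RGT_0).
  replace (B * (r / (r - Cmod a))) with ((2 * PI - 0) * (B * r * / (2 * PI) * / (r - Cmod a)))
    by (field; split; lra).
  eapply is_CInt_bound; [apply PI2_pos | | apply (cauchy_formula f r a Hf Hr Ha)].
  intros t Ht. assert (N1 := circle_minus_nz r t a (Rlt_le _ _ (proj1 Hr)) Ha).
  unfold cauchy_kernel.
  rewrite !Cmod_mult, (Cmod_inv (circle r t - a)), (Cmod_inv (RtoC (2 * PI))), Cmod_circle, (Cmod_RtoC_pos (2 * PI))
    by (lra || exact N1 || apply RtoC_2PI_nz).
  assert (X : Cmod (f (circle r t)) <= B) by (apply HB, Ht).
  assert (Y := Cmod_ge_0 (f (circle r t))).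
  assert (0 < / (2 * PI)) by (apply Rinv_0_lt_compat; lra).
  assert (Z : 0 < / Cmod (circle r t - a)) by (apply Rinv_0_lt_compat, Cmod_gt_0, N1).
  apply Rmult_le_compat; [| lra | | apply Rinv_le_contravar; [lra | apply circle_minus_ge; lra]].
  - repeat apply Rmult_le_pos; lra.
  - apply Rmult_le_compat_r; [lra |]. apply Rmult_le_compat_r; lra.
Qed.

(** * Maximum modulus, identity theorem, square root and exponential *)


Lemma hol_mult (f g : C -> C) : hol f -> hol g -> hol (fun z => f z * g z)%C.
Proof. intros Hf Hg. apply is_cderive_hol. intros z Hz. eexists. apply is_cderive_mult; [apply Hf | apply Hg]; exact Hz. Qed.

Lemma hol_pow (f : C -> C) (n : nat) : hol f -> hol (fun z => f z ^ n)%C.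
Proof.
  intros Hf. induction n.
  - apply is_cderive_hol. intros z _. eexists. apply (is_cderive_const (RtoC 1)).
  - apply (hol_mult f (fun z => f z ^ n)%C); assumption.
Qed.

Lemma pow_bounded (x K : R) : (forall n, x ^ n <= K) -> x <= 1.
Proof.
  intros H. destruct (Rle_lt_dec x 1) as [L | L]; [exact L | exfalso].
  destruct (Pow_x_infinity x) with (b := K + 1) as [N HN]; [rewrite Rabs_pos_eq; lra |].
  specialize (HN N (Nat.le_refl N)). rewrite Rabs_pos_eq in HN by (apply pow_le; lra).
  specialize (H N). lra.
Qed.

(* Cauchy's formula for f ^ n bounds |f a| ^ n by a fixed multiple of B ^ n. *)
Lemma maximum_modulus (f : C -> C) (r B : R) (a : C) :
  hol f -> 0 < r < 1 -> Cmod a < r -> 0 < B ->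
  (forall t, 0 <= t <= 2 * PI -> Cmod (f (circle r t)) <= B) -> Cmod (f a) <= B.
Proof.
  intros Hf Hr Ha HB H.
  enough (Cmod (f a) / B <= 1).
  { apply Rmult_le_reg_r with (/ B); [apply Rinv_0_lt_compat, HB |]. rewrite Rinv_r by lra. exact H0. }
  apply pow_bounded with (r / (r - Cmod a)). intros n.
  unfold Rdiv at 1. rewrite Rpow_mult_distr, pow_inv.
  assert (P := pow_lt B n HB).
  apply Rmult_le_reg_r with (B ^ n); [exact P |].
  rewrite Rmult_assoc, Rinv_l, Rmult_1_r, <- Cmod_pow by lra.
  rewrite (Rmult_comm (r / _)). apply (cauchy_estimate (fun z : C => f z ^ n)%C); auto using hol_pow.
  intros t Ht. rewrite Cmod_pow. apply pow_incr. split; [apply Cmod_ge_0 | apply H, Ht].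
Qed.

Lemma schwarz (w : C -> C) (z : C) :
  hol w -> w (RtoC 0) = RtoC 0 -> (forall u, unit_disk u -> Cmod (w u) < 1) ->
  unit_disk z -> Cmod (w z) <= Cmod z.
Proof.
  intros Hw H0 Hb Hz.
  rewrite <- (divz_mult w z H0), Cmod_mult.
  enough (Cmod (divz w z) <= 1) by (assert (X := Cmod_ge_0 z); nra).
  assert (H : forall r, Cmod z < r < 1 -> r * Cmod (divz w z) <= 1).
  { intros r Hr. assert (X := Cmod_ge_0 z).
    assert (Cmod (divz w z) <= / r).
    { apply (maximum_modulus (divz w) r); [apply hol_divz; assumption | lra | lra | |].
      - apply Rinv_0_lt_compat; lra.
      - intros t _.
        assert (E : Cmod (circle r t) * Cmod (divz w (circle r t)) < 1).
        { rewrite <- Cmod_mult, divz_mult by exact H0. apply Hb.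
          unfold unit_disk. rewrite Cmod_circle; lra. }
        rewrite Cmod_circle in E by lra.
        apply Rmult_le_reg_l with r; [lra |]. rewrite Rinv_r by lra. lra. }
    replace 1 with (r * / r) by (field; lra). apply Rmult_le_compat_l; lra. }
  unfold unit_disk in Hz.
  destruct (Rle_lt_dec (Cmod (divz w z)) 1) as [L | L]; [exact L | exfalso].
  set (x := Cmod (divz w z)) in *.
  assert (Hx : / x < 1) by (rewrite <- Rinv_1; apply Rinv_lt_contravar; lra).
  assert (Hx0 : 0 < / x) by (apply Rinv_0_lt_compat; lra).
  (* If [x > 1], any [r] between [m] and 1 gives [r x > 1], against the bound for that [r]; the
     midpoint is used. *)
  set (m := Rmax (Cmod z) (/ x)).
  assert (Hm : m < 1) by (apply Rmax_lub_lt; lra).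
  assert (Hm1 : Cmod z <= m) by apply Rmax_l. assert (Hm2 : / x <= m) by apply Rmax_r.
  specialize (H ((1 + m) / 2) ltac:(lra)).
  assert (E : / x * x = 1) by (field; lra). nra.
Qed.

Definition zero_near_0 (f : C -> C) : Prop :=
  exists d, 0 < d /\ forall z, Cmod z < d -> f z = RtoC 0.

Lemma divz_zero_near_0 (f : C -> C) : zero_near_0 f -> zero_near_0 (divz f).
Proof.
  intros [d [Hd H]]. exists d. split; [exact Hd |]. intros z Hz. unfold divz.
  destruct (Ceq_dec z (RtoC 0)) as [-> | Hz0].
  - apply is_cderive_C_derive. apply is_cderive_locally_ext with (fun _ => RtoC 0) d; [exact Hd | | apply is_cderive_const].
    intros y Hy. symmetry. apply H. replace (y - RtoC 0)%C with y in Hy by ring. exact Hy.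
  - rewrite H by exact Hz. field. exact Hz0.
Qed.

Lemma zero_near_0_eq (f : C -> C) : zero_near_0 f -> f (RtoC 0) = RtoC 0.
Proof. intros [d [Hd H]]. apply H. rewrite Cmod_0. exact Hd. Qed.

Fixpoint divzn (n : nat) (f : C -> C) : C -> C :=
  match n with O => f | S n => divzn n (divz f) end.

Lemma divzn_spec (n : nat) : forall f, hol f -> zero_near_0 f ->
  hol (divzn n f) /\ forall z, f z = (z ^ n * divzn n f z)%C.
Proof.
  induction n; intros f Hf H0; simpl.
  - split; [exact Hf |]. intros z. ring.
  - assert (E := zero_near_0_eq f H0).
    destruct (IHn (divz f)) as [H1 H2]; [apply hol_divz; assumption | apply divz_zero_near_0, H0 |].
    split; [exact H1 |]. intros z. rewrite <- (divz_mult f z E), (H2 z). ring.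
Qed.

(* f / z ^ n is analytic for every n, so |f a| <= B (|a| / r) ^ n by the maximum modulus principle. *)
Lemma identity_theorem (f : C -> C) (a : C) :
  hol f -> zero_near_0 f -> unit_disk a -> f a = RtoC 0.
Proof.
  intros Hf H0 Ha. destruct (radius_between a Ha) as (r & Hr & Har).
  destruct (curve_continuous_bounded (fun t => f (circle r t)) 0 (2 * PI) PI2_pos) as [B [HB Hb]].
  { intros t _. apply curve_continuous_comp_circle; [exact Hf | lra]. }
  apply Cmod_zero. apply le_epsilon. intros eps He. rewrite Rplus_0_l.
  assert (X := Cmod_ge_0 a).
  assert (Hq : 0 <= Cmod a / r < 1).
  { split; [apply Rdiv_le_0_compat; lra |]. apply Rmult_lt_reg_r with r; [lra |].
    unfold Rdiv. rewrite Rmult_assoc, Rinv_l by lra. lra. }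
  destruct (pow_lt_1_zero (Cmod a / r)) with (y := eps / (B + 1)) as [N HN];
    [rewrite Rabs_pos_eq; lra | apply Rdiv_lt_0_compat; lra |].
  specialize (HN N (Nat.le_refl N)). rewrite Rabs_pos_eq in HN by (apply pow_le; lra).
  destruct (divzn_spec N f Hf H0) as [H1 H2].
  assert (Hrn := pow_lt r N (proj1 Hr)).
  (* [B] may be 0, whereas [maximum_modulus] asks for a positive bound. *)
  assert (M : Cmod (divzn N f a) <= (B + 1) / r ^ N).
  { apply (maximum_modulus _ r); [exact H1 | exact Hr | exact Har | apply Rdiv_lt_0_compat; lra |].
    intros t Ht. specialize (Hb t Ht). rewrite (H2 (circle r t)), Cmod_mult, Cmod_pow, Cmod_circle in Hb by lra.
    apply Rmult_le_reg_l with (r ^ N); [exact Hrn |].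
    replace (r ^ N * ((B + 1) / r ^ N)) with (B + 1) by (field; lra). lra. }
  rewrite (H2 a), Cmod_mult, Cmod_pow.
  apply Rle_trans with (Cmod a ^ N * ((B + 1) / r ^ N)).
  - apply Rmult_le_compat_l; [apply pow_le, X | exact M].
  - apply Rle_trans with ((B + 1) * (Cmod a / r) ^ N).
    + right. unfold Rdiv. rewrite Rpow_mult_distr, pow_inv. field. lra.
    + left. apply Rlt_le_trans with ((B + 1) * (eps / (B + 1))).
      * apply Rmult_lt_compat_l; lra.
      * right. field. lra.
Qed.

(** * The principal square root *)

Lemma Csqrt_Re (z : C) : Re (Csqrt z) = sqrt ((Cmod z + Re z) / 2).
Proof. reflexivity. Qed.

Lemma Csqrt_Re_pos (z : C) : 0 < Re z -> 0 < Re (Csqrt z).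
Proof. intros H. rewrite Csqrt_Re. apply sqrt_lt_R0. assert (X := Cmod_ge_0 z). lra. Qed.

Lemma Csqrt_Re_nonneg (z : C) : 0 <= Re (Csqrt z).
Proof. rewrite Csqrt_Re. apply sqrt_pos. Qed.

Lemma Re_le_Cmod (z : C) : Re z <= Cmod z.
Proof. apply Re_le_Cmod_abs. Qed.

Lemma Re_pos_nz (z : C) : 0 < Re z -> z <> RtoC 0.
Proof. intros H ->. unfold Re, RtoC in H; simpl in H. lra. Qed.

(** Both roots have nonnegative real part, so the sum in [y - z = (sqrt y - sqrt z) (sqrt y + sqrt
    z)] has modulus at least [Re (sqrt z)]. This settles the choice of branch for all [y]. *)
Lemma Csqrt_lipschitz (z y : C) :
  Cmod (Csqrt y - Csqrt z) * Re (Csqrt z) <= Cmod (y - z).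
Proof.
  replace (y - z)%C with ((Csqrt y - Csqrt z) * (Csqrt y + Csqrt z))%C
    by (transitivity (Csqrt y * Csqrt y - Csqrt z * Csqrt z)%C; [ring | rewrite !Csqrt_sqr; reflexivity]).
  rewrite Cmod_mult. apply Rmult_le_compat_l; [apply Cmod_ge_0 |].
  eapply Rle_trans; [| apply Re_le_Cmod]. rewrite re_plus. assert (X := Csqrt_Re_nonneg y). lra.
Qed.

Lemma is_cderive_Csqrt (z : C) : 0 < Re z -> is_cderive Csqrt z (/ (RtoC 2 * Csqrt z))%C.
Proof.
  intros Hz. assert (P := Csqrt_Re_pos z Hz). assert (Nz := Re_pos_nz _ P).
  set (x := Re (Csqrt z)) in *.
  assert (N2 : RtoC 2 <> RtoC 0) by (intros E; apply RtoC_inj in E; lra).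
  assert (Hx : 0 < / x) by (apply Rinv_0_lt_compat, P).
  apply is_cderive_quadratic with (/ x * / x * / x) 1; [lra | repeat apply Rmult_le_pos; lra |].
  intros y _.
  assert (L : Cmod (Csqrt y - Csqrt z) <= / x * Cmod (y - z)).
  { apply Rmult_le_reg_r with x; [exact P |].
    replace (/ x * Cmod (y - z) * x) with (Cmod (y - z)) by (field; lra). apply Csqrt_lipschitz. }
  assert (E : (y - z)%C = ((Csqrt y - Csqrt z) * (Csqrt y + Csqrt z))%C)
    by (transitivity (Csqrt y * Csqrt y - Csqrt z * Csqrt z)%C; [rewrite !Csqrt_sqr; reflexivity | ring]).
  (* The exact remainder is [- (sqrt y - sqrt z)^2 / (2 sqrt z)], quadratic by the Lipschitz
     bound. *)
  replace (Csqrt y - Csqrt z - / (RtoC 2 * Csqrt z) * (y - z))%C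
    with (- ((Csqrt y - Csqrt z) * (Csqrt y - Csqrt z) * / (RtoC 2 * Csqrt z)))%C
    by (rewrite E; field; auto).
  rewrite Cmod_opp, !Cmod_mult, Cmod_inv, Cmod_mult, Cmod_RtoC_pos by (lra || (apply Cmult_neq_0; auto)).
  assert (Hs : x <= Cmod (Csqrt z)) by apply Re_le_Cmod.
  assert (Hi : / (2 * Cmod (Csqrt z)) <= / x) by (apply Rinv_le_contravar; lra).
  assert (Hi0 : 0 < / (2 * Cmod (Csqrt z))) by (apply Rinv_0_lt_compat; lra).
  assert (X := Cmod_ge_0 (Csqrt y - Csqrt z)). assert (Y := Cmod_ge_0 (y - z)).
  replace (/ x * / x * / x * (Cmod (y - z) * Cmod (y - z)))
    with ((/ x * Cmod (y - z)) * (/ x * Cmod (y - z)) * / x) by ring.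
  repeat apply Rmult_le_compat; nra.
Qed.

Lemma Re_1_plus_pos (z : C) : unit_disk z -> 0 < Re (RtoC 1 + z)%C.
Proof.
  intros H. unfold unit_disk in H. destruct (Re_le_Cmod_abs z). rewrite re_plus, re_RtoC. lra.
Qed.

Lemma is_cderive_phi_L (z : C) : unit_disk z -> is_cderive phi_L z (/ (RtoC 2 * phi_L z))%C.
Proof.
  intros Hz. replace (/ (RtoC 2 * phi_L z))%C with (/ (RtoC 2 * phi_L z) * (RtoC 0 + RtoC 1))%C by ring.
  apply (is_cderive_comp Csqrt (fun z => RtoC 1 + z)%C).
  - apply is_cderive_Csqrt, Re_1_plus_pos, Hz.
  - apply is_cderive_plus; [apply is_cderive_const | apply is_cderive_id].
Qed.

Lemma hol_phi_L : hol phi_L.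
Proof. apply is_cderive_hol. intros z Hz. eexists. apply is_cderive_phi_L, Hz. Qed.

(** * The complex exponential *)

Definition Cexp (z : C) : C := (exp (Re z) * cos (Im z), exp (Re z) * sin (Im z)).

Lemma Cexp_plus (a b : C) : Cexp (a + b) = (Cexp a * Cexp b)%C.
Proof.
  unfold Cexp, Cmult. rewrite re_plus, im_plus, exp_plus, cos_plus, sin_plus. simpl. f_equal; ring.
Qed.

Lemma Cexp_0 : Cexp (RtoC 0) = RtoC 1.
Proof. unfold Cexp. simpl. rewrite exp_0, cos_0, sin_0. unfold RtoC. f_equal; ring. Qed.

Lemma Cexp_nz (z : C) : Cexp z <> RtoC 0.
Proof.
  intros E. assert (H := Cexp_plus z (- z)). rewrite E in H.
  replace (z + - z)%C with (RtoC 0) in H by ring. rewrite Cexp_0 in H.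
  apply C1_nz. rewrite H. ring.
Qed.

Lemma is_cderive_Cexp_0 : is_cderive Cexp (RtoC 0) (RtoC 1).
Proof.
  intros eps He.
  (* The remainders add up to [4 k |z|] in the real part and [5 k |z|] in the imaginary part. *)
  set (k := Rmin 1 (eps / 10)).
  assert (Hk : 0 < k) by (apply Rmin_pos; lra).
  assert (Hk1 : k <= 1) by apply Rmin_l. assert (Hk2 : k <= eps / 10) by apply Rmin_r.
  destruct (proj1 (is_derive_eps exp 0 1)) with (eps := k) as [d1 [Hd1 H1]]; [auto_derive; auto; rewrite exp_0; ring | exact Hk |].
  destruct (proj1 (is_derive_eps cos 0 0)) with (eps := k) as [d2 [Hd2 H2]]; [auto_derive; auto; rewrite sin_0; ring | exact Hk |].
  destruct (proj1 (is_derive_eps sin 0 1)) with (eps := k) as [d3 [Hd3 H3]]; [auto_derive; auto; rewrite cos_0; ring | exact Hk |].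
  exists (Rmin k (Rmin d1 (Rmin d2 d3))). split; [repeat apply Rmin_pos; lra |].
  intros z Hz. replace (z - RtoC 0)%C with z in * by ring.
  assert (B0 := Rlt_le_trans _ _ _ Hz (Rmin_l _ _)).
  assert (B' := Rlt_le_trans _ _ _ Hz (Rmin_r _ _)).
  assert (B1 := Rlt_le_trans _ _ _ B' (Rmin_l _ _)).
  assert (B'' := Rlt_le_trans _ _ _ B' (Rmin_r _ _)).
  assert (B2 := Rlt_le_trans _ _ _ B'' (Rmin_l _ _)).
  assert (B3 := Rlt_le_trans _ _ _ B'' (Rmin_r _ _)).
  assert (Rx := re_le_Cmod z). assert (Ry := Im_le_Cmod z).
  rewrite Cexp_0.
  set (n := Cmod z) in *. assert (Hn : 0 <= n) by apply Cmod_ge_0.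
  unfold Cexp. set (x := Re z) in *. set (y := Im z) in *.
  assert (Ez : z = (x, y)) by (destruct z; reflexivity). rewrite Ez.
  specialize (H1 x). specialize (H2 y). specialize (H3 y).
  rewrite Rminus_0_r in H1, H2, H3. rewrite exp_0 in H1. rewrite cos_0 in H2. rewrite sin_0 in H3.
  specialize (H1 ltac:(lra)). specialize (H2 ltac:(lra)). specialize (H3 ltac:(lra)).
  set (al := exp x - 1 - 1 * x) in *. set (be := cos y - 1 - 0 * y) in *. set (ga := sin y - 0 - 1 * y) in *.
  assert (Ex : exp x = 1 + x + al) by (unfold al; ring).
  assert (Ec : cos y = 1 + be) by (unfold be; ring).
  assert (Es : sin y = y + ga) by (unfold ga; ring).
  rewrite Ex, Ec, Es.
  assert (A1 : Rabs al <= k * n) by (apply Rle_trans with (k * Rabs x); [exact H1 | apply Rmult_le_compat_l; lra]).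
  assert (A2 : Rabs be <= k * n) by (apply Rle_trans with (k * Rabs y); [exact H2 | apply Rmult_le_compat_l; lra]).
  assert (A3 : Rabs ga <= k * n) by (apply Rle_trans with (k * Rabs y); [exact H3 | apply Rmult_le_compat_l; lra]).
  clear H1 H2 H3. clearbody al be ga x y.
  assert (An : k * n <= 1) by nra.
  assert (Ax : Rabs (1 + x + al) <= 3).
  { eapply Rle_trans; [apply Rabs_triang |]. assert (X := Rabs_triang 1 x). rewrite Rabs_R1 in X. lra. }
  eapply Rle_trans; [apply Cmod_le_Re_Im |]. simpl.
  replace ((1 + x + al) * (1 + be) + - (1) + - (1 * x - 0 * y)) with (al + (1 + x + al) * be) by ring.
  replace ((1 + x + al) * (y + ga) + - 0 + - (1 * y + 0 * x)) with ((x * y + al * y) + (1 + x + al) * ga) by ring.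
  assert (T1 : Rabs (al + (1 + x + al) * be) <= k * n + 3 * (k * n)).
  { eapply Rle_trans; [apply Rabs_triang |]. rewrite Rabs_mult.
    apply Rplus_le_compat; [exact A1 |]. apply Rmult_le_compat; auto using Rabs_pos. }
  assert (T2 : Rabs ((x * y + al * y) + (1 + x + al) * ga) <= k * n + k * n + 3 * (k * n)).
  { eapply Rle_trans; [apply Rabs_triang |]. rewrite (Rabs_mult (1 + x + al)).
    apply Rplus_le_compat; [| apply Rmult_le_compat; auto using Rabs_pos].
    eapply Rle_trans; [apply Rabs_triang |]. rewrite !Rabs_mult.
    apply Rplus_le_compat.
    - apply Rmult_le_compat; auto using Rabs_pos. lra.
    - apply Rle_trans with (k * n * 1); [apply Rmult_le_compat; auto using Rabs_pos; lra | lra]. }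
  fold n. nra.
Qed.

(** The functional equation transports the derivative from 0. *)
Lemma is_cderive_Cexp (z : C) : is_cderive Cexp z (Cexp z).
Proof.
  apply is_cderive_ext with (fun y => Cexp z * Cexp (y - z))%C.
  - intros y. rewrite <- Cexp_plus. f_equal. ring.
  - apply is_cderive_eq with (Cexp z * (RtoC 1 * (RtoC 1 - RtoC 0)))%C; [| ring].
    apply is_cderive_scal. apply (is_cderive_comp Cexp (fun y => y - z)%C).
    + replace (z - z)%C with (RtoC 0) by ring. apply is_cderive_Cexp_0.
    + apply is_cderive_minus; [apply is_cderive_id | apply is_cderive_const].
Qed.

(** * The disk estimate *)


Lemma exp_ge_pow (x : R) (n : nat) : (0 < n)%nat -> 0 <= 1 + x / INR n -> (1 + x / INR n) ^ n <= exp x.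
Proof.
  intros Hn Hx. assert (P : 0 < INR n) by (apply lt_0_INR, Hn).
  replace (exp x) with (exp (x / INR n) ^ n).
  - apply pow_incr. split; [exact Hx | apply exp_ineq1_le].
  - rewrite <- Rpower_pow by apply exp_pos. unfold Rpower. rewrite ln_exp. f_equal. field. lra.
Qed.

(** Reduces each bound on a logarithm to a rational inequality; the exponent 64 is accurate enough
    for all of them. Lower bounds on [ln] apply it to [- x]. *)
Lemma exp_ge_64 (x q : R) : 0 <= 1 + x / 64 -> q <= (1 + x / 64) ^ 64 -> q <= exp x.
Proof.
  intros H1 H2. eapply Rle_trans; [exact H2 |].
  assert (E : INR 64 = 64) by (rewrite INR_IZR_INZ; reflexivity).
  assert (H := exp_ge_pow x 64). rewrite E in H. apply H; [lia | exact H1].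
Qed.

Lemma ln_le_of_exp (x y : R) : 0 < y -> y <= exp x -> ln y <= x.
Proof. intros Hy H. rewrite <- (ln_exp x). apply ln_le; assumption. Qed.

Lemma ln_ge_of_exp (x y : R) : 0 < y -> / y <= exp (- x) -> x <= ln y.
Proof.
  intros Hy H. rewrite exp_Ropp in H.
  rewrite <- (ln_exp x). apply ln_le; [apply exp_pos |].
  rewrite <- (Rinv_inv y), <- (Rinv_inv (exp x)). apply Rinv_le_contravar; [apply Rinv_0_lt_compat, Hy | exact H].
Qed.

Lemma ln2_lower : 0.685 <= ln 2.
Proof. apply ln_ge_of_exp; [lra |]. apply exp_ge_64; lra. Qed.

Lemma ln2_upper : ln 2 <= 0.7.
Proof. apply ln_le_of_exp; [lra |]. apply exp_ge_64; lra. Qed.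

Lemma sqrt2_bounds : 1.414 < sqrt 2 < 1.4143.
Proof. assert (H := sqrt_sqrt 2 ltac:(lra)). assert (P := sqrt_pos 2). nra. Qed.

Lemma ln_1_sqrt2_upper : ln (1 + sqrt 2) <= 0.89.
Proof.
  assert (H := sqrt2_bounds). apply ln_le_of_exp; [lra |].
  apply Rle_trans with 2.4143; [lra |]. apply exp_ge_64; lra.
Qed.

Lemma ln_1_sqrt2_lower : 0.82 <= ln (1 + sqrt 2).
Proof.
  assert (H := sqrt2_bounds). apply ln_ge_of_exp; [lra |].
  apply Rle_trans with (/ 2.414); [apply Rinv_le_contravar; lra |]. apply exp_ge_64; lra.
Qed.

Lemma ln_5_3_upper : ln (5 / 3) <= 0.515.
Proof. apply ln_le_of_exp; [lra |]. apply exp_ge_64; lra. Qed.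

(* The integral of (phi_L t - 1) / t over [0, s]. *)
Definition phi_L_int (s : R) : R := 2 * (sqrt (1 + s) + ln 2 - ln (1 + sqrt (1 + s)) - 1).

Lemma phi_L_int_0 : phi_L_int 0 = 0.
Proof. unfold phi_L_int. rewrite Rplus_0_r, sqrt_1. replace (1 + 1) with 2 by ring. ring. Qed.

Lemma phi_L_int_m1 : phi_L_int (-1) = - (2 * (1 - ln 2)).
Proof. unfold phi_L_int. replace (1 + -1) with 0 by ring. rewrite sqrt_0, Rplus_0_r, ln_1. ring. Qed.

Lemma phi_L_int_1 : phi_L_int 1 = 2 * (sqrt 2 + ln 2 - ln (1 + sqrt 2) - 1).
Proof. unfold phi_L_int. replace (1 + 1) with 2 by ring. reflexivity. Qed.

(** Amounts to [ln (1 + y) - ln (1 + x) < y - x] for the two roots, from [1 + h < exp h]. Avoiding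
    derivatives includes the end [s = -1]. *)
Lemma phi_L_int_increasing (s t : R) : -1 <= s -> s < t -> phi_L_int s < phi_L_int t.
Proof.
  intros Hs Hst. unfold phi_L_int.
  assert (H := sqrt_lt_1_alt (1 + s) (1 + t) ltac:(lra)). assert (P := sqrt_pos (1 + s)).
  set (x := sqrt (1 + s)) in *. set (y := sqrt (1 + t)) in *.
  assert (ln (1 + y) < ln (1 + x) + (y - x)); [| lra].
  rewrite <- (ln_exp (y - x)), <- ln_mult by (lra || apply exp_pos).
  apply ln_increasing; [lra |].
  assert (E := exp_ineq1 (y - x) ltac:(lra)). nra.
Qed.

(** This is [(sqrt (1 + s) - 1) / s], rationalised so as to be regular at 0. *)
Lemma is_derive_phi_L_int (s : R) : -1 < s -> is_derive phi_L_int s (/ (1 + sqrt (1 + s))).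
Proof.
  intros Hs. unfold phi_L_int. assert (P := sqrt_lt_R0 (1 + s) ltac:(lra)).
  auto_derive.
  - repeat split; lra.
  - field. lra.
Qed.

(** Needed at the end [-1], outside the range of the derivative formula. It holds on all of [R]
    since the real [sqrt] is extended by 0. *)
Lemma continuous_phi_L_int (s : R) : continuous phi_L_int s.
Proof.
  unfold phi_L_int.
  assert (Cs : continuous (fun s => sqrt (1 + s)) s).
  { apply (continuous_comp (fun s => 1 + s) sqrt); [| apply continuous_sqrt].
    apply (continuous_plus (fun _ => 1) (fun s => s)); [apply continuous_const | apply continuous_id]. }
  assert (P := sqrt_pos (1 + s)).
  assert (Cl : continuous (fun s => ln (1 + sqrt (1 + s))) s).
  { apply (continuous_comp (fun s => sqrt (1 + s)) (fun x => ln (1 + x))); [exact Cs |].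
    apply (ex_derive_continuous (fun x => ln (1 + x))). auto_derive. lra. }
  apply (continuous_mult (fun _ => 2)); [apply continuous_const |].
  apply (continuous_minus (fun s => sqrt (1 + s) + ln 2 - ln (1 + sqrt (1 + s))) (fun _ => 1));
    [| apply continuous_const].
  apply (continuous_minus (fun s => sqrt (1 + s) + ln 2) (fun s => ln (1 + sqrt (1 + s)))); [| exact Cl].
  apply (continuous_plus (fun s => sqrt (1 + s)) (fun _ => ln 2)); [exact Cs | apply continuous_const].
Qed.

(** Mean value inequality for curves: with [v] the increment of [phi], the scalar theorem is applied
    to [Re (conj v * phi) - |v| psi]. The velocity bound is asked only in the open interval, as the
    equations below are divided by [t]. *)
Lemma growth_bound (phi dphi : R -> C) (psi dpsi : R -> R) (a b : R) : a < b ->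
  (forall t, a <= t <= b -> is_curve_derive phi t (dphi t)) ->
  (forall t, a <= t <= b -> is_derive psi t (dpsi t)) ->
  (forall t, a < t < b -> Cmod (dphi t) <= dpsi t) ->
  Cmod (phi b - phi a) <= psi b - psi a.
Proof.
  intros Hab Hphi Hpsi H.
  set (v := (phi b - phi a)%C).
  destruct (MVT_cor2 (fun t => Re (Cconj v * phi t)%C - Cmod v * psi t)
    (fun t => Re (Cconj v * dphi t)%C - Cmod v * dpsi t) a b Hab) as (c & E & Hc).
  { intros t Ht. apply is_derive_Reals.
    apply (is_derive_minus (fun t => Re (Cconj v * phi t)%C) (fun t => Cmod v * psi t)).
    - apply is_curve_derive_Re. apply (is_cderive_is_curve_derive (fun z => Cconj v * z)%C phi); [| apply Hphi, Ht].
      apply is_cderive_eq with (Cconj v * RtoC 1)%C; [apply is_cderive_scal, is_cderive_id | ring].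
    - apply (is_derive_scal psi t (Cmod v)). apply Hpsi, Ht. }
  assert (Hd := H c ltac:(lra)).
  assert (X := Re_le_Cmod (Cconj v * dphi c)). rewrite Cmod_mult, Cmod_conj in X.
  assert (P := Cmod_ge_0 v).
  assert (Ev : Re (Cconj v * phi b)%C - Re (Cconj v * phi a)%C = Cmod v * Cmod v).
  { rewrite Cmod_sqr. unfold v, Cconj, Re, Im; simpl. ring. }
  assert (L : Cmod v * Cmod v <= Cmod v * (psi b - psi a)).
  { assert (Y1 : Cmod v * Cmod (dphi c) <= Cmod v * dpsi c) by (apply Rmult_le_compat_l; assumption).
    assert (Y2 : (Re (Cconj v * dphi c)%C - Cmod v * dpsi c) * (b - a) <= 0 * (b - a))
      by (apply Rmult_le_compat_r; lra).
    lra. }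
  (* Cancelling [|v|] in [|v|^2 <= |v| (psi b - psi a)] fails for [v = 0]; then the increment of
     [psi] must be known to be nonnegative. *)
  destruct (MVT_cor2 psi dpsi a b Hab) as (c' & E' & Hc').
  { intros t Ht. apply is_derive_Reals, Hpsi, Ht. }
  assert (Hd' := H c' ltac:(lra)). assert (P' := Cmod_ge_0 (dphi c')).
  assert (0 <= psi b - psi a) by nra. nra.
Qed.

(* The Cassini oval |W ^ 2 - 1| <= t, Re W > 0, lies in the disk whose diameter is its trace on the real axis. *)
Lemma cassini_in_disk (t : R) (W : C) : 0 <= t <= 1 -> 0 <= Re W -> Cmod (W * W - RtoC 1)%C <= t ->
  Cmod (W - RtoC ((sqrt (1 + t) + sqrt (1 - t)) / 2)) <= (sqrt (1 + t) - sqrt (1 - t)) / 2.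
Proof.
  intros Ht HX HW.
  assert (S1 := sqrt_sqrt (1 + t) ltac:(lra)). assert (S2 := sqrt_sqrt (1 - t) ltac:(lra)).
  assert (P1 := sqrt_pos (1 + t)). assert (P2 := sqrt_pos (1 - t)).
  assert (P3 := sqrt_le_1_alt (1 - t) (1 + t) ltac:(lra)).
  set (p := sqrt (1 + t)) in *. set (q := sqrt (1 - t)) in *.
  destruct W as [x y]. unfold Re in HX; simpl in HX.
  set (N := x * x + y * y).
  assert (HN : (N + 1) * (N + 1) - 4 * x * x <= t * t).
  { assert (E := Cmod_sqr ((x, y) * (x, y) - RtoC 1)%C).
    assert (P := Cmod_ge_0 ((x, y) * (x, y) - RtoC 1)%C).
    set (m := Cmod _) in *. unfold Re, Im in E; simpl in E.
    replace ((N + 1) * (N + 1) - 4 * x * x) with (m * m) by (rewrite E; unfold N; ring). nra. }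
  assert (HN1 : (N - 1) * (N - 1) <= t * t).
  { assert (A := Cmod_rev ((x, y) * (x, y)) (RtoC 1)).
    assert (B := Cmod_rev (RtoC 1) ((x, y) * (x, y))).
    rewrite Cmod_minus_sym in B. rewrite Cmod_mult, Cmod_1 in A, B.
    assert (E := Cmod_sqr (x, y)). unfold Re, Im in E; simpl in E. fold N in E. rewrite E in A, B. nra. }
  assert (Hd : (p * q) * (p * q) = 1 - t * t) by nra.
  assert (Hd0 : 0 <= p * q) by nra.
  set (d := p * q) in *.
  assert (Hd1 : d <= 1) by nra.
  assert (HN0 : 0 <= N) by (unfold N; nra).
  (* This is the disk with diameter [[q, p]]: [|W|^2 - x (p + q) + p q <= 0]. *)
  assert (Main : N + d <= x * (p + q)).
  { assert (Hs : (p + q) * (p + q) = 2 + 2 * d) by (unfold d; nra).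
    (* By [HN], the right side minus the left is at least [(1 - d) (1 - d^2 - (N - 1)^2) / 2], which
       is nonnegative by [HN1] since [t^2 = 1 - d^2]. *)
    assert (K : (N + d) * (N + d) <= (x * (p + q)) * (x * (p + q))).
    { replace ((x * (p + q)) * (x * (p + q))) with (x * x * (2 + 2 * d)) by (rewrite <- Hs; ring).
      assert (H1 : (1 - d) * ((N - 1) * (N - 1)) <= (1 - d) * (1 - d * d))
        by (apply Rmult_le_compat_l; lra).
      assert (H2 : ((N + 1) * (N + 1) - 1 + d * d) * (1 + d) <= (4 * x * x) * (1 + d))
        by (apply Rmult_le_compat_r; lra).
      nra. }
    assert (0 <= x * (p + q)) by (apply Rmult_le_pos; lra).
    apply Rsqr_incr_0_var; [exact K | assumption]. }
  assert (Q := Cmod_sqr ((x, y) - RtoC ((p + q) / 2))%C).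
  set (m := Cmod ((x, y) - RtoC ((p + q) / 2))%C) in *.
  assert (Pm : 0 <= m) by apply Cmod_ge_0.
  unfold Re, Im in Q; simpl in Q.
  assert (m * m <= (p - q) / 2 * ((p - q) / 2)) by (unfold N, d in Main; nra).
  apply Rsqr_incr_0_var; [assumption | lra].
Qed.

Lemma phi_L_sqr (z : C) : (phi_L z * phi_L z)%C = (RtoC 1 + z)%C.
Proof. apply Csqrt_sqr. Qed.

(** The disks of [cassini_in_disk] have a centre that moves with [t]. Along the ray through [z], the
    velocity of [H] minus the integrated centre is bounded by the derivative of the integrated
    radius, so [growth_bound] gives the disk. *)
Lemma H_in_disk (w H dH : C -> C) (z : C) :
  (forall u, unit_disk u -> Cmod (w u) <= Cmod u) ->
  H (RtoC 0) = RtoC 0 -> (forall u, unit_disk u -> is_cderive H u (dH u)) ->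
  (forall u, unit_disk u -> (u * dH u)%C = (phi_L (w u) - RtoC 1)%C) ->
  unit_disk z ->
  Cmod (H z - RtoC ((phi_L_int (Cmod z) + phi_L_int (- Cmod z)) / 2)) <= (phi_L_int (Cmod z) - phi_L_int (- Cmod z)) / 2.
Proof.
  intros Hw H0 HD HE Hz.
  destruct (Ceq_dec z (RtoC 0)) as [-> | Hz0].
  { rewrite Cmod_0, Ropp_0, H0, phi_L_int_0. replace ((0 + 0) / 2) with 0 by field.
    replace (RtoC 0 - RtoC 0)%C with (RtoC 0) by ring. rewrite Cmod_0. lra. }
  unfold unit_disk in Hz. set (rho := Cmod z) in *.
  assert (Hrho : 0 < rho) by (apply Cmod_gt_0, Hz0).
  assert (Nrho : RtoC rho <> RtoC 0) by (intros E; apply RtoC_inj in E; lra).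
  set (e := (z / RtoC rho)%C).
  assert (He : Cmod e = 1).
  { unfold e. rewrite Cmod_div by exact Nrho. rewrite (Cmod_RtoC_pos rho) by lra. fold rho. field. lra. }
  assert (Hdisk : forall t, 0 <= t <= rho -> Cmod (RtoC 0 + RtoC t * e) = t).
  { intros t Ht. rewrite Cplus_0_l, Cmod_mult, He, Cmod_RtoC_pos by lra. ring. }
  set (phi := fun t => (H (RtoC 0 + RtoC t * e) - RtoC ((phi_L_int t + phi_L_int (- t)) / 2))%C).
  set (dphi := fun t => (dH (RtoC 0 + RtoC t * e) * e
    - RtoC ((/ (1 + sqrt (1 + t)) - / (1 + sqrt (1 - t))) / 2))%C).
  set (psi := fun t => (phi_L_int t - phi_L_int (- t)) / 2).
  set (dpsi := fun t => (/ (1 + sqrt (1 + t)) + / (1 + sqrt (1 - t))) / 2).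
  assert (DHm : forall t, 0 <= t <= rho -> is_derive (fun t => phi_L_int (- t)) t (- / (1 + sqrt (1 - t)))).
  { intros t Ht. replace (- / (1 + sqrt (1 - t))) with (-1 * / (1 + sqrt (1 + - t))) by (unfold Rminus; ring).
    apply (is_derive_comp phi_L_int (fun t => - t)); [apply is_derive_phi_L_int; lra |].
    auto_derive; [exact I | ring]. }
  assert (B : Cmod (phi rho - phi 0) <= psi rho - psi 0).
  { apply (growth_bound phi dphi psi dpsi); [exact Hrho | | |].
    - intros t Ht. unfold phi, dphi.
      assert (Dt : unit_disk (RtoC 0 + RtoC t * e)%C) by (unfold unit_disk; rewrite Hdisk; lra).
      assert (R1 := is_cderive_is_curve_derive H (fun t => RtoC 0 + RtoC t * e)%C t _ e (HD _ Dt) (is_curve_derive_line (RtoC 0) e t)).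
      assert (R2 : is_curve_derive (fun t => RtoC ((phi_L_int t + phi_L_int (- t)) / 2)) t
        (RtoC ((/ (1 + sqrt (1 + t)) - / (1 + sqrt (1 - t))) / 2))).
      { apply (is_curve_derive_pair (fun t => (phi_L_int t + phi_L_int (- t)) / 2) (fun _ => 0)).
        - apply (is_derive_ext (fun t => / 2 * (phi_L_int t + phi_L_int (- t))));
            [intros s; change (/ 2 * (phi_L_int s + phi_L_int (- s)) = (phi_L_int s + phi_L_int (- s)) / 2); field |].
          replace ((/ (1 + sqrt (1 + t)) - / (1 + sqrt (1 - t))) / 2)
            with (/ 2 * (/ (1 + sqrt (1 + t)) + - / (1 + sqrt (1 - t)))) by (unfold Rdiv; ring).
          apply is_derive_scal. apply (is_derive_plus phi_L_int (fun t => phi_L_int (- t)));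
            [apply is_derive_phi_L_int; lra | apply DHm, Ht].
        - apply (is_derive_const (K := R_AbsRing) (V := R_NormedModule) 0 t). }
      apply is_curve_derive_minus; assumption.
    - intros t Ht. unfold psi, dpsi.
      apply (is_derive_ext (fun t => / 2 * (phi_L_int t - phi_L_int (- t))));
        [intros s; change (/ 2 * (phi_L_int s - phi_L_int (- s)) = (phi_L_int s - phi_L_int (- s)) / 2); field |].
      replace ((/ (1 + sqrt (1 + t)) + / (1 + sqrt (1 - t))) / 2)
        with (/ 2 * (/ (1 + sqrt (1 + t)) - - / (1 + sqrt (1 - t)))) by (unfold Rdiv; ring).
      apply is_derive_scal. apply (is_derive_minus phi_L_int (fun t => phi_L_int (- t)));
        [apply is_derive_phi_L_int; lra | apply DHm, Ht].
    - intros t Ht. unfold dphi, dpsi.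
      set (u := (RtoC 0 + RtoC t * e)%C).
      assert (Cu : Cmod u = t) by (apply Hdisk; lra).
      assert (Du : unit_disk u) by (unfold unit_disk; lra).
      assert (Wu := Hw u Du). rewrite Cu in Wu.
      assert (S1 := sqrt_sqrt (1 + t) ltac:(lra)). assert (S2 := sqrt_sqrt (1 - t) ltac:(lra)).
      assert (P1 := sqrt_pos (1 + t)). assert (P2 := sqrt_pos (1 - t)).
      assert (Q := cassini_in_disk t (phi_L (w u)) ltac:(lra) (Csqrt_Re_nonneg _)).
      rewrite phi_L_sqr in Q. replace (RtoC 1 + w u - RtoC 1)%C with (w u) in Q by ring. specialize (Q Wu).
      (* Back to the quotient form, so that multiplication by [t] turns the claim into the disk
         estimate for [phi_L (w u)]. *)
      assert (E1 : / (1 + sqrt (1 + t)) = (sqrt (1 + t) - 1) / t).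
      { apply Rmult_eq_reg_l with ((1 + sqrt (1 + t)) * t); [| apply Rgt_not_eq; apply Rmult_lt_0_compat; lra].
        transitivity t; [field; lra |]. transitivity (sqrt (1 + t) * sqrt (1 + t) - 1); [lra | field; lra]. }
      assert (E2 : / (1 + sqrt (1 - t)) = (1 - sqrt (1 - t)) / t).
      { apply Rmult_eq_reg_l with ((1 + sqrt (1 - t)) * t); [| apply Rgt_not_eq; apply Rmult_lt_0_compat; lra].
        transitivity t; [field; lra |]. transitivity (1 - sqrt (1 - t) * sqrt (1 - t)); [lra | field; lra]. }
      rewrite E1, E2. set (p := sqrt (1 + t)) in *. set (q := sqrt (1 - t)) in *.
      apply Rmult_le_reg_l with t; [lra |].
      replace (t * (((p - 1) / t + (1 - q) / t) / 2)) with ((p - q) / 2) by (field; lra).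
      rewrite <- (Cmod_RtoC_pos t) at 1 by lra. rewrite <- Cmod_mult.
      replace (RtoC t * (dH u * e - RtoC (((p - 1) / t - (1 - q) / t) / 2)))%C
        with (phi_L (w u) - RtoC ((p + q) / 2))%C; [exact Q |].
      transitivity (u * dH u - RtoC (t * (((p - 1) / t - (1 - q) / t) / 2)))%C.
      + rewrite (HE u Du). replace (t * (((p - 1) / t - (1 - q) / t) / 2)) with ((p + q) / 2 - 1) by (field; lra).
        rewrite RtoC_minus. ring.
      + rewrite RtoC_mult. unfold u at 1. ring. }
  unfold phi, psi in B. rewrite Ropp_0, phi_L_int_0 in B.
  replace (RtoC 0 + RtoC rho * e)%C with z in B by (unfold e; field; exact Nrho).
  replace (RtoC 0 + RtoC 0 * e)%C with (RtoC 0) in B by ring. rewrite H0 in B.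
  replace ((0 + 0) / 2) with 0 in B by field. replace ((0 - 0) / 2) with 0 in B by field.
  replace (H z - RtoC ((phi_L_int rho + phi_L_int (- rho)) / 2))%C
    with (H z - RtoC ((phi_L_int rho + phi_L_int (- rho)) / 2) - (RtoC 0 - RtoC 0))%C by ring. lra.
Qed.

(** * Subordination to phi_Ne *)


(** The differential equations carry a factor [z] and say nothing about the derivative at 0, which
    is therefore left arbitrary. *)
Lemma local_constant (q : C -> C) (d : R) :
  (forall z, Cmod z < d -> exists l, is_cderive q z l /\ (z <> RtoC 0 -> l = RtoC 0)) ->
  forall z, Cmod z < d -> q z = q (RtoC 0).
Proof.
  intros Hq z Hz.
  destruct (Ceq_dec z (RtoC 0)) as [-> | Hz0]; [reflexivity |].
  assert (Pz := proj1 (Cmod_gt_0 z) Hz0).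
  assert (Dz : forall t, 0 <= t <= 1 -> Cmod (RtoC 0 + RtoC t * z) < d).
  { intros t Ht. rewrite Cplus_0_l, Cmod_mult, Cmod_RtoC_pos by lra. nra. }
  set (dq := fun t => (C_derive q (RtoC 0 + RtoC t * z) * z)%C).
  assert (B : Cmod (q (RtoC 0 + RtoC 1 * z)%C - q (RtoC 0 + RtoC 0 * z)%C) <= 0 - 0).
  { apply (growth_bound (fun t => q (RtoC 0 + RtoC t * z)%C) dq (fun _ => 0) (fun _ => 0)); [lra | | |].
    - intros t Ht. apply (is_cderive_is_curve_derive q (fun t => RtoC 0 + RtoC t * z)%C); [| apply is_curve_derive_line].
      destruct (Hq _ (Dz t Ht)) as [l [Hl _]]. rewrite (is_cderive_C_derive _ _ _ Hl). exact Hl.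
    - intros t _. apply (is_derive_const (K := R_AbsRing) (V := R_NormedModule) 0 t).
    - intros t Ht. unfold dq. destruct (Hq _ (Dz t ltac:(lra))) as [l [Hl El]].
      rewrite (is_cderive_C_derive _ _ _ Hl), El; [rewrite Cmult_0_l, Cmod_0; lra |].
      rewrite Cplus_0_l. apply Cmult_neq_0; [| exact Hz0]. intros E. apply RtoC_inj in E. lra. }
  replace (RtoC 0 + RtoC 1 * z)%C with z in B by ring.
  replace (RtoC 0 + RtoC 0 * z)%C with (RtoC 0) in B by ring.
  apply Ceq_minus, Cmod_zero. lra.
Qed.

(** Fixed point of [T w = zeta + w^3 / 3] on the disk of radius [r = |zeta| + 1 / 3 < 1]: it is
    preserved because [r^3 <= 1], and [T] contracts by [r^2]. *)
Lemma cubic_iteration (zeta : C) : Cmod zeta < 2 / 3 ->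
  exists w, Cmod w < 1 /\ (w - w ^ 3 / RtoC 3 = zeta)%C.
Proof.
  intros Hz. set (rho := Cmod zeta) in *. assert (Prho : 0 <= rho) by apply Cmod_ge_0.
  set (r := rho + 1 / 3).
  assert (N3 : RtoC 3 <> RtoC 0) by (intros E; apply RtoC_inj in E; lra).
  set (T := fun w => (zeta + w ^ 3 / RtoC 3)%C).
  assert (Hr : 1 / 3 <= r < 1) by (unfold r; lra).
  assert (Hr3 : r * r * r <= 1) by (assert (r * r <= 1) by nra; nra).
  assert (C3 : forall w, Cmod (w ^ 3 / RtoC 3)%C = Cmod w * Cmod w * Cmod w / 3).
  { intros w. rewrite Cmod_div by exact N3. rewrite Cmod_pow, (Cmod_RtoC_pos 3) by lra. simpl. field. }
  assert (Tin : forall w, Cmod w <= r -> Cmod (T w) <= r).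
  { intros w Hw. unfold T. eapply Rle_trans; [apply Cmod_triangle |]. rewrite C3. fold rho.
    assert (P := Cmod_ge_0 w).
    assert (Cmod w * Cmod w * Cmod w <= r * r * r) by (repeat apply Rmult_le_compat; nra).
    unfold r at 1. unfold r in *. lra. }
  assert (Tlip : forall v w, Cmod v <= r -> Cmod w <= r -> Cmod (T v - T w) <= r * r * Cmod (v - w)).
  { intros v w Hv Hw. unfold T.
    replace (zeta + v ^ 3 / RtoC 3 - (zeta + w ^ 3 / RtoC 3))%C
      with ((v * v + v * w + w * w) / RtoC 3 * (v - w))%C by (simpl; field; exact N3).
    rewrite Cmod_mult. apply Rmult_le_compat_r; [apply Cmod_ge_0 |].
    rewrite Cmod_div by exact N3. rewrite (Cmod_RtoC_pos 3) by lra.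
    assert (X : Cmod (v * v + v * w + w * w) <= 3 * (r * r)).
    { eapply Rle_trans; [apply Cmod_triangle |].
      eapply Rle_trans; [apply Rplus_le_compat_r, Cmod_triangle |]. rewrite !Cmod_mult.
      assert (P := Cmod_ge_0 v). assert (Q := Cmod_ge_0 w). nra. }
    lra. }
  set (u := fix u n := match n with O => RtoC 0 | S n => T (u n) end).
  assert (Uin : forall n, Cmod (u n) <= r).
  { induction n; simpl; [rewrite Cmod_0; lra | apply Tin, IHn]. }
  assert (Hq : 0 <= r * r < 1) by (split; nra).
  destruct (C_geometric_limit u rho (r * r) Hq) as (l & _ & Hlim).
  { induction n.
    - simpl. unfold T. replace (zeta + RtoC 0 ^ 3 / RtoC 3 - RtoC 0)%C with zeta
        by (simpl; field; exact N3). fold rho. lra.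
    - change (Cmod (T (u (S n)) - T (u n)) <= rho * (r * r) ^ S n).
      eapply Rle_trans; [apply Tlip; apply Uin |].
      apply Rle_trans with (r * r * (rho * (r * r) ^ n)); [apply Rmult_le_compat_l; lra | right; simpl; ring]. }
  assert (Hl : Cmod l <= r).
  { apply le_epsilon. intros eps He. destruct (Hlim eps He) as [n Hn]. specialize (Hn n (Nat.le_refl n)).
    assert (X := Cmod_rev l (u n)). rewrite Cmod_minus_sym in X. specialize (Uin n). lra. }
  exists l. split; [lra |].
  assert (E : (l - T l)%C = RtoC 0).
  { apply Cmod_zero. apply le_epsilon. intros eps He. rewrite Rplus_0_l.
    destruct (Hlim (eps / 2)) as [n Hn]; [lra |].
    assert (H1 := Hn n (Nat.le_refl n)). assert (H2 := Hn (S n) ltac:(lia)).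
    change (u (S n)) with (T (u n)) in H2.
    eapply Rle_trans; [apply (Cmod_tri3 _ (T (u n))) |]. rewrite Cmod_minus_sym.
    assert (H3 := Tlip (u n) l (Uin n) Hl). assert (P := Cmod_ge_0 (u n - l)). nra. }
  apply Ceq_minus in E. unfold T in E. rewrite E at 1. ring.
Qed.

Lemma cubic_difference (v w : C) :
  ((w - w ^ 3 / RtoC 3) - (v - v ^ 3 / RtoC 3)
   = (w - v) * (RtoC 1 - (w * w + w * v + v * v) / RtoC 3))%C.
Proof. simpl. field. Qed.

(** The bound depends on [v] only. With [cubic_difference] it gives injectivity on the disk and a
    local Lipschitz constant for the inverse. *)
Lemma cubic_factor_ge (v w : C) : Cmod v < 1 -> Cmod w < 1 ->
  (1 - Cmod v) / 3 <= Cmod (RtoC 1 - (w * w + w * v + v * v) / RtoC 3)%C.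
Proof.
  intros Hv Hw. assert (N3 : RtoC 3 <> RtoC 0) by (intros E; apply RtoC_inj in E; lra).
  assert (X := Cmod_rev (RtoC 1) ((w * w + w * v + v * v) / RtoC 3)%C).
  rewrite Cmod_1 in X. rewrite Cmod_div in X by exact N3. rewrite (Cmod_RtoC_pos 3) in X by lra.
  assert (Y : Cmod (w * w + w * v + v * v) <= 2 + Cmod v).
  { eapply Rle_trans; [apply Cmod_triangle |].
    eapply Rle_trans; [apply Rplus_le_compat_r, Cmod_triangle |]. rewrite !Cmod_mult.
    assert (P := Cmod_ge_0 v). assert (Q := Cmod_ge_0 w). nra. }
  lra.
Qed.

(** Meaningful for [|zeta| < 2 / 3], where a root exists; it is unique by [cubic_factor_ge], so the
    choice is a true inverse. *)
Definition cubic_inverse (zeta : C) : C :=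
  epsilon (inhabits (RtoC 0)) (fun w => Cmod w < 1 /\ (w - w ^ 3 / RtoC 3 = zeta)%C).

Lemma cubic_inverse_spec (zeta : C) : Cmod zeta < 2 / 3 ->
  Cmod (cubic_inverse zeta) < 1 /\
  (cubic_inverse zeta - cubic_inverse zeta ^ 3 / RtoC 3 = zeta)%C.
Proof. intros H. unfold cubic_inverse. apply epsilon_spec, cubic_iteration, H. Qed.

Lemma cubic_inverse_lipschitz (x y : C) : Cmod x < 2 / 3 -> Cmod y < 2 / 3 ->
  Cmod (cubic_inverse y - cubic_inverse x) * ((1 - Cmod (cubic_inverse x)) / 3) <= Cmod (y - x).
Proof.
  intros Hx Hy. destruct (cubic_inverse_spec x Hx) as [X1 X2]. destruct (cubic_inverse_spec y Hy) as [Y1 Y2].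
  set (v := cubic_inverse x) in *. set (w := cubic_inverse y) in *.
  rewrite <- X2, <- Y2, cubic_difference, Cmod_mult.
  apply Rmult_le_compat_l; [apply Cmod_ge_0 | apply cubic_factor_ge; assumption].
Qed.

Lemma cubic_inverse_0 : cubic_inverse (RtoC 0) = RtoC 0.
Proof.
  assert (H0 : Cmod (RtoC 0) < 2 / 3) by (rewrite Cmod_0; lra).
  destruct (cubic_inverse_spec (RtoC 0) H0) as [H1 H2].
  set (v := cubic_inverse (RtoC 0)) in *.
  assert (E : ((v - RtoC 0) * (RtoC 1 - (v * v + v * RtoC 0 + RtoC 0 * RtoC 0) / RtoC 3))%C = RtoC 0).
  { rewrite <- cubic_difference, H2. simpl. field. }
  assert (B := cubic_factor_ge (RtoC 0) v ltac:(rewrite Cmod_0; lra) H1). rewrite Cmod_0 in B.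
  destruct (Ceq_dec v (RtoC 0)) as [Ev | Ev]; [exact Ev | exfalso].
  revert E. apply Cmult_neq_0; [| apply Cmod_gt_0; lra].
  replace (v - RtoC 0)%C with v by ring. exact Ev.
Qed.

Lemma is_cderive_cubic_inverse (x : C) : Cmod x < 2 / 3 ->
  is_cderive cubic_inverse x (/ (RtoC 1 - cubic_inverse x * cubic_inverse x))%C.
Proof.
  intros Hx. destruct (cubic_inverse_spec x Hx) as [X1 X2].
  set (v := cubic_inverse x) in *.
  assert (N3 : RtoC 3 <> RtoC 0) by (intros E; apply RtoC_inj in E; lra).
  assert (Nv : (RtoC 1 - v * v)%C <> RtoC 0).
  { apply Cmod_lt_neq. rewrite Cmod_mult, Cmod_1. assert (P := Cmod_ge_0 v). nra. }
  set (l := (/ (RtoC 1 - v * v))%C).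
  set (m := (1 - Cmod v) / 3). assert (Hm : 0 < m) by (unfold m; lra).
  assert (Hm' : 0 < / m) by (apply Rinv_0_lt_compat, Hm).
  assert (Pl := Cmod_ge_0 l).
  apply is_cderive_quadratic with (/ m * / m * Cmod l) (2 / 3 - Cmod x); [lra | repeat apply Rmult_le_pos; lra |].
  intros y Hy. assert (Hy' : Cmod y < 2 / 3) by (assert (X := Cmod_rev y x); lra).
  destruct (cubic_inverse_spec y Hy') as [Y1 Y2].
  assert (L := cubic_inverse_lipschitz x y Hx Hy'). fold v in L. fold m in L.
  set (w := cubic_inverse y) in *.
  assert (L' : Cmod (w - v) <= / m * Cmod (y - x)).
  { apply Rmult_le_reg_r with m; [exact Hm |].
    replace (/ m * Cmod (y - x) * m) with (Cmod (y - x)) by (field; lra). exact L. }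
  (* Comes from [(1 - v^2) - (1 - (w^2 + w v + v^2) / 3) = (w - v) (w + 2 v) / 3]. *)
  assert (E : (w - v - l * (y - x) = (w - v) * (w - v) * (l * ((w + RtoC 2 * v) / RtoC 3)))%C).
  { rewrite <- X2, <- Y2, cubic_difference. unfold l. field. auto. }
  fold v. rewrite E, !Cmod_mult.
  assert (B : Cmod ((w + RtoC 2 * v) / RtoC 3)%C <= 1).
  { rewrite Cmod_div by exact N3. rewrite (Cmod_RtoC_pos 3) by lra.
    assert (T := Cmod_triangle w (RtoC 2 * v)%C). rewrite Cmod_mult, (Cmod_RtoC_pos 2) in T by lra. lra. }
  assert (P1 := Cmod_ge_0 (w - v)). assert (P2 := Cmod_ge_0 (y - x)).
  assert (P3 := Cmod_ge_0 ((w + RtoC 2 * v) / RtoC 3)%C).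
  replace (/ m * / m * Cmod l * (Cmod (y - x) * Cmod (y - x)))
    with ((/ m * Cmod (y - x)) * (/ m * Cmod (y - x)) * (Cmod l * 1)) by ring.
  apply Rmult_le_compat; [nra | nra | | apply Rmult_le_compat_l; lra].
  apply Rmult_le_compat; lra.
Qed.

Lemma hol_phi_Ne : hol phi_Ne.
Proof.
  apply is_cderive_hol. intros z _. eexists. apply is_cderive_minus.
  - apply is_cderive_plus; [apply is_cderive_const | apply is_cderive_id].
  - apply (is_cderive_mult (fun z => z ^ 3)%C (fun _ => / RtoC 3)%C); [| apply is_cderive_const].
    apply is_cderive_ext with (fun z => z * (z * z))%C; [intros; simpl; ring |].
    apply (is_cderive_mult (fun z => z) (fun z => z * z)%C); [apply is_cderive_id |].
    apply (is_cderive_mult (fun z => z) (fun z => z)); apply is_cderive_id.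
Qed.

Lemma subordinate_phi_Ne (P : C -> C) : hol P -> P (RtoC 0) = RtoC 1 ->
  (forall z, unit_disk z -> Cmod (P z - RtoC 1) < 2 / 3) -> subordinate P phi_Ne.
Proof.
  intros HP P0 HB. split; [apply analytic_hol, HP |]. split; [apply analytic_hol, hol_phi_Ne |].
  exists (fun z => cubic_inverse (P z - RtoC 1)%C). split; [| split; [| split]].
  - apply analytic_hol, is_cderive_hol. intros z Hz. eexists.
    apply (is_cderive_comp cubic_inverse (fun z => P z - RtoC 1)%C); [apply is_cderive_cubic_inverse, HB, Hz |].
    apply is_cderive_minus; [apply HP, Hz | apply is_cderive_const].
  - rewrite P0. replace (RtoC 1 - RtoC 1)%C with (RtoC 0) by ring. apply cubic_inverse_0.
  - intros z Hz. apply cubic_inverse_spec, HB, Hz.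
  - intros z Hz. destruct (cubic_inverse_spec _ (HB z Hz)) as [_ E]. unfold phi_Ne.
    transitivity (RtoC 1 + (P z - RtoC 1))%C; [ring |]. rewrite <- E at 1. ring.
Qed.

(** * The function [z f' / f]: extension from 0 and differential equation *)

Lemma hol_ext (f g : C -> C) : (forall z, unit_disk z -> f z = g z) -> hol f -> hol g.
Proof.
  intros H Hf. apply is_cderive_hol. intros z Hz. unfold unit_disk in *. exists (C_derive f z).
  apply is_cderive_locally_ext with f (1 - Cmod z); [lra | | apply Hf, Hz].
  intros y Hy. apply H. assert (X := Cmod_rev y z). unfold unit_disk. lra.
Qed.

Lemma subordinate_ext (F G g : C -> C) :
  (forall z, unit_disk z -> F z = G z) -> subordinate F g -> subordinate G g.
Proof.
  intros H (HF & Hg & w & Hw & w0 & wb & E). split; [| split; [exact Hg |]].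
  - apply analytic_hol. apply hol_ext with F; [exact H | apply analytic_hol, HF].
  - exists w. repeat (split; [assumption |]). intros z Hz. rewrite <- H by exact Hz. apply E, Hz.
Qed.

Lemma unit_disk_0 : unit_disk (RtoC 0).
Proof. unfold unit_disk. rewrite Cmod_0. lra. Qed.

(** With [K' = (P - 1) / z], the function [z exp K] has [P] as its [z f' / f]; this produces
    functions with prescribed [zdlog]. *)
Lemma is_cderive_zexp (P K : C -> C) (z : C) :
  P (RtoC 0) = RtoC 1 ->
  is_cderive K z (divz (fun z => P z - RtoC 1)%C z) -> is_cderive (fun z => z * Cexp (K z))%C z (P z * Cexp (K z))%C.
Proof.
  intros P0 HK.
  apply is_cderive_eq with (RtoC 1 * Cexp (K z) + z * (Cexp (K z) * divz (fun z => P z - RtoC 1)%C z))%C.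
  - apply (is_cderive_mult (fun z => z) (fun z => Cexp (K z))); [apply is_cderive_id |].
    apply (is_cderive_comp Cexp K); [apply is_cderive_Cexp | exact HK].
  - transitivity (RtoC 1 * Cexp (K z) + Cexp (K z) * (z * divz (fun z => P z - RtoC 1)%C z))%C; [ring |].
    rewrite divz_mult by (rewrite P0; ring). ring.
Qed.

Lemma hol_minus_const (P : C -> C) (c : C) : hol P -> hol (fun z => P z - c)%C.
Proof. intros HP. apply is_cderive_hol. intros z Hz. eexists. apply is_cderive_minus; [apply HP, Hz | apply is_cderive_const]. Qed.

Lemma hol_id : hol (fun z => z).
Proof. apply is_cderive_hol. intros z _. eexists. apply is_cderive_id. Qed.

Lemma class_A_hol (f : C -> C) : class_A f -> hol f.
Proof. intros [H _]. apply analytic_hol, H. Qed.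

(* The identity theorem extends z f' = P f from a neighbourhood of 0 to the disk; hence f = z exp K. *)
Lemma zdlog_extends (f P : C -> C) (d : R) :
  class_A f -> hol P -> P (RtoC 0) = RtoC 1 -> 0 < d ->
  (forall z, Cmod z < d -> regular_point f z /\ zdlog f z = P z) ->
  forall z, unit_disk z -> zdlog f z = P z.
Proof.
  intros Hf HP P0 Hd Hnear. assert (Hh := class_A_hol f Hf). destruct Hf as (_ & f0 & f1).
  set (D := fun z => (z * C_derive f z - P z * f z)%C).
  assert (HD : hol D).
  { apply is_cderive_hol. intros z Hz. eexists. apply is_cderive_minus.
    - apply (is_cderive_mult (fun z => z) (C_derive f)); [apply is_cderive_id | apply hol_derive; assumption].
    - apply (is_cderive_mult P f); [apply HP | apply Hh]; exact Hz. }
  assert (D0 : zero_near_0 D).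
  { exists d. split; [exact Hd |]. intros z Hz. unfold D.
    destruct (Ceq_dec z (RtoC 0)) as [-> | Hz0]; [rewrite f0; ring |].
    destruct (Hnear z Hz) as [[R1 R2] E]. rewrite <- E. unfold zdlog.
    destruct (Ceq_dec z (RtoC 0)); [contradiction |]. field. apply R1, Hz0. }
  assert (Eq : forall z, unit_disk z -> (z * C_derive f z = P z * f z)%C).
  { intros z Hz. apply Ceq_minus. apply (identity_theorem D z HD D0 Hz). }
  set (P1 := fun z => (P z - RtoC 1)%C).
  assert (P10 : P1 (RtoC 0) = RtoC 0) by (unfold P1; rewrite P0; ring).
  assert (HP1 : hol (divz P1)) by (apply hol_divz; [apply hol_minus_const, HP | exact P10]).
  destruct (hol_primitive (divz P1) HP1) as (K & K0 & HK).
  assert (Hg := hol_divz f Hh f0).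
  (* Constancy of [(f / z) exp (- K)] is the identity [f = z exp K]. *)
  set (q := fun z => (divz f z * / Cexp (K z))%C).
  assert (Hq : forall z, Cmod z < 1 -> exists l, is_cderive q z l /\ (z <> RtoC 0 -> l = RtoC 0)).
  { intros z Hz. eexists. split.
    - apply (is_cderive_mult (divz f) (fun z => / Cexp (K z))%C); [apply Hg, Hz |].
      apply (is_cderive_inv (fun z => Cexp (K z))); [| apply Cexp_nz].
      apply (is_cderive_comp Cexp K); [apply is_cderive_Cexp | apply HK, Hz].
    - intros Hz0. assert (Nz := Cexp_nz (K z)).
      assert (E1 : (divz f z + z * C_derive (divz f) z)%C = C_derive f z).
      { symmetry. apply is_cderive_C_derive. apply is_cderive_ext with (fun z => z * divz f z)%C;
          [intros y; apply divz_mult, f0 |].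
        apply is_cderive_eq with (RtoC 1 * divz f z + z * C_derive (divz f) z)%C; [| ring].
        apply (is_cderive_mult (fun z => z) (divz f)); [apply is_cderive_id | apply Hg, Hz]. }
      assert (E2 := Eq z Hz). rewrite <- E1, <- (divz_mult f z f0) in E2.
      assert (E3 := divz_mult P1 z P10). unfold P1 at 2 in E3.
      (* The equation [z f' = P f], rewritten for [f / z], contains this expression multiplied by
         [z^2]. *)
      assert (E4 : (C_derive (divz f) z - divz f z * divz P1 z)%C = RtoC 0).
      { apply Cmod_zero. apply Rmult_le_reg_l with (Cmod (z * z)%C).
        - apply Cmod_gt_0, Cmult_neq_0; assumption.
        - rewrite <- Cmod_mult.
          replace (z * z * (C_derive (divz f) z - divz f z * divz P1 z))%C
            with (z * (divz f z + z * C_derive (divz f) z) - (RtoC 1 + z * divz P1 z) * (z * divz f z))%C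
            by ring.
          rewrite E2, E3, Rmult_0_r.
          replace (P z * (z * divz f z) - (RtoC 1 + (P z - RtoC 1)) * (z * divz f z))%C
            with (RtoC 0) by ring. rewrite Cmod_0. lra. }
      transitivity ((C_derive (divz f) z - divz f z * divz P1 z) * / Cexp (K z))%C; [field; exact Nz |].
      rewrite E4. ring. }
  intros z Hz.
  assert (Eqz := local_constant q 1 Hq z Hz). unfold q in Eqz. rewrite K0, Cexp_0 in Eqz.
  (* A zero of [f / z] would force the constant [q] to vanish, while its value at 0 is 1. *)
  assert (Nf : divz f z <> RtoC 0).
  { intros E. rewrite E in Eqz. unfold divz in Eqz.
    destruct (Ceq_dec (RtoC 0) (RtoC 0)) as [_ | X]; [| exact (X eq_refl)].
    rewrite f1 in Eqz. apply C1_nz.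
    transitivity (RtoC 1 * / RtoC 1)%C; [field; apply C1_nz |]. rewrite <- Eqz. ring. }
  unfold zdlog. destruct (Ceq_dec z (RtoC 0)) as [-> | Hz0]; [symmetry; exact P0 |].
  rewrite (Eq z Hz). field. rewrite <- (divz_mult f z f0). apply Cmult_neq_0; assumption.
Qed.

(** Near 0, [zdlog f] equals [f' / (f / z)], a quotient of functions with value 1 at 0; this also
    covers the filled value. *)
Lemma zdlog_near_0 (f : C -> C) : class_A f -> exists d, 0 < d <= 1 /\
  forall z, Cmod z < d -> regular_point f z /\ zdlog f z <> RtoC 0 /\ exists l, is_cderive (zdlog f) z l.
Proof.
  intros Hf. assert (Hh := class_A_hol f Hf). destruct Hf as (_ & f0 & f1).
  assert (Hg := hol_divz f Hh f0).
  assert (g0 : divz f (RtoC 0) = RtoC 1).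
  { unfold divz. destruct (Ceq_dec (RtoC 0) (RtoC 0)) as [_ | X]; [exact f1 | destruct (X eq_refl)]. }
  destruct (Ccontinuous_nz (divz f) (RtoC 0)) as [d1 [Hd1 H1]];
    [apply hol_Ccontinuous; [exact Hg | apply unit_disk_0] | rewrite g0; apply C1_nz |].
  destruct (Ccontinuous_nz (C_derive f) (RtoC 0)) as [d2 [Hd2 H2]];
    [apply hol_Ccontinuous; [apply hol_derive, Hh | apply unit_disk_0] | rewrite f1; apply C1_nz |].
  set (d := Rmin 1 (Rmin d1 d2)).
  assert (Hd : 0 < d) by (repeat apply Rmin_pos; lra).
  assert (HH : forall z, Cmod z < d -> unit_disk z /\ divz f z <> RtoC 0 /\ C_derive f z <> RtoC 0).
  { intros z Hz. assert (Ez : (z - RtoC 0)%C = z) by ring.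
    split; [eapply Rlt_le_trans; [exact Hz | apply Rmin_l] |].
    assert (Hz' := Rlt_le_trans _ _ _ Hz (Rmin_r _ _)).
    split; [apply H1 | apply H2]; rewrite Ez;
      (eapply Rlt_le_trans; [exact Hz' | apply Rmin_l || apply Rmin_r]). }
  assert (Ep : forall z, Cmod z < d -> zdlog f z = (C_derive f z / divz f z)%C).
  { intros z Hz. destruct (HH z Hz) as (_ & N1 & N2). unfold zdlog.
    destruct (Ceq_dec z (RtoC 0)) as [-> | Hz0].
    - rewrite f1, g0. field.
    - replace (f z) with (z * divz f z)%C by apply (divz_mult f z f0). field. split; assumption. }
  exists d. split; [split; [exact Hd | apply Rmin_l] |]. intros z Hz.
  destruct (HH z Hz) as (Dz & N1 & N2). split; [| split].
  - split; [| exact N2]. intros Hz0. rewrite <- (divz_mult f z f0). apply Cmult_neq_0; assumption.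
  - rewrite (Ep z Hz). unfold Cdiv. apply Cmult_neq_0; [exact N2 |].
    intros E. apply C1_nz. rewrite <- (Cinv_r (divz f z) N1), E. ring.
  - eexists. apply is_cderive_locally_ext with (fun z => C_derive f z / divz f z)%C (d - Cmod z); [lra | |].
    + intros y Hy. symmetry. apply Ep. assert (X := Cmod_rev y z). lra.
    + apply is_cderive_div; [apply hol_derive; assumption | apply Hg, Dz | exact N1].
Qed.

Lemma calG_zdlog (f : C -> C) (z l : C) : hol f -> unit_disk z -> z <> RtoC 0 -> regular_point f z ->
  is_cderive (zdlog f) z l -> (z * l = calG f z * zdlog f z)%C.
Proof.
  intros Hf Hz Hz0 [R1 R2] Hl. specialize (R1 Hz0).
  assert (E : is_cderive (zdlog f) z
    (((RtoC 1 * C_derive f z + z * C_derive (C_derive f) z) * f z - z * C_derive f z * C_derive f z)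
      / (f z * f z))%C).
  { apply is_cderive_locally_ext with (fun z => z * C_derive f z / f z)%C (Cmod z).
    - apply Cmod_gt_0, Hz0.
    - intros y Hy. unfold zdlog. destruct (Ceq_dec y (RtoC 0)) as [-> | Hy0]; [exfalso | reflexivity].
      rewrite Cmod_minus_sym in Hy. replace (z - RtoC 0)%C with z in Hy by ring. lra.
    - apply (is_cderive_div (fun z => z * C_derive f z)%C f); [| apply Hf, Hz | exact R1].
      apply (is_cderive_mult (fun z => z) (C_derive f)); [apply is_cderive_id | apply hol_derive; assumption]. }
  rewrite (is_cderive_unique _ _ _ _ Hl E). unfold calG, zdlog.
  destruct (Ceq_dec z (RtoC 0)); [contradiction |]. field. auto.
Qed.

(** * Sufficiency *)


(* the open disk with diameter [-a, b] *)
Definition diam_disk (a b : R) (u : C) : Prop := Im u * Im u < (Re u + a) * (b - Re u).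

Lemma diam_disk_mono (a b a' b' : R) (u : C) :
  0 <= a <= a' -> 0 <= b <= b' -> diam_disk a b u -> diam_disk a' b' u.
Proof.
  unfold diam_disk. intros Ha Hb H.
  assert (P : 0 <= Im u * Im u) by nra.
  assert (0 < Re u + a) by nra. assert (0 < b - Re u) by nra. nra.
Qed.

Lemma diam_disk_of_Cmod (a b : R) (u : C) :
  Cmod (u - RtoC ((b - a) / 2)) < (a + b) / 2 -> diam_disk a b u.
Proof.
  intros H. assert (E := Cmod_sqr (u - RtoC ((b - a) / 2))).
  assert (P := Cmod_ge_0 (u - RtoC ((b - a) / 2))).
  set (m := Cmod _) in *. unfold diam_disk.
  assert (m * m < (a + b) / 2 * ((a + b) / 2)) by nra.
  unfold Cminus in E. rewrite re_plus, im_plus, re_opp, im_opp, re_RtoC, im_RtoC in E. nra.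
Qed.

(** The diameters grow with [|z|]; strict monotonicity of [phi_L_int] up to the ends [-1] and 1
    gives the open limiting disk. *)
Lemma solution_in_disk (H : C -> C) (z : C) (beta : R) : 0 < beta -> unit_disk z ->
  Cmod (H z - RtoC ((phi_L_int (Cmod z) + phi_L_int (- Cmod z)) / 2)) <= (phi_L_int (Cmod z) - phi_L_int (- Cmod z)) / 2 ->
  diam_disk (- phi_L_int (-1) / beta) (phi_L_int 1 / beta) (H z / RtoC beta)%C.
Proof.
  intros Hb Hz HH. unfold unit_disk in Hz. assert (P := Cmod_ge_0 z).
  assert (Nb : RtoC beta <> RtoC 0) by (intros E; apply RtoC_inj in E; lra).
  assert (A1 := phi_L_int_increasing (Cmod z) 1 ltac:(lra) Hz).
  assert (A2 := phi_L_int_increasing (-1) (- Cmod z) ltac:(lra) ltac:(lra)).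
  assert (Hib : 0 < / beta) by (apply Rinv_0_lt_compat, Hb).
  apply diam_disk_of_Cmod.
  replace (H z / RtoC beta - RtoC ((phi_L_int 1 / beta - - phi_L_int (-1) / beta) / 2))%C
    with (RtoC (/ beta) * (H z - RtoC ((phi_L_int 1 + phi_L_int (-1)) / 2)))%C.
  2: { replace ((phi_L_int 1 / beta - - phi_L_int (-1) / beta) / 2) with (/ beta * ((phi_L_int 1 + phi_L_int (-1)) / 2))
         by (field; lra).
       rewrite RtoC_mult, RtoC_inv by lra. field. exact Nb. }
  rewrite Cmod_mult, Cmod_RtoC_pos by lra.
  replace ((- phi_L_int (-1) / beta + phi_L_int 1 / beta) / 2) with (/ beta * ((phi_L_int 1 - phi_L_int (-1)) / 2)) by (field; lra).
  apply Rmult_lt_compat_l; [exact Hib |].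
  eapply Rle_lt_trans; [apply (Cmod_tri3 _ (RtoC ((phi_L_int (Cmod z) + phi_L_int (- Cmod z)) / 2))) |].
  rewrite <- RtoC_minus, Cmod_R.
  set (x := phi_L_int (Cmod z)) in *. set (y := phi_L_int (- Cmod z)) in *.
  unfold Rabs. destruct (Rcase_abs _); lra.
Qed.

Lemma diam_disk_two_thirds (u : C) : diam_disk (2 / 3) (2 / 3) u -> Cmod u < 2 / 3.
Proof.
  unfold diam_disk. intros H. assert (E := Cmod_sqr u). assert (P := Cmod_ge_0 u). nra.
Qed.

(** The conclusion means [|u| < 2 / 3 |1 - u|], an Apollonius disk with diameter [[-2, 2 / 5]]. The
    right end is the critical one; [-8 / 5] on the left is enough. *)
Lemma diam_disk_inv (u : C) : diam_disk (8 / 5) (2 / 5) u ->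
  (RtoC 1 - u)%C <> RtoC 0 /\ Cmod (/ (RtoC 1 - u) - RtoC 1) < 2 / 3.
Proof.
  unfold diam_disk. intros H.
  assert (Hx : Re u < 2 / 5) by nra.
  assert (N : (RtoC 1 - u)%C <> RtoC 0).
  { apply Re_pos_nz. unfold Cminus. rewrite re_plus, re_opp, re_RtoC. lra. }
  split; [exact N |].
  replace (/ (RtoC 1 - u) - RtoC 1)%C with (u / (RtoC 1 - u))%C by (field; exact N).
  rewrite Cmod_div by exact N.
  assert (E1 := Cmod_sqr u). assert (E2 := Cmod_sqr (RtoC 1 - u)%C).
  unfold Cminus in E2 at 3 4 5 6. rewrite re_plus, im_plus, re_opp, im_opp, re_RtoC, im_RtoC in E2.
  assert (P1 := Cmod_ge_0 u). assert (P2 := proj1 (Cmod_gt_0 _) N).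
  apply Rmult_lt_reg_r with (Cmod (RtoC 1 - u)); [exact P2 |].
  unfold Rdiv at 1. rewrite Rmult_assoc, Rinv_l, Rmult_1_r by lra. nra.
Qed.

Lemma exp_4_3 : exp (4 / 3) < 5.
Proof.
  assert (H3 := exp_le_3).
  assert (E : exp 1 = exp (1 / 3) * exp (1 / 3) * exp (1 / 3))
    by (rewrite <- !exp_plus; f_equal; field).
  assert (P := exp_pos (1 / 3)).
  assert (exp (1 / 3) <= 1.5) by nra.
  replace (4 / 3) with (1 + 1 / 3) by field. rewrite exp_plus. nra.
Qed.

(** Left minus right plus 2 is a function [f] with [f 0 = 2] and [f' 0 = 0], the coefficient [4 / 3]
    making the first order terms cancel. With [X = exp s], the sign of [f''] is that of
    [(X - 1) (X - 5)], negative by [exp_4_3]. *)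
Lemma exp_convexity_bound (s : R) : 0 < s <= 4 / 3 ->
  5 / 3 * exp (- s) + 1 / 3 * exp s < 2 - 4 / 3 * s + s * s.
Proof.
  set (f := fun s => 5 / 3 * exp (- s) + 1 / 3 * exp s + 4 / 3 * s - s * s).
  set (f1 := fun s => - (5 / 3) * exp (- s) + 1 / 3 * exp s + 4 / 3 - 2 * s).
  set (f2 := fun s => 5 / 3 * exp (- s) + 1 / 3 * exp s - 2).
  assert (D1 : forall t, derivable_pt_lim f t (f1 t)).
  { intros t. apply is_derive_Reals. unfold f, f1. auto_derive; [exact I | ring]. }
  assert (D2 : forall t, derivable_pt_lim f1 t (f2 t)).
  { intros t. apply is_derive_Reals. unfold f1, f2. auto_derive; [exact I | ring]. }
  assert (F2 : forall t, 0 < t < 4 / 3 -> f2 t < 0).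
  { intros t Ht. unfold f2.
    assert (L1 : 1 < exp t) by (rewrite <- exp_0; apply exp_increasing; lra).
    assert (L2 : exp t < 5) by (eapply Rlt_trans; [apply exp_increasing, Ht | apply exp_4_3]).
    rewrite exp_Ropp. apply Rmult_lt_reg_r with (exp t); [lra |].
    replace ((5 / 3 * / exp t + 1 / 3 * exp t - 2) * exp t)
      with (5 / 3 + 1 / 3 * exp t * exp t - 2 * exp t) by (field; lra). nra. }
  assert (F1 : forall t, 0 < t <= 4 / 3 -> f1 t < 0).
  { intros t Ht. destruct (MVT_cor2 f1 f2 0 t) as (c & E & Hc); [lra | intros; apply D2 |].
    assert (f1 0 = 0) by (unfold f1; rewrite Ropp_0, exp_0; field).
    assert (X := F2 c ltac:(lra)). nra. }
  intros Hs. destruct (MVT_cor2 f f1 0 s) as (c & E & Hc); [lra | intros; apply D1 |].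
  assert (f 0 = 2) by (unfold f; rewrite Ropp_0, exp_0; field).
  assert (X := F1 c ltac:(lra)). assert (f s < 2) by nra. unfold f in *. lra.
Qed.

Lemma cos_ge_quadratic (y : R) : 1 - y * y / 2 <= cos y.
Proof.
  replace y with (2 * (y / 2)) at 3 by field. rewrite cos_2a_sin.
  assert (A : forall t, 0 <= t -> sin t * sin t <= t * t).
  { intros t Ht. destruct Ht as [Ht | <-]; [| rewrite sin_0; lra].
    assert (L := sin_lt_x t Ht). assert (B := SIN_bound t).
    destruct (Rle_lt_dec 0 (sin t)) as [S | S]; [nra |].
    destruct (Rle_lt_dec 1 t) as [T | T]; [nra |].
    assert (Q := sin_gt_0 t Ht). assert (PP := PI2_1). lra. }
  assert (B : sin (y / 2) * sin (y / 2) <= (y / 2) * (y / 2)).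
  { destruct (Rle_lt_dec 0 (y / 2)) as [Y | Y]; [apply A, Y |].
    assert (Z := A (- (y / 2)) ltac:(lra)). rewrite sin_neg in Z. nra. }
  nra.
Qed.

(** Let [E = |exp u|] and [s = ln (5 / 3) - Re u], so [E = 5 / 3 exp (- s)]. The claim is
    [E^2 + 5 / 9 < 2 E cos y]; since [5 / 9 = E exp s / 3] and [cos y >= 1 - y^2 / 2], it suffices
    that [E + exp s / 3 < 2 - y^2]. The disk gives [y^2 < (4 / 3 - s) s], and [exp_convexity_bound]
    concludes. *)
Lemma diam_disk_exp (a : R) (u : C) : 0 <= a -> a + ln (5 / 3) <= 4 / 3 ->
  diam_disk a (ln (5 / 3)) u -> Cmod (Cexp u - RtoC 1) < 2 / 3.
Proof.
  unfold diam_disk. intros Ha Hal H. set (L := ln (5 / 3)) in *.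
  assert (HL : 0 < L) by (unfold L; rewrite <- ln_1; apply ln_increasing; lra).
  set (x := Re u) in *. set (y := Im u) in *.
  assert (Hy : 0 <= y * y) by nra.
  assert (X1 : 0 < x + a) by nra. assert (X2 : 0 < L - x) by nra.
  assert (Q := Cmod_sqr (Cexp u - RtoC 1)%C). assert (P := Cmod_ge_0 (Cexp u - RtoC 1)%C).
  set (m := Cmod (Cexp u - RtoC 1)%C) in *.
  unfold Cminus in Q. rewrite re_plus, im_plus, re_opp, im_opp, re_RtoC, im_RtoC in Q.
  change (Re (Cexp u)) with (exp x * cos y) in Q. change (Im (Cexp u)) with (exp x * sin y) in Q.
  assert (SC := sin2_cos2 y). unfold Rsqr in SC.
  set (E := exp x) in *. assert (PE : 0 < E) by apply exp_pos.
  assert (Q' : m * m = E * E - 2 * E * cos y + 1).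
  { rewrite Q. transitivity (E * E * (sin y * sin y + cos y * cos y) - 2 * E * cos y + 1);
      [ring | rewrite SC; ring]. }
  assert (CQ := cos_ge_quadratic y).
  set (s := L - x) in *.
  assert (Hs : 0 < s <= 4 / 3) by (unfold s in *; lra).
  assert (K := exp_convexity_bound s Hs).
  assert (Es1 : exp (- s) * (5 / 3) = E).
  { unfold s, E. rewrite <- (exp_ln (5 / 3)) by lra. fold L. rewrite <- exp_plus. f_equal. ring. }
  assert (Es2 : exp s * E = 5 / 3).
  { unfold s, E. rewrite <- exp_plus, <- (exp_ln (5 / 3)) by lra. fold L. f_equal. ring. }
  assert (K' : E + 1 / 3 * exp s < 2 - y * y).
  { assert (y * y < (4 / 3 - s) * s).
    { eapply Rlt_le_trans; [exact H |]. apply Rmult_le_compat_r; [lra | unfold s; lra]. }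
    lra. }
  assert (K2 : E * (E + 1 / 3 * exp s) < E * (2 - y * y)) by (apply Rmult_lt_compat_l; lra).
  assert (CE : E * (1 - y * y / 2) <= E * cos y) by (apply Rmult_le_compat_l; lra).
  assert (m * m < 4 / 9) by (rewrite Q'; nra). nra.
Qed.

(** Applied to the hypotheses of (a), (b), (c), and with [F = phi_L] to the extremal functions. *)
Lemma subordinate_phi_L_primitive (F : C -> C) : subordinate F phi_L ->
  exists H dH : C -> C, H (RtoC 0) = RtoC 0 /\
    forall z, unit_disk z ->
      is_cderive H z (dH z) /\ (z * dH z)%C = (F z - RtoC 1)%C /\
      Cmod (H z - RtoC ((phi_L_int (Cmod z) + phi_L_int (- Cmod z)) / 2)) <= (phi_L_int (Cmod z) - phi_L_int (- Cmod z)) / 2.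
Proof.
  intros (HF & _ & w & Hw & w0 & wb & E). apply analytic_hol in Hw, HF.
  set (G := fun z => (F z - RtoC 1)%C).
  assert (G0 : G (RtoC 0) = RtoC 0).
  { unfold G. rewrite E, w0, phi_L_0 by apply unit_disk_0. ring. }
  destruct (hol_primitive (divz G)) as (H & H0 & HH); [apply hol_divz; [apply hol_minus_const, HF | exact G0] |].
  exists H, (divz G). split; [exact H0 |]. intros z Hz. split; [apply HH, Hz |].
  split; [apply (divz_mult G z G0) |].
  apply (H_in_disk w H (divz G)); auto.
  - intros u Hu. apply schwarz; assumption.
  - intros u Hu. rewrite (divz_mult G u G0). unfold G. rewrite E by exact Hu. reflexivity.
Qed.

Lemma Sstar_Ne_of_extension (f P : C -> C) (d : R) :
  class_A f -> hol P -> P (RtoC 0) = RtoC 1 ->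
  (forall z, unit_disk z -> Cmod (P z - RtoC 1) < 2 / 3) -> 0 < d ->
  (forall z, Cmod z < d -> regular_point f z /\ zdlog f z = P z) -> Sstar_Ne f.
Proof.
  intros Hf HP P0 HB Hd Hn. split; [exact Hf |].
  apply subordinate_ext with P; [| apply subordinate_phi_Ne; assumption].
  intros z Hz. symmetry. apply (zdlog_extends f P d); assumption.
Qed.

Lemma zdlog_0 (f : C -> C) : zdlog f (RtoC 0) = RtoC 1.
Proof. unfold zdlog. destruct (Ceq_dec (RtoC 0) (RtoC 0)) as [_ | X]; [reflexivity | destruct (X eq_refl)]. Qed.

Lemma is_cderive_div_const (H : C -> C) (z l : C) (beta : R) :
  is_cderive H z l -> is_cderive (fun z => H z / RtoC beta)%C z (l / RtoC beta)%C.
Proof.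
  intros HH. unfold Cdiv. apply is_cderive_eq with (l * / RtoC beta + H z * RtoC 0)%C; [| ring].
  apply (is_cderive_mult H (fun _ => / RtoC beta)%C); [exact HH | apply is_cderive_const].
Qed.

(** The part common to (a), (b), (c). The solution [u] and its disk live on the whole of the unit
    disk; its link with [f] is asserted only near 0, where all points are regular. *)
Lemma sufficiency_core (f F : C -> C) (beta : R) (E : C -> C) :
  class_A f -> 0 < beta ->
  (forall z, unit_disk z -> regular_point f z -> F z = E z) -> subordinate F phi_L ->
  exists (u du : C -> C) (d : R), 0 < d <= 1 /\ u (RtoC 0) = RtoC 0 /\
    (forall z, unit_disk z -> is_cderive u z (du z) /\ diam_disk (- phi_L_int (-1) / beta) (phi_L_int 1 / beta) (u z)) /\
    (forall z, Cmod z < d -> regular_point f z /\ zdlog f z <> RtoC 0 /\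
       exists l, is_cderive (zdlog f) z l /\
         (z <> RtoC 0 -> (z * l = calG f z * zdlog f z)%C /\ (z * du z * RtoC beta = E z - RtoC 1)%C)).
Proof.
  intros Hf Hb HE HF.
  assert (Nb : RtoC beta <> RtoC 0) by (intros X; apply RtoC_inj in X; lra).
  destruct (subordinate_phi_L_primitive F HF) as (H & dH & H0 & HH).
  destruct (zdlog_near_0 f Hf) as (d & Hd & Hn).
  exists (fun z => H z / RtoC beta)%C, (fun z => dH z / RtoC beta)%C, d.
  split; [exact Hd |]. split; [rewrite H0; field; exact Nb |]. split.
  - intros z Hz. destruct (HH z Hz) as (A1 & A2 & A3). split; [apply is_cderive_div_const, A1 |].
    apply solution_in_disk; assumption.
  - intros z Hz. destruct (Hn z Hz) as (R1 & R2 & l & Hl).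
    assert (Dz : unit_disk z) by (unfold unit_disk; lra).
    split; [exact R1 |]. split; [exact R2 |]. exists l. split; [exact Hl |]. intros Hz0. split.
    + apply calG_zdlog; auto. apply class_A_hol, Hf.
    + destruct (HH z Dz) as (A1 & A2 & A3). rewrite <- (HE z Dz R1), <- A2. field. exact Nb.
Qed.

Lemma Cmult_cancel_l (c x y : C) : c <> RtoC 0 -> (c * x = c * y)%C -> x = y.
Proof.
  intros Hc H. replace x with (/ c * (c * x))%C by (field; exact Hc). rewrite H. field. exact Hc.
Qed.

Lemma phi_L_int_1_pos : 0 < phi_L_int 1.
Proof. rewrite <- phi_L_int_0. apply phi_L_int_increasing; lra. Qed.

Lemma phi_L_int_m1_neg : phi_L_int (-1) < 0.
Proof. rewrite <- phi_L_int_0. apply phi_L_int_increasing; lra. Qed.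

Lemma phi_L_int_m1_value : 0.6 <= - phi_L_int (-1) <= 0.63.
Proof. rewrite phi_L_int_m1. assert (A := ln2_lower). assert (B := ln2_upper). lra. Qed.

Lemma phi_L_int_1_value : 0.418 <= phi_L_int 1.
Proof. rewrite phi_L_int_1. assert (A := ln2_lower). assert (B := sqrt2_bounds). assert (D := ln_1_sqrt2_upper). lra. Qed.

(** Makes the left end of the diameter the decisive one in (a). *)
Lemma phi_L_int_1_le_m1 : phi_L_int 1 <= - phi_L_int (-1).
Proof.
  rewrite phi_L_int_1, phi_L_int_m1. assert (A := ln2_upper). assert (B := sqrt2_bounds). assert (D := ln_1_sqrt2_lower). lra.
Qed.

Lemma diam_disk_weaken (a b beta a' b' : R) (u : C) : 0 < beta -> 0 <= a <= a' * beta -> 0 <= b <= b' * beta ->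
  diam_disk (a / beta) (b / beta) u -> diam_disk a' b' u.
Proof.
  intros Hb Ha Hb' H. assert (Hi : 0 < / beta) by (apply Rinv_0_lt_compat, Hb).
  apply diam_disk_mono with (a / beta) (b / beta); [| | exact H].
  - split; [apply Rdiv_le_0_compat; lra |]. apply Rmult_le_reg_r with beta; [exact Hb |].
    replace (a / beta * beta) with a by (field; lra). lra.
  - split; [apply Rdiv_le_0_compat; lra |]. apply Rmult_le_reg_r with beta; [exact Hb |].
    replace (b / beta * beta) with b by (field; lra). lra.
Qed.

Lemma sufficient_a (f : C -> C) (beta : R) : class_A f -> 3 * (1 - ln 2) <= beta ->
  expr_subordinate f (fun z : C => (RtoC 1 + RtoC beta * calG f z * zdlog f z)%C) phi_L -> Sstar_Ne f.
Proof.
  intros Hf Hb (F & HE & HF). assert (L2 := ln2_upper).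
  assert (Hb0 : 0 < beta) by lra.
  assert (Nb : RtoC beta <> RtoC 0) by (intros X; apply RtoC_inj in X; lra).
  destruct (sufficiency_core f F beta _ Hf Hb0 HE HF) as (u & du & d & Hd & u0 & Hu & Hn).
  apply Sstar_Ne_of_extension with (fun z => RtoC 1 + u z)%C d; [exact Hf | | | | lra |].
  - apply is_cderive_hol. intros z Hz. eexists. apply is_cderive_plus; [apply is_cderive_const | apply (Hu z Hz)].
  - rewrite u0. ring.
  - intros z Hz. replace (RtoC 1 + u z - RtoC 1)%C with (u z) by ring.
    apply diam_disk_two_thirds. destruct (Hu z Hz) as [_ D].
    assert (A := phi_L_int_1_pos). assert (B := phi_L_int_m1_neg). assert (V := phi_L_int_1_le_m1).
    assert (E := phi_L_int_m1). apply diam_disk_weaken with (- phi_L_int (-1)) (phi_L_int 1) beta; try assumption; lra.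
  - intros z Hz. split; [apply (Hn z Hz) |].
    (* Here [beta z p' = E - 1 = beta z u'], so [p - u] is constant near 0. *)
    assert (K : (zdlog f z - u z = zdlog f (RtoC 0) - u (RtoC 0))%C).
    { apply (local_constant (fun z => zdlog f z - u z)%C d); [| exact Hz]. clear z Hz. intros z Hz.
      destruct (Hn z Hz) as (_ & _ & l & Hl & El).
      exists (l - du z)%C. split.
      - apply is_cderive_minus; [exact Hl |]. apply Hu. unfold unit_disk. lra.
      - intros Hz0. destruct (El Hz0) as [E1 E2].
        apply (Cmult_cancel_l (z * RtoC beta)%C); [apply Cmult_neq_0; assumption |].
        transitivity (RtoC beta * (z * l) - z * du z * RtoC beta)%C; [ring |].
        rewrite E1, E2. ring. }
    rewrite zdlog_0, u0 in K.
    transitivity (zdlog f z - u z + u z)%C; [ring |]. rewrite K. ring.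
Qed.

Lemma ln_5_3_pos : 0 < ln (5 / 3).
Proof. rewrite <- ln_1. apply ln_increasing; lra. Qed.

Lemma sufficient_b (f : C -> C) (beta : R) : class_A f ->
  2 * (sqrt 2 + ln 2 - ln (1 + sqrt 2) - 1) / ln (5 / 3) <= beta ->
  expr_subordinate f (fun z : C => (RtoC 1 + RtoC beta * calG f z)%C) phi_L -> Sstar_Ne f.
Proof.
  intros Hf Hb (F & HE & HF). rewrite <- phi_L_int_1 in Hb.
  assert (A := phi_L_int_1_value). assert (B := phi_L_int_m1_value). assert (L := ln_5_3_upper). assert (Lp := ln_5_3_pos).
  assert (Hb1 : phi_L_int 1 <= ln (5 / 3) * beta).
  { replace (phi_L_int 1) with (ln (5 / 3) * (phi_L_int 1 / ln (5 / 3))) by (field; lra).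
    apply Rmult_le_compat_l; lra. }
  assert (Hb0 : 0 < beta) by nra.
  assert (Nb : RtoC beta <> RtoC 0) by (intros X; apply RtoC_inj in X; lra).
  destruct (sufficiency_core f F beta _ Hf Hb0 HE HF) as (u & du & d & Hd & u0 & Hu & Hn).
  apply Sstar_Ne_of_extension with (fun z => Cexp (u z)) d; [exact Hf | | | | lra |].
  - apply is_cderive_hol. intros z Hz. eexists. apply (is_cderive_comp Cexp u); [apply is_cderive_Cexp | apply (Hu z Hz)].
  - rewrite u0. apply Cexp_0.
  - intros z Hz. apply (diam_disk_exp (4 / 3 - ln (5 / 3))); [lra | lra |].
    destruct (Hu z Hz) as [_ D].
    apply diam_disk_weaken with (- phi_L_int (-1)) (phi_L_int 1) beta; try assumption; [| lra].
    split; [lra |].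
    (* The left end is not critical: after replacing [beta] by its least value, it suffices that
       [0.63 * 0.515 <= (4 / 3 - 0.515) * 0.418]. *)
    apply Rmult_le_reg_l with (ln (5 / 3)); [exact Lp |].
    apply Rle_trans with ((4 / 3 - ln (5 / 3)) * phi_L_int 1); [| nra].
    apply Rle_trans with ((4 / 3 - 0.515) * 0.418); [| nra]. nra.
  - intros z Hz. split; [apply (Hn z Hz) |].
    (* The equation is [p' / p = u']; testing [p exp (- u)] avoids a complex logarithm. *)
    assert (K : (zdlog f z * / Cexp (u z) = zdlog f (RtoC 0) * / Cexp (u (RtoC 0)))%C).
    { apply (local_constant (fun z => zdlog f z * / Cexp (u z))%C d); [| exact Hz]. clear z Hz. intros z Hz.
      destruct (Hn z Hz) as (_ & R2 & l & Hl & El). assert (Ne := Cexp_nz (u z)).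
      eexists. split.
      - apply is_cderive_mult; [exact Hl |]. apply (is_cderive_inv (fun z => Cexp (u z))); [| exact Ne].
        apply (is_cderive_comp Cexp u); [apply is_cderive_Cexp | apply Hu; unfold unit_disk; lra].
      - intros Hz0. destruct (El Hz0) as [E1 E2].
        apply (Cmult_cancel_l (z * RtoC beta * Cexp (u z))%C); [repeat apply Cmult_neq_0; assumption |].
        transitivity (RtoC beta * (z * l) - zdlog f z * (z * du z * RtoC beta))%C; [field; exact Ne |].
        rewrite E1, E2. ring. }
    rewrite zdlog_0, u0, Cexp_0 in K. assert (Ne := Cexp_nz (u z)).
    transitivity (zdlog f z * / Cexp (u z) * Cexp (u z))%C; [field; exact Ne |]. rewrite K. field.
Qed.

Lemma sufficient_c (f : C -> C) (beta : R) : class_A f ->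
  5 * (sqrt 2 + ln 2 - ln (1 + sqrt 2) - 1) <= beta ->
  expr_subordinate f (fun z : C => (RtoC 1 + RtoC beta * calG f z * / zdlog f z)%C) phi_L -> Sstar_Ne f.
Proof.
  intros Hf Hb (F & HE & HF).
  assert (E1 := phi_L_int_1). assert (A := phi_L_int_1_value). assert (B := phi_L_int_m1_value).
  assert (Hb0 : 0 < beta) by lra.
  assert (Nb : RtoC beta <> RtoC 0) by (intros X; apply RtoC_inj in X; lra).
  destruct (sufficiency_core f F beta _ Hf Hb0 HE HF) as (u & du & d & Hd & u0 & Hu & Hn).
  assert (D : forall z, unit_disk z ->
    (RtoC 1 - u z)%C <> RtoC 0 /\ Cmod (/ (RtoC 1 - u z) - RtoC 1) < 2 / 3).
  { intros z Hz. apply diam_disk_inv. destruct (Hu z Hz) as [_ D].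
    apply diam_disk_weaken with (- phi_L_int (-1)) (phi_L_int 1) beta; try assumption; lra. }
  apply Sstar_Ne_of_extension with (fun z => / (RtoC 1 - u z))%C d; [exact Hf | | | | lra |].
  - apply is_cderive_hol. intros z Hz. eexists. apply (is_cderive_inv (fun z => RtoC 1 - u z)%C); [| apply D, Hz].
    apply is_cderive_minus; [apply is_cderive_const | apply (Hu z Hz)].
  - rewrite u0. field.
  - intros z Hz. apply D, Hz.
  - intros z Hz. split; [apply (Hn z Hz) |].
    assert (K : (/ zdlog f z + u z = / zdlog f (RtoC 0) + u (RtoC 0))%C).
    { apply (local_constant (fun z => / zdlog f z + u z)%C d); [| exact Hz]. clear z Hz. intros z Hz.
      destruct (Hn z Hz) as (_ & R2 & l & Hl & El).
      eexists. split.
      - apply is_cderive_plus; [apply (is_cderive_inv (zdlog f)); [exact Hl | exact R2] |].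
        apply Hu. unfold unit_disk. lra.
      - intros Hz0. destruct (El Hz0) as [F1 F2].
        apply (Cmult_cancel_l (z * RtoC beta)%C); [repeat apply Cmult_neq_0; assumption |].
        transitivity (z * du z * RtoC beta - RtoC beta * (z * l) / (zdlog f z * zdlog f z))%C; [field; exact R2 |].
        rewrite F1, F2. field. exact R2. }
    rewrite zdlog_0, u0 in K. destruct (Hn z Hz) as (_ & R2 & _).
    assert (Dz : unit_disk z) by (unfold unit_disk; lra).
    destruct (D z Dz) as [N _].
    assert (K' : (/ zdlog f z)%C = (RtoC 1 - u z)%C).
    { transitivity (/ zdlog f z + u z - u z)%C; [ring |]. rewrite K. field. }
    rewrite <- K'. field. exact R2.
Qed.

(** * Sharpness *)


(** Take [f = z exp K] with [K' = (P - 1) / z] and [K 0 = 0]. *)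
Lemma class_A_with_zdlog (P : C -> C) : hol P -> P (RtoC 0) = RtoC 1 ->
  exists f, class_A f /\ forall z, unit_disk z -> zdlog f z = P z.
Proof.
  intros HP P0. set (P1 := fun z => (P z - RtoC 1)%C).
  assert (P10 : P1 (RtoC 0) = RtoC 0) by (unfold P1; rewrite P0; ring).
  destruct (hol_primitive (divz P1)) as (K & K0 & HK); [apply hol_divz; [apply hol_minus_const, HP | exact P10] |].
  assert (Df : forall z, unit_disk z -> is_cderive (fun z => z * Cexp (K z))%C z (P z * Cexp (K z))%C)
    by (intros z Hz; apply is_cderive_zexp; [exact P0 | apply HK, Hz]).
  exists (fun z => z * Cexp (K z))%C. split; [split; [| split] |].
  - apply analytic_hol, is_cderive_hol. intros z Hz. eexists. apply Df, Hz.
  - ring.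
  - rewrite (is_cderive_C_derive _ _ _ (Df _ unit_disk_0)), P0, K0, Cexp_0. ring.
  - intros z Hz. unfold zdlog. destruct (Ceq_dec z (RtoC 0)) as [-> | Hz0]; [symmetry; exact P0 |].
    rewrite (is_cderive_C_derive _ _ _ (Df _ Hz)). field. split; [apply Cexp_nz | exact Hz0].
Qed.

Lemma subordinate_refl (g : C -> C) : hol g -> subordinate g g.
Proof.
  intros Hg. apply analytic_hol in Hg. split; [exact Hg |]. split; [exact Hg |].
  exists (fun z => z). split; [apply analytic_hol, hol_id |]. auto.
Qed.

Lemma phi_L_real (t : R) : -1 <= t -> phi_L (RtoC t) = RtoC (sqrt (1 + t)).
Proof.
  intros Ht. unfold phi_L. rewrite <- RtoC_plus. unfold Csqrt. rewrite Cmod_RtoC_pos, re_RtoC by lra.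
  replace ((1 + t + (1 + t)) / 2) with (1 + t) by field.
  replace ((1 + t - (1 + t)) / 2) with 0 by field. rewrite sqrt_0, Rmult_0_r. reflexivity.
Qed.

Lemma phi_L_primitive_real (H dH : C -> C) (x : R) : H (RtoC 0) = RtoC 0 ->
  (forall z, unit_disk z -> is_cderive H z (dH z) /\ (z * dH z)%C = (phi_L z - RtoC 1)%C) ->
  -1 < x < 1 -> H (RtoC x) = RtoC (phi_L_int x).
Proof.
  intros H0 HH Hx.
  set (phi := fun t => (H (RtoC 0 + RtoC t * RtoC 1) - RtoC (phi_L_int t))%C).
  set (dphi := fun t => (dH (RtoC 0 + RtoC t * RtoC 1) * RtoC 1 - RtoC (/ (1 + sqrt (1 + t))))%C).
  assert (El : forall t, (RtoC 0 + RtoC t * RtoC 1)%C = RtoC t) by (intros; ring).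
  assert (Du : forall t, -1 < t < 1 -> unit_disk (RtoC t)).
  { intros t Ht. unfold unit_disk. rewrite Cmod_R. apply Rabs_def1; lra. }
  (* The two sides of 0 are treated separately, since [z dH = phi_L - 1] does not determine [dH] at
     0. *)
  assert (B : forall a b, -1 < a -> a < b -> b < 1 -> (0 <= a \/ b <= 0) -> Cmod (phi b - phi a) <= 0 - 0).
  { intros a b Ha Hab Hb Hs.
    apply (growth_bound phi dphi (fun _ => 0) (fun _ => 0)); [exact Hab | | |].
    - intros t Ht. apply is_curve_derive_minus.
      + apply (is_cderive_is_curve_derive H (fun t => RtoC 0 + RtoC t * RtoC 1)%C); [| apply is_curve_derive_line].
        apply HH. rewrite El. apply Du. lra.
      + apply (is_curve_derive_pair phi_L_int (fun _ => 0)); [apply is_derive_phi_L_int; lra |].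
        apply (is_derive_const (K := R_AbsRing) (V := R_NormedModule) 0 t).
    - intros t _. apply (is_derive_const (K := R_AbsRing) (V := R_NormedModule) 0 t).
    - intros t Ht. unfold dphi. rewrite El, Cmult_1_r.
      destruct (HH _ (Du t ltac:(lra))) as [_ E]. rewrite phi_L_real in E by lra.
      assert (P := sqrt_pos (1 + t)). assert (S := sqrt_sqrt (1 + t) ltac:(lra)).
      assert (Nt : RtoC t <> RtoC 0) by (intros X; apply RtoC_inj in X; lra).
      replace (dH (RtoC t)) with (RtoC (/ (1 + sqrt (1 + t)))).
      + replace (RtoC (/ (1 + sqrt (1 + t))) - RtoC (/ (1 + sqrt (1 + t))))%C with (RtoC 0) by ring.
        rewrite Cmod_0. lra.
      + apply (Cmult_cancel_l (RtoC t)); [exact Nt |]. rewrite E, <- RtoC_mult, <- RtoC_minus. f_equal.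
        apply Rmult_eq_reg_l with (1 + sqrt (1 + t)); [| lra].
        transitivity t; [field; lra |]. lra. }
  assert (F0 : phi 0 = RtoC 0).
  { unfold phi. rewrite El, H0, phi_L_int_0. ring. }
  assert (Fx : phi x = RtoC 0).
  { destruct (Rtotal_order x 0) as [L | [-> | L]]; [| exact F0 |].
    - assert (Q := B x 0 ltac:(lra) L ltac:(lra) ltac:(right; lra)). rewrite F0 in Q.
      replace (RtoC 0 - phi x)%C with (- phi x)%C in Q by ring. rewrite Cmod_opp in Q.
      apply Cmod_zero. lra.
    - assert (Q := B 0 x ltac:(lra) L ltac:(lra) ltac:(left; lra)). rewrite F0 in Q.
      replace (phi x - RtoC 0)%C with (phi x)%C in Q by ring. apply Cmod_zero. lra. }
  unfold phi in Fx. rewrite El in Fx. apply Ceq_minus, Fx.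
Qed.

(** For [w = a + i b] the imaginary part is [b (3 - 3 a^2 + b^2) / 3], whose second factor is
    positive, so [w] is real. Then [5 - 3 x = (1 - a)^2 (2 + a)] and
    [3 x - 1 = (1 + a)^2 (2 - a)]. *)
Lemma phi_Ne_real_range (w : C) (x : R) : Cmod w < 1 -> phi_Ne w = RtoC x -> 1 / 3 < x < 5 / 3.
Proof.
  intros Hw E. assert (Q := Cmod_sqr w). assert (P := Cmod_ge_0 w).
  set (m := Cmod w) in *. destruct w as [a b]. unfold Re, Im in Q; simpl in Q.
  assert (N3 : RtoC 3 <> RtoC 0) by (intros X; apply RtoC_inj in X; lra).
  assert (E3 : (RtoC 3 * (RtoC 1 + (a, b)) - (a, b) * ((a, b) * (a, b)))%C = RtoC (3 * x)).
  { rewrite RtoC_mult, <- E. unfold phi_Ne. simpl. field. }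
  assert (Er := f_equal Re E3). assert (Ei := f_equal Im E3).
  unfold Re, Im in Er, Ei; simpl in Er, Ei.
  assert (Hab : a * a + b * b < 1) by nra.
  assert (Hb : b * (3 - 3 * (a * a) + b * b) = 0) by lra.
  apply Rmult_integral in Hb. destruct Hb as [-> | Hb]; [| nra].
  assert (Ha : -1 < a < 1) by nra.
  assert (Ex : 3 * x = 3 + 3 * a - a * (a * a)) by lra.
  assert (0 < (1 - a) * (1 - a) * (2 + a)) by (repeat apply Rmult_lt_0_compat; lra).
  assert (0 < (1 + a) * (1 + a) * (2 - a)) by (repeat apply Rmult_lt_0_compat; lra).
  split; nra.
Qed.

Lemma phi_L_int_near (s y d : R) : 0 < d -> Rabs (phi_L_int s - y) > 0 -> exists e, 0 < e < d /\
  forall t, Rabs (t - s) < e -> Rabs (phi_L_int t - phi_L_int s) < Rabs (phi_L_int s - y).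
Proof.
  intros Hd Hy. destruct (proj1 (filterlim_locally _ _) (continuous_phi_L_int s) (mkposreal _ Hy)) as [e He].
  assert (Pe := cond_pos e).
  exists (Rmin (e / 2) (d / 2)). split.
  - split; [apply Rmin_pos; lra |]. eapply Rle_lt_trans; [apply Rmin_r | lra].
  - intros t Ht. apply (He t). change (Rabs (t - s) < e).
    eapply Rlt_trans; [exact Ht |]. eapply Rle_lt_trans; [apply Rmin_l | lra].
Qed.

Lemma phi_L_int_approach_1 (y : R) : y < phi_L_int 1 -> exists x, -1 < x < 1 /\ y < phi_L_int x.
Proof.
  intros Hy. destruct (phi_L_int_near 1 y 1) as (e & He & H); [lra | rewrite Rabs_pos_eq; lra |].
  exists (1 - e / 2). split; [lra |].
  specialize (H (1 - e / 2)). replace (1 - e / 2 - 1) with (- (e / 2)) in H by ring.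
  rewrite Rabs_Ropp, Rabs_pos_eq in H by lra. specialize (H ltac:(lra)).
  rewrite (Rabs_pos_eq (phi_L_int 1 - y)) in H by lra. apply Rabs_def2 in H. lra.
Qed.

Lemma phi_L_int_approach_m1 (y : R) : phi_L_int (-1) < y -> exists x, -1 < x < 1 /\ phi_L_int x < y.
Proof.
  intros Hy. destruct (phi_L_int_near (-1) y 1) as (e & He & H); [lra | rewrite Rabs_left; lra |].
  exists (-1 + e / 2). split; [lra |].
  specialize (H (-1 + e / 2)). replace (-1 + e / 2 - -1) with (e / 2) in H by ring.
  rewrite Rabs_pos_eq in H by lra. specialize (H ltac:(lra)).
  rewrite (Rabs_left (phi_L_int (-1) - y)) in H by lra. apply Rabs_def2 in H. lra.
Qed.

(** The solution for the Schwarz function [w = id]. Its explicit real values approach both ends of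
    the diameter; the disk serves to keep [1 - u] away from 0 in (c). *)
Definition extremal_data (beta : R) (u du : C -> C) : Prop :=
  u (RtoC 0) = RtoC 0 /\
  (forall z, unit_disk z -> is_cderive u z (du z) /\ (RtoC beta * (z * du z))%C = (phi_L z - RtoC 1)%C /\
     diam_disk (- phi_L_int (-1) / beta) (phi_L_int 1 / beta) (u z)) /\
  forall x, -1 < x < 1 -> u (RtoC x) = RtoC (phi_L_int x / beta).

Lemma extremal_exists (beta : R) : 0 < beta -> exists u du, extremal_data beta u du.
Proof.
  intros Hb. assert (Nb : RtoC beta <> RtoC 0) by (intros X; apply RtoC_inj in X; lra).
  destruct (subordinate_phi_L_primitive phi_L (subordinate_refl phi_L hol_phi_L)) as (H & dH & H0 & HH).
  exists (fun z => H z / RtoC beta)%C, (fun z => dH z / RtoC beta)%C.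
  split; [rewrite H0; field; exact Nb |]. split.
  - intros z Hz. destruct (HH z Hz) as (A1 & A2 & A3). split; [apply is_cderive_div_const, A1 |].
    split; [rewrite <- A2; field; exact Nb | apply solution_in_disk; assumption].
  - intros x Hx. rewrite (phi_L_primitive_real H dH x H0); [rewrite RtoC_div by lra; reflexivity | | exact Hx].
    intros z Hz. destruct (HH z Hz) as (A1 & A2 & _). split; assumption.
Qed.

Lemma is_cderive_zdlog_of_eq (f P : C -> C) (z l : C) : unit_disk z ->
  (forall z, unit_disk z -> zdlog f z = P z) -> is_cderive P z l -> is_cderive (zdlog f) z l.
Proof.
  intros Hz H HP. unfold unit_disk in Hz. apply is_cderive_locally_ext with P (1 - Cmod z); [lra | | exact HP].
  intros y Hy. symmetry. apply H. unfold unit_disk. assert (X := Cmod_rev y z). lra.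
Qed.

Lemma calG_0 (f : C -> C) : calG f (RtoC 0) = RtoC 0.
Proof. unfold calG. rewrite zdlog_0. unfold Cdiv. ring. Qed.

(** A function with [zdlog f = P] satisfies the hypothesis with [E = phi_L], yet [P] takes at [x] a
    real value that [phi_Ne] omits. *)
Lemma not_sufficient (E : R -> (C -> C) -> C -> C) (b beta : R) (P dP : C -> C) (x y : R) :
  b <= beta -> P (RtoC 0) = RtoC 1 -> (forall z, unit_disk z -> is_cderive P z (dP z)) ->
  (forall f z, unit_disk z -> zdlog f z = P z -> (calG f z * P z = z * dP z)%C -> E beta f z = phi_L z) ->
  -1 < x < 1 -> P (RtoC x) = RtoC y -> (y <= 1 / 3 \/ 5 / 3 <= y) ->
  ~ sufficient_from E b.
Proof.
  intros Hb P0 HP HE Hx Hxy Hy Hs.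
  destruct (class_A_with_zdlog P) as (f & Hf & Hz); [apply is_cderive_hol; intros z D; eexists; apply HP, D | exact P0 |].
  assert (Dx : unit_disk (RtoC x)) by (unfold unit_disk; rewrite Cmod_R; apply Rabs_def1; lra).
  destruct (Hs f beta Hf Hb) as [_ (_ & _ & w & _ & _ & wb & Ew)].
  - exists phi_L. split; [| apply subordinate_refl, hol_phi_L].
    intros z D R0. symmetry. apply HE; [exact D | apply Hz, D |].
    (* [calG_zdlog] excludes 0, where both sides vanish. *)
    destruct (Ceq_dec z (RtoC 0)) as [-> | Hz0]; [rewrite calG_0; ring |].
    rewrite <- (Hz z D). symmetry. apply calG_zdlog; auto; [apply class_A_hol, Hf |].
    apply (is_cderive_zdlog_of_eq f P); auto.
  - assert (Q := phi_Ne_real_range (w (RtoC x)) y (wb _ Dx)). rewrite <- Ew, Hz, Hxy in Q by exact Dx.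
    specialize (Q eq_refl). lra.
Qed.

Lemma best_possible_a : best_possible
  (fun (beta : R) (f : C -> C) (z : C) => (RtoC 1 + RtoC beta * calG f z * zdlog f z)%C) (3 * (1 - ln 2)).
Proof.
  intros b Hb. assert (L2 := ln2_upper).
  (* The bound [b] may be negative or 0; some positive [beta >= b] below the threshold is needed. *)
  set (beta := Rmax b (3 * (1 - ln 2) / 2)).
  assert (B1 : b <= beta) by apply Rmax_l. assert (B2 : 3 * (1 - ln 2) / 2 <= beta) by apply Rmax_r.
  assert (B3 : beta < 3 * (1 - ln 2)) by (apply Rmax_lub_lt; lra).
  assert (B0 : 0 < beta) by lra.
  destruct (extremal_exists beta B0) as (u & du & u0 & Hu & Hux).
  (* Near [-1] the value [u x] drops below [-2 / 3], hence [p] below [1 / 3]. *)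
  destruct (phi_L_int_approach_m1 (- (2 / 3 * beta))) as (x & Hx & Hxy); [rewrite phi_L_int_m1; lra |].
  apply (not_sufficient _ b beta (fun z => RtoC 1 + u z)%C du x (1 + phi_L_int x / beta)); auto.
  - rewrite u0. ring.
  - intros z Hz. apply is_cderive_eq with (RtoC 0 + du z)%C; [| ring].
    apply is_cderive_plus; [apply is_cderive_const | apply Hu, Hz].
  - intros f z Hz E1 E2. rewrite E1, <- Cmult_assoc, E2. destruct (Hu z Hz) as (_ & E3 & _).
    rewrite E3. ring.
  - rewrite Hux by exact Hx. rewrite <- RtoC_plus. reflexivity.
  - left. apply Rmult_le_reg_r with beta; [exact B0 |].
    replace ((1 + phi_L_int x / beta) * beta) with (beta + phi_L_int x) by (field; lra). lra.
Qed.

Lemma best_possible_b : best_possible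
  (fun (beta : R) (f : C -> C) (z : C) => (RtoC 1 + RtoC beta * calG f z)%C)
  (2 * (sqrt 2 + ln 2 - ln (1 + sqrt 2) - 1) / ln (5 / 3)).
Proof.
  rewrite <- phi_L_int_1. intros b Hb. assert (Lp := ln_5_3_pos). assert (Hp := phi_L_int_1_pos).
  set (b0 := phi_L_int 1 / ln (5 / 3)) in *.
  assert (Hb0 : 0 < b0) by (apply Rdiv_lt_0_compat; assumption).
  set (beta := Rmax b (b0 / 2)).
  assert (B1 : b <= beta) by apply Rmax_l. assert (B2 : b0 / 2 <= beta) by apply Rmax_r.
  assert (B3 : beta < b0) by (apply Rmax_lub_lt; lra).
  assert (B0 : 0 < beta) by lra.
  destruct (extremal_exists beta B0) as (u & du & u0 & Hu & Hux).
  (* Near 1 the value [u x] exceeds [ln (5 / 3)], hence [p] exceeds [5 / 3]. *)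
  destruct (phi_L_int_approach_1 (ln (5 / 3) * beta)) as (x & Hx & Hxy).
  { replace (phi_L_int 1) with (ln (5 / 3) * b0) by (unfold b0; field; lra). apply Rmult_lt_compat_l; assumption. }
  apply (not_sufficient _ b beta (fun z => Cexp (u z)) (fun z => Cexp (u z) * du z)%C x (exp (phi_L_int x / beta))); auto.
  - rewrite u0. apply Cexp_0.
  - intros z Hz. apply (is_cderive_comp Cexp u); [apply is_cderive_Cexp | apply Hu, Hz].
  - intros f z Hz E1 E2. destruct (Hu z Hz) as (_ & E3 & _).
    assert (E4 : calG f z = (z * du z)%C).
    { apply (Cmult_cancel_l (Cexp (u z))); [apply Cexp_nz |].
      transitivity (calG f z * Cexp (u z))%C; [ring |]. rewrite E2. ring. }
    rewrite E4, E3. ring.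
  - rewrite Hux by exact Hx. unfold Cexp. rewrite re_RtoC, im_RtoC, cos_0, sin_0.
    unfold RtoC. f_equal; ring.
  - right. rewrite <- (exp_ln (5 / 3)) by lra. left. apply exp_increasing.
    apply Rmult_lt_reg_r with beta; [exact B0 |].
    replace (phi_L_int x / beta * beta) with (phi_L_int x) by (field; lra). exact Hxy.
Qed.

Lemma best_possible_c : best_possible
  (fun (beta : R) (f : C -> C) (z : C) => (RtoC 1 + RtoC beta * calG f z * / zdlog f z)%C)
  (5 * (sqrt 2 + ln 2 - ln (1 + sqrt 2) - 1)).
Proof.
  intros b Hb. assert (E := phi_L_int_1). assert (Hp := phi_L_int_1_pos).
  (* Besides being positive, [beta] must exceed [phi_L_int 1], so that [Re u < 1] and [1 / (1 - u)]
     has no pole; the threshold is [5 / 2 * phi_L_int 1]. *)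
  set (beta := Rmax b (5 / 4 * phi_L_int 1)).
  assert (B1 : b <= beta) by apply Rmax_l. assert (B2 : 5 / 4 * phi_L_int 1 <= beta) by apply Rmax_r.
  assert (B3 : beta < 5 / 2 * phi_L_int 1) by (apply Rmax_lub_lt; lra).
  assert (B0 : 0 < beta) by lra.
  destruct (extremal_exists beta B0) as (u & du & u0 & Hu & Hux).
  assert (Hb1 : phi_L_int 1 / beta < 1).
  { apply Rmult_lt_reg_r with beta; [exact B0 |].
    replace (phi_L_int 1 / beta * beta) with (phi_L_int 1) by (field; lra). lra. }
  assert (N : forall z, unit_disk z -> (RtoC 1 - u z)%C <> RtoC 0).
  { intros z Hz. destruct (Hu z Hz) as (_ & _ & D). unfold diam_disk in D.
    assert (A1 : 0 < phi_L_int 1 / beta) by (apply Rdiv_lt_0_compat; assumption).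
    assert (A2 : 0 < - phi_L_int (-1) / beta) by (apply Rdiv_lt_0_compat; [assert (X := phi_L_int_m1_neg); lra | assumption]).
    apply Re_pos_nz. unfold Cminus. rewrite re_plus, re_opp, re_RtoC. nra. }
  (* [1 / (1 - u)] passes [5 / 3] when [u] passes [2 / 5]. *)
  destruct (phi_L_int_approach_1 (2 / 5 * beta)) as (x & Hx & Hxy); [lra |].
  assert (Hx1 : phi_L_int x < phi_L_int 1) by (apply phi_L_int_increasing; lra).
  apply (not_sufficient _ b beta (fun z => / (RtoC 1 - u z))%C
    (fun z => du z / ((RtoC 1 - u z) * (RtoC 1 - u z)))%C x (/ (1 - phi_L_int x / beta))); auto.
  - rewrite u0. field.
  - intros z Hz. apply is_cderive_eq with (- (RtoC 0 - du z) / ((RtoC 1 - u z) * (RtoC 1 - u z)))%C.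
    + apply (is_cderive_inv (fun z => RtoC 1 - u z)%C); [| apply N, Hz].
      apply is_cderive_minus; [apply is_cderive_const | apply Hu, Hz].
    + field. apply N, Hz.
  - intros f z Hz E1 E2. destruct (Hu z Hz) as (_ & E3 & _). assert (Nz := N z Hz).
    rewrite E1.
    assert (E4 : (calG f z * / / (RtoC 1 - u z))%C = (z * du z)%C).
    { transitivity (calG f z * / (RtoC 1 - u z) * ((RtoC 1 - u z) * (RtoC 1 - u z)))%C; [field; exact Nz |].
      rewrite E2. field. exact Nz. }
    rewrite <- Cmult_assoc, E4, E3. ring.
  - rewrite Hux by exact Hx. rewrite <- RtoC_minus, RtoC_inv; [reflexivity |].
    assert (phi_L_int x / beta < phi_L_int 1 / beta); [| lra].
    apply Rmult_lt_compat_r; [apply Rinv_0_lt_compat, B0 | exact Hx1].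
  - right.
    assert (Q1 : phi_L_int x / beta < phi_L_int 1 / beta) by (apply Rmult_lt_compat_r; [apply Rinv_0_lt_compat, B0 | exact Hx1]).
    assert (Q2 : 2 / 5 < phi_L_int x / beta).
    { apply Rmult_lt_reg_r with beta; [exact B0 |].
      replace (phi_L_int x / beta * beta) with (phi_L_int x) by (field; lra). exact Hxy. }
    replace (5 / 3) with (/ (3 / 5)) by field. apply Rinv_le_contravar; lra.
Qed.

Theorem corollary2p1 :
  (forall (f : C -> C) (beta : R), class_A f ->
     (3 * (1 - ln 2) <= beta ->
      expr_subordinate f
        (fun z : C => (RtoC 1 + RtoC beta * calG f z * zdlog f z)%C) phi_L ->
      Sstar_Ne f) /\
     (2 * (sqrt 2 + ln 2 - ln (1 + sqrt 2) - 1) / ln (5 / 3) <= beta ->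
      expr_subordinate f
        (fun z : C => (RtoC 1 + RtoC beta * calG f z)%C) phi_L ->
      Sstar_Ne f) /\
     (5 * (sqrt 2 + ln 2 - ln (1 + sqrt 2) - 1) <= beta ->
      expr_subordinate f
        (fun z : C => (RtoC 1 + RtoC beta * calG f z * / zdlog f z)%C) phi_L ->
      Sstar_Ne f)) /\
  best_possible
    (fun (beta : R) (f : C -> C) (z : C) =>
       (RtoC 1 + RtoC beta * calG f z * zdlog f z)%C)
    (3 * (1 - ln 2)) /\
  best_possible
    (fun (beta : R) (f : C -> C) (z : C) =>
       (RtoC 1 + RtoC beta * calG f z)%C)
    (2 * (sqrt 2 + ln 2 - ln (1 + sqrt 2) - 1) / ln (5 / 3)) /\
  best_possible
    (fun (beta : R) (f : C -> C) (z : C) =>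
       (RtoC 1 + RtoC beta * calG f z * / zdlog f z)%C)
    (5 * (sqrt 2 + ln 2 - ln (1 + sqrt 2) - 1)).
Proof.
  split; [| split; [apply best_possible_a | split; [apply best_possible_b | apply best_possible_c]]].
  intros f beta Hf. split; [| split].
  - apply sufficient_a, Hf.
  - apply sufficient_b, Hf.
  - apply sufficient_c, Hf.
Qed.
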